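(* For a commutative ring $A$, the point covering families of $A$ for the $(Hens^o,indEt^o)$ factorisation system on $CRings^o$ are the ordinary etale covers of $A$, i.e. the families $\{A\to A_i\}$ of finitely presented etale maps which induce a jointly surjective family of maps on the sets of prime ideals.
   Context: $CRings$ is the category of commutative unital rings. $Et^f$ is the class of etale ring maps (flat and unramified) of finite presentation and $Et^f_*$ the class of etale maps between rings of finite presentation over $\mathbb{Z}$. $Hens$ is the class of ring maps having the unique right lifting property with respect to $Et^f_*$, and $indEt$ is the class of maps having the unique left lifting property with respect to $Hens$; $(indEt,Hens)$ is a unique factorisation system on $CRings$ (left class $indEt$), viewed as $(Hens^o,indEt^o)$ on the opposite category. A ring $K$ is a point of this system if $K\ne0$ and every finitely presented map $K\to B$ in $indEt$ with $B\neq 0$ admits a retraction. A point covering family of $A$ is a family $\{A\to A_i\}$ of finitely presented maps in $indEt$ such that every ring map $A\to K$ with $K$ a point factors through some $A\to A_i$. *)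

(* Defs.v *)
(* MathComp world.  Rings are [comPzRingType]s: unlike the rings over which
   the library builds polynomials and prime ideals, they include the zero
   ring.  Equality of ring maps is pointwise. *)
From HB Require Import structures.
From mathcomp Require Import all_boot all_order all_algebra.

Set Implicit Arguments.
Unset Strict Implicit.
Unset Printing Implicit Defensive.

Import GRing.Theory.
Local Open Scope ring_scope.

(* Polynomial expressions over [A] in [n] variables.  Opposites are products
   with [PConst (-1)]. *)
Inductive pexp (A : Type) (n : nat) : Type :=
  | PConst of A
  | PVar of 'I_n
  | PAdd of pexp A n & pexp A n
  | PMul of pexp A n & pexp A n.

Arguments PConst {A n} _.
Arguments PVar {A n} _.

Fixpoint peval (A B : comPzRingType) (f : {rmorphism A -> B}) (n : nat)
    (x : 'I_n -> B) (t : pexp A n) : B :=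
  match t with
  | PConst a => f a
  | PVar i => x i
  | PAdd t u => peval f x t + peval f x u
  | PMul t u => peval f x t * peval f x u
  end.

(* The least congruence on [pexp A n] that makes the quotient a commutative
   [A]-algebra and kills the expressions in [rs]; the quotient is
   A[X_1, ..., X_n] / (rs). *)
Inductive pres_eq (A : comPzRingType) (n : nat) (rs : seq (pexp A n)) :
    pexp A n -> pexp A n -> Prop :=
  | pres_refl t : pres_eq rs t t
  | pres_sym t u : pres_eq rs t u -> pres_eq rs u t
  | pres_trans t u v : pres_eq rs t u -> pres_eq rs u v -> pres_eq rs t v
  | pres_add t t' u u' : pres_eq rs t t' -> pres_eq rs u u' ->
      pres_eq rs (PAdd t u) (PAdd t' u')
  | pres_mul t t' u u' : pres_eq rs t t' -> pres_eq rs u u' ->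
      pres_eq rs (PMul t u) (PMul t' u')
  | pres_addA t u v : pres_eq rs (PAdd t (PAdd u v)) (PAdd (PAdd t u) v)
  | pres_addC t u : pres_eq rs (PAdd t u) (PAdd u t)
  | pres_add0 t : pres_eq rs (PAdd (PConst 0) t) t
  | pres_mulA t u v : pres_eq rs (PMul t (PMul u v)) (PMul (PMul t u) v)
  | pres_mulC t u : pres_eq rs (PMul t u) (PMul u t)
  | pres_mul1 t : pres_eq rs (PMul (PConst 1) t) t
  | pres_mul0 t : pres_eq rs (PMul (PConst 0) t) (PConst 0)
  | pres_mulD t u v :
      pres_eq rs (PMul t (PAdd u v)) (PAdd (PMul t u) (PMul t v))
  | pres_constD a b : pres_eq rs (PConst (a + b)) (PAdd (PConst a) (PConst b))
  | pres_constM a b : pres_eq rs (PConst (a * b)) (PMul (PConst a) (PConst b))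
  | pres_rel (k : 'I_(size rs)) : pres_eq rs (tnth (in_tuple rs) k) (PConst 0).

(* B is isomorphic, as an A-algebra, to A[X_1, ..., X_n] / (rs) for some n and
   some finite rs, via X_i |-> x i. *)
Definition finitely_presented (A B : comPzRingType) (f : {rmorphism A -> B}) :
    Prop :=
  exists (n : nat) (rs : seq (pexp A n)) (x : 'I_n -> B),
    (forall b : B, exists t : pexp A n, peval f x t = b) /\
    (forall t u : pexp A n, peval f x t = peval f x u <-> pres_eq rs t u).

Definition finitely_presented_ring (R : comPzRingType) : Prop :=
  finitely_presented ((intmul 1 : int -> R) : {rmorphism int -> R}).

(* The elements of M (x)_A B, for B an A-module through f, are represented by
   finite formal sums of pairs (m, b), standing for m (x) b; [tens_eq f] is
   equality in M (x)_A B. *)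
Inductive tens_eq (A B : comPzRingType) (f : {rmorphism A -> B})
    (M : lmodType A) : seq (M * B) -> seq (M * B) -> Prop :=
  | tens_refl s : tens_eq f s s
  | tens_sym s t : tens_eq f s t -> tens_eq f t s
  | tens_trans s t u : tens_eq f s t -> tens_eq f t u -> tens_eq f s u
  | tens_cat s s' t t' : tens_eq f s s' -> tens_eq f t t' ->
      tens_eq f (s ++ t) (s' ++ t')
  | tens_catC s t : tens_eq f (s ++ t) (t ++ s)
  | tens_0l b : tens_eq f [:: (0, b)] [::]
  | tens_Dl m m' b : tens_eq f [:: (m + m', b)] [:: (m, b); (m', b)]
  | tens_Dr m b b' : tens_eq f [:: (m, b + b')] [:: (m, b); (m, b')]
  | tens_Z a m b : tens_eq f [:: (a *: m, b)] [:: (m, f a * b)].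

(* - (x)_A B preserves injections of A-modules. *)
Definition flat (A B : comPzRingType) (f : {rmorphism A -> B}) : Prop :=
  forall (M N : lmodType A) (g : {linear M -> N}), injective g ->
  forall s t : seq (M * B),
    tens_eq f [seq (g x.1, x.2) | x <- s] [seq (g x.1, x.2) | x <- t] ->
    tens_eq f s t.

(* For every A-algebra C (through u) and every quotient p : C -> D by an ideal
   of square zero, a map of A-algebras B -> D has at most one lift B -> C.
   With finite presentation, this is "unramified". *)
Definition unramified (A B : comPzRingType) (f : {rmorphism A -> B}) : Prop :=
  forall (C D : comPzRingType) (p : {rmorphism C -> D}),
    (forall d : D, exists c : C, p c = d) ->
    (forall x y : C, p x = 0 -> p y = 0 -> x * y = 0) ->
  forall (u : {rmorphism A -> C}) (g h : {rmorphism B -> C}),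
    g \o f =1 u -> h \o f =1 u -> p \o g =1 p \o h -> g =1 h.

(* The class Et^f. *)
Definition fp_etale (A B : comPzRingType) (f : {rmorphism A -> B}) : Prop :=
  [/\ flat f, unramified f & finitely_presented f].

(* The class Et^f_*. *)
Definition fp_etale_star (A B : comPzRingType) (f : {rmorphism A -> B}) :
    Prop :=
  [/\ finitely_presented_ring A, finitely_presented_ring B & fp_etale f].

(* f has the unique left lifting property with respect to g. *)
Definition unique_lifting (A B C D : comPzRingType)
    (f : {rmorphism A -> B}) (g : {rmorphism C -> D}) : Prop :=
  forall (u : {rmorphism A -> C}) (v : {rmorphism B -> D}),
    g \o u =1 v \o f ->
  exists h : {rmorphism B -> C},
    [/\ h \o f =1 u, g \o h =1 v &
        forall h' : {rmorphism B -> C},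
          h' \o f =1 u -> g \o h' =1 v -> h' =1 h].

Definition Hens (C D : comPzRingType) (g : {rmorphism C -> D}) : Prop :=
  forall (R S : comPzRingType) (e : {rmorphism R -> S}),
    fp_etale_star e -> unique_lifting e g.

Definition indEt (A B : comPzRingType) (f : {rmorphism A -> B}) : Prop :=
  forall (C D : comPzRingType) (g : {rmorphism C -> D}),
    Hens g -> unique_lifting f g.

Definition is_point (K : comPzRingType) : Prop :=
  (1 : K) <> 0 /\
  forall (B : comPzRingType) (g : {rmorphism K -> B}),
    finitely_presented g -> indEt g -> (1 : B) <> 0 ->
  exists r : {rmorphism B -> K}, r \o g =1 id.

Definition point_covering_family (A : comPzRingType) (I : Type)
    (B : I -> comPzRingType) (f : forall i, {rmorphism A -> B i}) : Prop :=
  (forall i, finitely_presented (f i) /\ indEt (f i)) /\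
  (forall K : comPzRingType, is_point K -> forall u : {rmorphism A -> K},
     exists (i : I) (v : {rmorphism B i -> K}), v \o f i =1 u).

Definition prime_ideal (A : comPzRingType) (p : A -> Prop) : Prop :=
  [/\ p 0,
      forall x y, p x -> p y -> p (x + y),
      forall a x, p x -> p (a * x),
      ~ p 1 &
      forall x y, p (x * y) -> p x \/ p y].

Definition etale_cover (A : comPzRingType) (I : Type)
    (B : I -> comPzRingType) (f : forall i, {rmorphism A -> B i}) : Prop :=
  (forall i, fp_etale (f i)) /\
  (forall p : A -> Prop, prime_ideal p ->
     exists (i : I) (q : B i -> Prop),
       prime_ideal q /\ forall a, p a <-> q (f i a)).

(* Main.v *)
(* An A-algebra is called "jac_etale" here if it has a presentation with as many
   relations as variables whose Jacobian determinant is a unit; all classes of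
   the statement reduce to this one.

   A finitely presented unramified A -> B is a quotient S/I of a jac_etale S with
   I finitely generated.  If A -> B is flat, or lifts uniquely along square-zero
   extensions, then I = I^2, so I is generated by an idempotent and B is
   jac_etale.  Conversely a jac_etale algebra lifts uniquely along square-zero
   extensions (Newton), and is the base change of a jac_etale algebra over
   A0 = Z[c_1, ..., c_N] (take the coefficients as new variables and invert the
   Jacobian determinant), so it remains to see that it is flat over a Noetherian
   A0.  Let P = A0[X], let I be the ideal of the relations g, and let m be an ideal
   of A0.  The Newton step th : X |-> X - J^-1 g is an endomorphism of P which is
   the identity modulo I and maps I into I^2.  Hence, for z in I and in mP, z - th^r z
   lies in mI and th^r z lies in I^(r+1); Krull's theorem then gives z in mI, which
   is the equational criterion for flatness.
   Thus square-zero extensions are in Hens, and for finitely presented maps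
   "indEt" and "etale" coincide.

   Every non-zero ring maps to a non-zero ring K such that each non-zero finitely
   presented K-algebra has a retraction; K is a field and a point.  Applied to the
   residue field of a prime this shows that point covering families are etale
   covers.  In the other direction, given a point K and A -> K, extend K to such a
   K' and take B_i with a prime q over p = ker (A -> K').  By flatness
   (A/p) (x) B_i embeds in K' (x) B_i; it maps onto B_i/q, so K (x) B_i is non-zero
   and has a retraction to K. *)
Require Import Defs.
From Stdlib Require List.
From HB Require Import structures.
From mathcomp Require Import all_boot all_order all_algebra ring.
From mathcomp Require Import boolp classical_sets mpoly.

Set Implicit Arguments.
Unset Strict Implicit.
Unset Printing Implicit Defensive.

Import Order.TTheory GRing.Theory Num.Theory.
Local Open Scope ring_scope.

(** * Rings as quotients by partial equivalence relations *)

(* [pr_rel] is only a partial equivalence: [pr_rel t t] says that the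
   expression t is defined. *)
Record per_ring := PerRing {
  pr_sort : Type;
  pr_rel : pr_sort -> pr_sort -> Prop;
  pr_zero : pr_sort;
  pr_one : pr_sort;
  pr_opp : pr_sort -> pr_sort;
  pr_add : pr_sort -> pr_sort -> pr_sort;
  pr_mul : pr_sort -> pr_sort -> pr_sort;
  pr_sym : forall t u, pr_rel t u -> pr_rel u t;
  pr_trans : forall t u v, pr_rel t u -> pr_rel u v -> pr_rel t v;
  pr_zeroP : pr_rel pr_zero pr_zero;
  pr_oneP : pr_rel pr_one pr_one;
  pr_oppP : forall t t', pr_rel t t' -> pr_rel (pr_opp t) (pr_opp t');
  pr_addP : forall t t' u u', pr_rel t t' -> pr_rel u u' ->
    pr_rel (pr_add t u) (pr_add t' u');
  pr_mulP : forall t t' u u', pr_rel t t' -> pr_rel u u' ->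
    pr_rel (pr_mul t u) (pr_mul t' u');
  pr_addA : forall t u v, pr_rel t t -> pr_rel u u -> pr_rel v v ->
    pr_rel (pr_add t (pr_add u v)) (pr_add (pr_add t u) v);
  pr_addC : forall t u, pr_rel t t -> pr_rel u u ->
    pr_rel (pr_add t u) (pr_add u t);
  pr_add0 : forall t, pr_rel t t -> pr_rel (pr_add pr_zero t) t;
  pr_addN : forall t, pr_rel t t -> pr_rel (pr_add (pr_opp t) t) pr_zero;
  pr_mulA : forall t u v, pr_rel t t -> pr_rel u u -> pr_rel v v ->
    pr_rel (pr_mul t (pr_mul u v)) (pr_mul (pr_mul t u) v);
  pr_mulC : forall t u, pr_rel t t -> pr_rel u u ->
    pr_rel (pr_mul t u) (pr_mul u t);
  pr_mul1 : forall t, pr_rel t t -> pr_rel (pr_mul pr_one t) t;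
  pr_mulD : forall t u v, pr_rel t t -> pr_rel u u -> pr_rel v v ->
    pr_rel (pr_mul (pr_add t u) v) (pr_add (pr_mul t v) (pr_mul u v)) }.

(** A class is stored as a predicate on expressions; by extensionality, related expressions then
    have equal classes. *)
Record pquo (p : per_ring) := Pquo {
  pquo_class : pr_sort p -> Prop;
  _ : exists t, pr_rel t t /\ pquo_class = @pr_rel p t }.

HB.instance Definition _ p := gen_eqMixin (pquo p).
HB.instance Definition _ p := gen_choiceMixin (pquo p).

Section Pquo.
Variable p : per_ring.
Local Notation T := (pr_sort p).
Local Notation E := (@pr_rel p).

Lemma pquo_inj (c d : pquo p) : pquo_class c = pquo_class d -> c = d.
Proof.
by case: c d => [c hc] [d hd] /= e; subst d; rewrite (Prop_irrelevance hc hd).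
Qed.

(** An undefined expression receives the class of zero as a default value. *)
Definition pcls (t : T) : pquo p :=
  match pselect (E t t) with
  | left h => Pquo (ex_intro _ t (conj h erefl))
  | right _ => Pquo (ex_intro _ _ (conj (pr_zeroP p) erefl))
  end.

Lemma pcls_class t : E t t -> pquo_class (pcls t) = E t.
Proof. by rewrite /pcls; case: pselect. Qed.

Lemma pcls_eq t u : E t u -> pcls t = pcls u.
Proof.
move=> tu; have ut := pr_sym tu.
apply: pquo_inj; rewrite !pcls_class; [|exact: pr_trans ut tu|exact: pr_trans tu ut].
apply/funext => v; apply/propext; split; exact: pr_trans.
Qed.

Lemma pcls_rel t u : E t t -> E u u -> pcls t = pcls u -> E t u.
Proof.
move=> tt uu /(congr1 (@pquo_class p)); rewrite !pcls_class // => ->; exact: uu.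
Qed.

Lemma prepr_ex (c : pquo p) : exists t, E t t /\ pcls t = c.
Proof.
case: c => c [t [tt e]]; exists t; split=> //.
by apply: pquo_inj; rewrite pcls_class.
Qed.

Definition prepr c : T := sval (cid (prepr_ex c)).

Lemma preprP c : E (prepr c) (prepr c) /\ pcls (prepr c) = c.
Proof. exact: (svalP (cid (prepr_ex c))). Qed.

Lemma prepr_dom c : E (prepr c) (prepr c). Proof. by case: (preprP c). Qed.
Lemma preprK c : pcls (prepr c) = c. Proof. by case: (preprP c). Qed.

Lemma prepr_cls t : E t t -> E (prepr (pcls t)) t.
Proof. by move=> tt; apply: pcls_rel => //; [exact: prepr_dom | rewrite preprK]. Qed.

Definition pquo_add c d := pcls (pr_add (prepr c) (prepr d)).
Definition pquo_mul c d := pcls (pr_mul (prepr c) (prepr d)).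
Definition pquo_opp c := pcls (pr_opp (prepr c)).

Lemma pquo_addE t u : E t t -> E u u -> pquo_add (pcls t) (pcls u) = pcls (pr_add t u).
Proof. by move=> tt uu; apply: pcls_eq; apply: pr_addP; apply: prepr_cls. Qed.
Lemma pquo_mulE t u : E t t -> E u u -> pquo_mul (pcls t) (pcls u) = pcls (pr_mul t u).
Proof. by move=> tt uu; apply: pcls_eq; apply: pr_mulP; apply: prepr_cls. Qed.
Lemma pquo_oppE t : E t t -> pquo_opp (pcls t) = pcls (pr_opp t).
Proof. by move=> tt; apply: pcls_eq; apply: pr_oppP; apply: prepr_cls. Qed.

Lemma pquoP (P : pquo p -> Prop) : (forall t, E t t -> P (pcls t)) -> forall c, P c.
Proof. by move=> h c; rewrite -(preprK c); apply: h; exact: prepr_dom. Qed.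

Fact pquo_addrA : associative pquo_add.
Proof.
elim/pquoP => t tt; elim/pquoP => u uu; elim/pquoP => v vv.
rewrite !pquo_addE //; do ?exact: pr_addP; exact/pcls_eq/pr_addA.
Qed.
Fact pquo_addrC : commutative pquo_add.
Proof.
elim/pquoP => t tt; elim/pquoP => u uu.
rewrite !pquo_addE //; exact/pcls_eq/pr_addC.
Qed.
Fact pquo_add0r : left_id (pcls (pr_zero p)) pquo_add.
Proof.
elim/pquoP => t tt; rewrite pquo_addE //; [exact/pcls_eq/pr_add0|exact: pr_zeroP].
Qed.
Fact pquo_addNr : left_inverse (pcls (pr_zero p)) pquo_opp pquo_add.
Proof.
elim/pquoP => t tt; rewrite pquo_oppE // pquo_addE //; last exact: pr_oppP.
exact/pcls_eq/pr_addN.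
Qed.

HB.instance Definition _ := GRing.isZmodule.Build (pquo p)
  pquo_addrA pquo_addrC pquo_add0r pquo_addNr.

Fact pquo_mulrA : associative pquo_mul.
Proof.
elim/pquoP => t tt; elim/pquoP => u uu; elim/pquoP => v vv.
rewrite !pquo_mulE //; do ?exact: pr_mulP; exact/pcls_eq/pr_mulA.
Qed.
Fact pquo_mulrC : commutative pquo_mul.
Proof.
elim/pquoP => t tt; elim/pquoP => u uu.
rewrite !pquo_mulE //; exact/pcls_eq/pr_mulC.
Qed.
Fact pquo_mul1r : left_id (pcls (pr_one p)) pquo_mul.
Proof.
elim/pquoP => t tt; rewrite pquo_mulE //; [exact/pcls_eq/pr_mul1|exact: pr_oneP].
Qed.
Fact pquo_mulrDl : left_distributive pquo_mul pquo_add.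
Proof.
elim/pquoP => t tt; elim/pquoP => u uu; elim/pquoP => v vv.
rewrite (pquo_addE tt uu) (pquo_mulE tt vv) (pquo_mulE uu vv).
rewrite (pquo_mulE _ vv) ?(pquo_addE (pr_mulP tt vv) (pr_mulP uu vv)).
  exact/pcls_eq/pr_mulD.
exact: pr_addP.
Qed.

HB.instance Definition _ := GRing.Zmodule_isComPzRing.Build (pquo p)
  pquo_mulrA pquo_mulrC pquo_mul1r pquo_mulrDl.

Lemma pclsD t u : E t t -> E u u -> pcls (pr_add t u) = pcls t + pcls u.
Proof. by move=> tt uu; exact: (esym (pquo_addE tt uu)). Qed.
Lemma pclsM t u : E t t -> E u u -> pcls (pr_mul t u) = pcls t * pcls u.
Proof. by move=> tt uu; exact: (esym (pquo_mulE tt uu)). Qed.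
Lemma pcls0 : pcls (pr_zero p) = 0. Proof. by []. Qed.
Lemma pcls1 : pcls (pr_one p) = 1. Proof. by []. Qed.

End Pquo.

(** Compatibility with 0 and with opposites follows by cancellation. The bundled map is controlled
    only up to pointwise equality. *)
Lemma rmorph_of (A B : comPzRingType) (f : A -> B) :
  (forall x y, f (x + y) = f x + f y) -> (forall x y, f (x * y) = f x * f y) ->
  f 1 = 1 -> exists g : {rmorphism A -> B}, g =1 f.
Proof.
move=> fD fM f1.
have f0 : f 0 = 0 by apply: (addIr (f 0)); rewrite -fD !add0r.
have fN x : f (- x) = - f x by apply: (addIr (f x)); rewrite -fD !addNr.
have fB : zmod_morphism f by move=> x y; rewrite fD fN.
have fm : monoid_morphism f by split.
pose m1 := GRing.isZmodMorphism.Build _ _ f fB.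
pose m2 := GRing.isMonoidMorphism.Build _ _ f fm.
pose g : {rmorphism A -> B} := HB.pack f m1 m2.
by exists g.
Qed.

(** * Ideals and quotient rings *)

Inductive idl (R : comPzRingType) (S : R -> Prop) : R -> Prop :=
  | idl0 : idl S 0
  | idl_mem a s : S s -> idl S (a * s)
  | idlD x y : idl S x -> idl S y -> idl S (x + y).

Section Idl.
Variable R : comPzRingType.
Implicit Types S : R -> Prop.

Lemma idl_in S s : S s -> idl S s.
Proof. by move=> ss; rewrite -[s]mul1r; apply: idl_mem. Qed.

Lemma idlM S a x : idl S x -> idl S (a * x).
Proof.
elim=> [|b s ss|y z _ hy _ hz]; first by rewrite mulr0; exact: idl0.
- by rewrite mulrA; apply: idl_mem.
- by rewrite mulrDr; apply: idlD.
Qed.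

Lemma idlMr S a x : idl S x -> idl S (x * a).
Proof. by rewrite mulrC; exact: idlM. Qed.

Lemma idlN S x : idl S x -> idl S (- x).
Proof. by rewrite -mulN1r; exact: idlM. Qed.

Lemma idlB S x y : idl S x -> idl S y -> idl S (x - y).
Proof. by move=> hx hy; apply: idlD => //; apply: idlN. Qed.

Lemma idl_sum S (J : Type) (r : seq J) (P : pred J) (F : J -> R) :
  (forall j, P j -> idl S (F j)) -> idl S (\sum_(j <- r | P j) F j).
Proof. by move=> h; elim/big_rec: _ => [|j x Pj hx]; [exact: idl0|exact: idlD (h _ Pj) hx]. Qed.

Lemma idl_sub S S' x : (forall s, S s -> idl S' s) -> idl S x -> idl S' x.
Proof.
move=> h; elim=> [|a s /h ss|y z _ hy _ hz]; [exact: idl0|exact: idlM|exact: idlD].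
Qed.

Lemma idl_eq S x y : idl S (x - y) -> idl S y -> idl S x.
Proof. by move=> h1 h2; rewrite -[x](subrK y); apply: idlD. Qed.

Definition fam (m : nat) (y : 'I_m -> R) : R -> Prop := fun s => exists i, s = y i.

Lemma idl_famP (m : nat) (y : 'I_m -> R) x :
  idl (fam y) x -> exists c : 'I_m -> R, x = \sum_i c i * y i.
Proof.
elim=> [|a s [i ->]|u v _ [c ->] _ [d ->]].
- by exists (fun=> 0); rewrite big1 // => i _; rewrite mul0r.
- exists (fun j => if j == i then a else 0).
  rewrite (bigD1 i) //= eqxx big1 ?addr0 // => j /negPf ->; exact: mul0r.
- exists (fun i => c i + d i); rewrite -big_split /=.
  by apply: eq_bigr => i _; rewrite mulrDl.
Qed.

Definition prods S S' : R -> Prop := fun s => exists a b, [/\ S a, S' b & s = a * b].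

End Idl.

Lemma idl_morph (R R' : comPzRingType) (g : {rmorphism R -> R'}) S S' x :
  (forall s, S s -> idl S' (g s)) -> idl S x -> idl S' (g x).
Proof.
move=> h; elim=> [|a s /h ss|y z _ hy _ hz].
- by rewrite rmorph0; exact: idl0.
- by rewrite rmorphM; exact: idlM.
- by rewrite rmorphD; exact: idlD.
Qed.

Lemma idl_ker (R R' : comPzRingType) (g : {rmorphism R -> R'}) S x :
  (forall s, S s -> g s = 0) -> idl S x -> g x = 0.
Proof.
move=> h; elim=> [|a s /h ss|y z _ hy _ hz].
- by rewrite rmorph0.
- by rewrite rmorphM ss mulr0.
- by rewrite rmorphD hy hz addr0.
Qed.

Section Quot.
Variables (R : comPzRingType) (S : R -> Prop).
Local Notation E := (fun x y : R => idl S (x - y)).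

Lemma quo_refl x y : x = y -> E x y.
Proof. by move=> ->; rewrite subrr; exact: idl0. Qed.

Definition quo_per : per_ring.
Proof.
refine (@PerRing R E 0 1 -%R +%R *%R _ _ _ _ _ _ _ _ _ _ _ _ _ _ _);
  try by (move=> *; apply: quo_refl; rewrite /= ?(addrA, add0r, addNr, mulrA, mul1r, mulrDl)).
- by move=> t u h; rewrite -opprB; exact: idlN.
- by move=> t u v h1 h2; rewrite -[t](subrK u) -addrA; exact: idlD.
- by move=> t u h; rewrite -opprD; exact: idlN.
- by move=> t t' u u' h1 h2; rewrite opprD addrACA; exact: idlD.
- move=> t t' u u' h1 h2.
  rewrite (_ : _ - _ = (t - t') * u + t' * (u - u')).
    by apply: idlD; [exact: idlMr|exact: idlM].
  by rewrite mulrBl mulrBr addrA subrK.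
- by move=> t u _ _; apply: quo_refl; rewrite addrC.
- by move=> t u _ _; apply: quo_refl; rewrite mulrC.
Defined.

Definition quot := pquo quo_per.

Lemma quot_proj : exists q : {rmorphism R -> quot},
  (forall c, exists x, q x = c) /\ (forall x, q x = 0 <-> idl S x).
Proof.
have refl (x : R) : @pr_rel quo_per x x by exact: quo_refl.
have [q qE] : exists q : {rmorphism R -> quot}, q =1 @pcls quo_per.
  apply: rmorph_of => // x y.
  - by rewrite -(pclsD (refl x) (refl y)).
  - by rewrite -(pclsM (refl x) (refl y)).
exists q; split=> [c|x]; first by exists (prepr c); rewrite qE preprK.
rewrite qE -pcls0; split=> [/pcls_rel|h].
  by move=> /(_ (refl x) (refl _)) /=; rewrite subr0.
by apply: pcls_eq => /=; rewrite subr0.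
Qed.

Definition qin : {rmorphism R -> quot} := sval (cid quot_proj).
Lemma qin_surj c : exists x, qin x = c.
Proof. by case: (svalP (cid quot_proj)) => h _; exact: h. Qed.
Lemma qin_eq0 x : qin x = 0 <-> idl S x.
Proof. by case: (svalP (cid quot_proj)) => _ h; exact: h. Qed.

End Quot.

(** * Presented algebras *)

Section Peval.
Variables (A : comPzRingType) (n : nat).

Lemma peval_morph (B C : comPzRingType) (f : {rmorphism A -> B})
    (h : {rmorphism B -> C}) (g : {rmorphism A -> C}) (x : 'I_n -> B) (y : 'I_n -> C) t :
  h \o f =1 g -> (forall i, h (x i) = y i) -> h (peval f x t) = peval g y t.
Proof.
move=> hf hx; elim: t => /= [a|i|t IHt u IHu|t IHt u IHu].
- exact: hf.
- exact: hx.
- by rewrite rmorphD IHt IHu.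
- by rewrite rmorphM IHt IHu.
Qed.

Lemma eq_peval (B : comPzRingType) (f : {rmorphism A -> B}) (x y : 'I_n -> B) t :
  x =1 y -> peval f x t = peval f y t.
Proof. by move=> xy; elim: t => //= t -> u ->. Qed.

Definition kills (B : comPzRingType) (f : {rmorphism A -> B}) (x : 'I_n -> B) rs :=
  forall t : pexp A n, List.In t rs -> peval f x t = 0.

Lemma kills_morph (B C : comPzRingType) (f : {rmorphism A -> B})
    (h : {rmorphism B -> C}) (g : {rmorphism A -> C}) (x : 'I_n -> B) (y : 'I_n -> C) rs :
  h \o f =1 g -> (forall i, h (x i) = y i) -> kills f x rs -> kills g y rs.
Proof. by move=> hf hx k t /k; rewrite -(peval_morph t hf hx) => ->; rewrite rmorph0. Qed.

Lemma tnth_In (T : Type) (s : seq T) k : List.In (tnth (in_tuple s) k) s.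
Proof.
case: s k => [[]//|x s] [k kP]; rewrite (tnth_nth x) /=; elim: s x k kP => [|y s IH] x [|k] //= kP.
- by left.
- by left.
- by right; rewrite (set_nth_default y) //; exact: IH.
Qed.

Lemma In_tnth (T : Type) (s : seq T) t : List.In t s -> exists k, tnth (in_tuple s) k = t.
Proof.
elim: s => [//|x s IH] /= [<-|/IH [k <-]]; first by exists ord0.
by exists (lift ord0 k); rewrite !(tnth_nth x) /=.
Qed.

Lemma pres_eq_sound (B : comPzRingType) (f : {rmorphism A -> B}) (x : 'I_n -> B) rs t u :
  kills f x rs -> pres_eq rs t u -> peval f x t = peval f x u.
Proof.
move=> k; elim=> //=.
- by move=> t' u' v _ -> _ ->.
- by move=> t1 t2 u1 u2 _ -> _ ->.
- by move=> t1 t2 u1 u2 _ -> _ ->.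
- by move=> *; rewrite addrA.
- by move=> *; rewrite addrC.
- by move=> *; rewrite rmorph0 add0r.
- by move=> *; rewrite mulrA.
- by move=> *; rewrite mulrC.
- by move=> *; rewrite rmorph1 mul1r.
- by move=> *; rewrite rmorph0 mul0r.
- by move=> *; rewrite mulrDr.
- by move=> *; rewrite rmorphD.
- by move=> *; rewrite rmorphM.
- by move=> i; rewrite rmorph0; apply: k; exact: tnth_In.
Qed.

Definition presented (B : comPzRingType) (f : {rmorphism A -> B}) rs (x : 'I_n -> B) :=
  (forall b : B, exists t : pexp A n, peval f x t = b) /\
  (forall t u : pexp A n, peval f x t = peval f x u <-> pres_eq rs t u).

Lemma gen_eq (B C : comPzRingType) (f : {rmorphism A -> B}) (x : 'I_n -> B)
    (h h' : {rmorphism B -> C}) :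
  (forall b : B, exists t : pexp A n, peval f x t = b) ->
  h \o f =1 h' \o f -> (forall i, h (x i) = h' (x i)) -> h =1 h'.
Proof.
move=> gen hf hx b; have [t <-] := gen b.
elim: t => /= [a|i|t IHt u IHu|t IHt u IHu].
- exact: hf.
- exact: hx.
- by rewrite !rmorphD IHt IHu.
- by rewrite !rmorphM IHt IHu.
Qed.

Lemma presented_kills (B : comPzRingType) (f : {rmorphism A -> B}) rs (x : 'I_n -> B) :
  presented f rs x -> kills f x rs.
Proof.
move=> [_ ke] t ht; have [k <-] := In_tnth ht.
rewrite ((ke _ _).2 (pres_rel k)); exact: rmorph0.
Qed.

(** The universal property of $A[X]/(rs)$: an element is mapped by evaluating any expression of it,
    and soundness of [pres_eq] makes the choice irrelevant. *)
Lemma presented_ext (B : comPzRingType) (f : {rmorphism A -> B}) rs (x : 'I_n -> B)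
    (C : comPzRingType) (g : {rmorphism A -> C}) (y : 'I_n -> C) :
  presented f rs x -> kills g y rs ->
  exists h : {rmorphism B -> C}, h \o f =1 g /\ forall i, h (x i) = y i.
Proof.
move=> [gen ke] k.
pose h b := peval g y (sval (cid (gen b))).
have hE t : h (peval f x t) = peval g y t.
  by rewrite /h; case: cid => u /= /ke; exact: pres_eq_sound.
have [h' h'E] : exists h' : {rmorphism B -> C}, h' =1 h.
  apply: rmorph_of => [b b'|b b'|].
  - by have [t <-] := gen b; have [u <-] := gen b'; rewrite -/(peval f x (PAdd t u)) !hE.
  - by have [t <-] := gen b; have [u <-] := gen b'; rewrite -/(peval f x (PMul t u)) !hE.
  - by rewrite -(rmorph1 f) -/(peval f x (PConst 1)) hE /= rmorph1.
exists h'; split=> [a|i]; rewrite /= h'E.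
- by rewrite -/(peval f x (PConst a)) hE.
- by rewrite -/(peval f x (PVar i)) hE.
Qed.

Definition pres_per (rs : seq (pexp A n)) : per_ring.
Proof.
refine (@PerRing (pexp A n) (pres_eq rs) (PConst 0) (PConst 1)
  (PMul (PConst (-1))) (@PAdd A n) (@PMul A n) _ _ _ _ _ _ _ _ _ _ _ _ _ _ _).
- exact: pres_sym.
- exact: pres_trans.
- exact: pres_refl.
- exact: pres_refl.
- by move=> t t' h; apply: pres_mul => //; exact: pres_refl.
- by move=> *; exact: pres_add.
- by move=> *; exact: pres_mul.
- by move=> *; exact: pres_addA.
- by move=> *; exact: pres_addC.
- by move=> *; exact: pres_add0.
- move=> t _.
  apply: (@pres_trans _ _ _ _ (PMul t (PAdd (PConst (-1)) (PConst 1)))).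
    apply: pres_trans (pres_sym (pres_mulD _ _ _ _)).
    apply: pres_add; first exact: pres_mulC.
    exact: pres_trans (pres_sym (pres_mul1 _ _)) (pres_mulC _ _ _).
  apply: pres_trans (pres_mulC _ _ _) _; apply: pres_trans (pres_mul0 _ t).
  apply: pres_mul; last exact: pres_refl.
  by apply: pres_trans (pres_sym (pres_constD _ _ _)) _; rewrite addNr; exact: pres_refl.
- by move=> *; exact: pres_mulA.
- by move=> *; exact: pres_mulC.
- by move=> *; exact: pres_mul1.
- move=> t u v _ _ _; apply: pres_trans (pres_mulC _ _ _) _.
  apply: pres_trans (pres_mulD _ _ _ _) _.
  by apply: pres_add; exact: pres_mulC.
Defined.

(** For [rs] empty this is the polynomial ring $A[X_1, ..., X_n]$, over the zero ring as well. *)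
Definition pa rs := pquo (pres_per rs).

Lemma pa_refl rs (t : pexp A n) : @pr_rel (pres_per rs) t t.
Proof. exact: pres_refl. Qed.

Lemma pa_in_ex rs : exists f : {rmorphism A -> pa rs},
  f =1 fun a => @pcls (pres_per rs) (PConst a).
Proof.
apply: rmorph_of => [a b|a b|//].
- rewrite -(pclsD (pa_refl _ _) (pa_refl _ _)); apply: pcls_eq; exact: pres_constD.
- rewrite -(pclsM (pa_refl _ _) (pa_refl _ _)); apply: pcls_eq; exact: pres_constM.
Qed.

Definition pa_in rs : {rmorphism A -> pa rs} := sval (cid (pa_in_ex rs)).
Definition pa_var rs (i : 'I_n) : pa rs := @pcls (pres_per rs) (PVar i).

Lemma peval_pa rs t : peval (pa_in rs) (pa_var rs) t = @pcls (pres_per rs) t.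
Proof.
elim: t => /= [a|i|t IHt u IHu|t IHt u IHu] //.
- exact: (svalP (cid (pa_in_ex rs))).
- by rewrite IHt IHu -(pclsD (pa_refl _ _) (pa_refl _ _)).
- by rewrite IHt IHu -(pclsM (pa_refl _ _) (pa_refl _ _)).
Qed.

Lemma pa_presented rs : presented (pa_in rs) rs (pa_var rs).
Proof.
split=> [b|t u]; first by exists (prepr b); rewrite peval_pa preprK.
rewrite !peval_pa; split=> [h|h]; last exact: (@pcls_eq (pres_per rs)) h.
by apply: (@pcls_rel (pres_per rs)) => //; exact: pa_refl.
Qed.

(** The map [h] back to the presented algebra shows that the relations generate the kernel:
    expressions with equal values in [B] have equal classes in [pa rs]. *)
Lemma presented_intro (B : comPzRingType) (f : {rmorphism A -> B}) rs (x : 'I_n -> B)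
    (h : {rmorphism B -> pa rs}) :
  (forall b : B, exists t : pexp A n, peval f x t = b) -> kills f x rs ->
  h \o f =1 pa_in rs -> (forall i, h (x i) = pa_var rs i) -> presented f rs x.
Proof.
move=> gen k hf hx; split=> // t u; split; last exact: pres_eq_sound.
move=> /(congr1 h); rewrite !(peval_morph _ hf hx).
by move/(pa_presented rs).2.
Qed.

End Peval.

(** * Jacobian matrices *)

Fixpoint pderiv (A : comPzRingType) n (i : 'I_n) (t : pexp A n) : pexp A n :=
  match t with
  | PConst _ => PConst 0
  | PVar j => PConst (i == j)%:R
  | PAdd t u => PAdd (pderiv i t) (pderiv i u)
  | PMul t u => PAdd (PMul (pderiv i t) u) (PMul t (pderiv i u))
  end.

Fixpoint pmap (A A' : Type) n m (g : A -> A') (s : 'I_n -> 'I_m) (t : pexp A n) : pexp A' m :=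
  match t with
  | PConst a => PConst (g a)
  | PVar j => PVar (s j)
  | PAdd t u => PAdd (pmap g s t) (pmap g s u)
  | PMul t u => PMul (pmap g s t) (pmap g s u)
  end.

Section Pderiv.
Variables (A : comPzRingType) (n : nat).

(** First-order Taylor expansion without remainder: the coefficients [M] agree with the partial
    derivatives only modulo the increments. The exact form allows determinants of [M] to be taken
    later. *)
Lemma hadamard (B : comPzRingType) (f : {rmorphism A -> B}) (x e : 'I_n -> B) t :
  exists M : 'I_n -> B,
    peval f (fun i => x i + e i) t = peval f x t + \sum_i M i * e i /\
    forall i, idl (fam e) (M i - peval f x (pderiv i t)).
Proof.
elim: t => /= [a|j|t [M [eM hM]] u [M' [eM' hM']]|t [M [eM hM]] u [M' [eM' hM']]].
- exists (fun=> 0); split=> [|i]; last by rewrite rmorph0 subrr; exact: idl0.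
  by rewrite big1 ?addr0 // => i _; rewrite mul0r.
- exists (fun i => (i == j)%:R); split=> [|i]; last first.
    by rewrite rmorph_nat subrr; exact: idl0.
  rewrite (bigD1 j) //= eqxx mul1r big1 ?addr0 // => i /negPf ->; exact: mul0r.
- exists (fun i => M i + M' i); split=> [|i]; last by rewrite opprD addrACA; exact: idlD.
  rewrite eM eM' addrACA -big_split /=; congr (_ + _).
  by apply: eq_bigr => i _; rewrite mulrDl.
- set u' := peval f (fun i => x i + e i) u in eM' *.
  exists (fun i => M i * u' + peval f x t * M' i); split=> [|i].
    rewrite eM mulrDl {1}eM' mulrDr -addrA; congr (_ + _).
    rewrite mulr_sumr mulr_suml -big_split /=; apply: eq_bigr => i _.
    by rewrite mulrDl addrC -mulrA; congr (_ + _); rewrite mulrA // mulrAC.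
  rewrite [X in idl _ X](_ : _ = (M i - peval f x (pderiv i t)) * u' +
    peval f x (pderiv i t) * (u' - peval f x u) +
    peval f x t * (M' i - peval f x (pderiv i u))).
    apply: idlD; [apply: idlD|].
    + exact: idlMr.
    + rewrite eM' addrC addKr; apply: idlM; apply: idl_sum => j _.
      by apply: idl_mem; exists j.
    + exact: idlM.
  ring.
Qed.

Definition rels m (g : 'I_m -> pexp A n) : seq (pexp A n) := [seq g i | i <- enum 'I_m].

Lemma In_rels m (g : 'I_m -> pexp A n) t : List.In t (rels g) <-> exists i, t = g i.
Proof.
split=> [/List.in_map_iff[i [<- _]]|[i ->]]; first by exists i.
apply: List.in_map; have : i \in enum 'I_m by rewrite mem_enum.
by elim: (enum _) => //= j r IH; rewrite inE => /predU1P[->|/IH]; [left|right].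
Qed.

Lemma killsP (B : comPzRingType) (f : {rmorphism A -> B}) (x : 'I_n -> B) m (g : 'I_m -> pexp A n) :
  kills f x (rels g) <-> forall i, peval f x (g i) = 0.
Proof.
by split=> [h i|h t /In_rels[i ->]]; apply: h; apply/In_rels; exists i.
Qed.

Lemma psum_peval (B : comPzRingType) (f : {rmorphism A -> B}) (x : 'I_n -> B) m
    (g : 'I_m -> pexp A n) :
  peval f x (\big[(@PAdd A n)/PConst 0]_l g l) = \sum_l peval f x (g l).
Proof. by apply: (big_morph (peval f x)) => //=; exact: rmorph0. Qed.

Lemma psum_pderiv i m (g : 'I_m -> pexp A n) :
  pderiv i (\big[(@PAdd A n)/PConst 0]_l g l) = \big[(@PAdd A n)/PConst 0]_l pderiv i (g l).
Proof. exact: (big_morph (pderiv i)). Qed.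

Definition jac (B : comPzRingType) (f : {rmorphism A -> B}) (x : 'I_n -> B) m
    (g : 'I_m -> pexp A n) : 'M[B]_(m, n) :=
  \matrix_(i, j) peval f x (pderiv j (g i)).

Lemma jac_morph (B C : comPzRingType) (f : {rmorphism A -> B})
    (h : {rmorphism B -> C}) (f' : {rmorphism A -> C}) (x : 'I_n -> B) (y : 'I_n -> C)
    m (g : 'I_m -> pexp A n) :
  h \o f =1 f' -> (forall i, h (x i) = y i) -> map_mx h (jac f x g) = jac f' y g.
Proof. by move=> hf hx; apply/matrixP => i j; rewrite !mxE; exact: peval_morph. Qed.

Lemma pa0_ext (C : comPzRingType) (f : {rmorphism A -> C}) (y : 'I_n -> C) :
  exists h : {rmorphism pa [::] -> C},
    h \o pa_in [::] =1 f /\ forall i, h (@pa_var A n [::] i) = y i.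
Proof. by apply: (presented_ext (pa_presented _)) => t []. Qed.

(** The determinant is formed at the generic point, the variables of the polynomial ring, and then
    specialised. *)
Lemma det_pexp (g : 'I_n -> pexp A n) :
  exists d : pexp A n, forall (B : comPzRingType) (f : {rmorphism A -> B}) (x : 'I_n -> B),
    peval f x d = \det (jac f x g).
Proof.
have [d dE] := (pa_presented [::]).1 (\det (jac (pa_in [::]) (@pa_var A n [::]) g)).
exists d => B f x; have [h [hf hx]] := pa0_ext f x.
by rewrite -(peval_morph d hf hx) dE -det_map_mx (jac_morph _ hf hx).
Qed.

End Pderiv.

Section Pmap.
Variables (A A' : comPzRingType) (n m : nat) (g : {rmorphism A -> A'}) (s : 'I_n -> 'I_m).

Lemma peval_pmap (B : comPzRingType) (f : {rmorphism A -> B}) (f' : {rmorphism A' -> B})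
    (x : 'I_n -> B) (y : 'I_m -> B) t :
  f' \o g =1 f -> (forall i, y (s i) = x i) -> peval f' y (pmap g s t) = peval f x t.
Proof.
by move=> hf hx; elim: t => /= [a|i|t -> u ->|t -> u ->] //; exact: hf.
Qed.

Lemma pderiv_pmap i t : injective s -> pderiv (s i) (pmap g s t) = pmap g s (pderiv i t).
Proof.
move=> inj; elim: t => /= [a|j|t -> u ->|t -> u ->] //.
  by rewrite rmorph0.
by rewrite (inj_eq inj) rmorph_nat.
Qed.

Lemma pderiv_pmap0 (B : comPzRingType) (f' : {rmorphism A' -> B}) (y : 'I_m -> B) j t :
  (forall i, s i != j) -> peval f' y (pderiv j (pmap g s t)) = 0.
Proof.
move=> h; elim: t => /= [a|i|t -> u ->|t -> u ->].
- exact: rmorph0.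
- by rewrite eq_sym (negPf (h i)) rmorph0.
- exact: addr0.
- by rewrite mul0r mulr0 addr0.
Qed.

End Pmap.

Section Ext.
Variables (A : comPzRingType) (n : nat).

Definition wk : pexp A n -> pexp A (n + 1) := pmap id (lshift 1).

Lemma peval_wk (B : comPzRingType) (f : {rmorphism A -> B}) (y : 'I_(n + 1) -> B) t :
  peval f y (wk t) = peval f (y \o lshift 1) t.
Proof. exact: (peval_pmap (g := idfun)). Qed.

(* Adjoins a variable Y and the equation Y h = 1, which inverts h. *)
Definition ext (g : 'I_n -> pexp A n) (h : pexp A n) (i : 'I_(n + 1)) : pexp A (n + 1) :=
  match split i with
  | inl i => wk (g i)
  | inr _ => PAdd (PMul (PVar (rshift n ord0)) (wk h)) (PConst (-1))
  end.

Definition extp (B : Type) (x : 'I_n -> B) (z : B) (i : 'I_(n + 1)) : B :=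
  match split i with inl i => x i | inr _ => z end.

Lemma extp_l B (x : 'I_n -> B) z i : extp x z (lshift 1 i) = x i.
Proof. by rewrite /extp (unsplitK (inl i : 'I_n + 'I_1)%type). Qed.
Lemma extp_r B (x : 'I_n -> B) z i : extp x z (rshift n i) = z.
Proof. by rewrite /extp (unsplitK (inr i : 'I_n + 'I_1)%type). Qed.
Lemma ext_l g h i : ext g h (lshift 1 i) = wk (g i).
Proof. by rewrite /ext (unsplitK (inl i : 'I_n + 'I_1)%type). Qed.
Lemma ext_r g h i :
  ext g h (rshift n i) = PAdd (PMul (PVar (rshift n ord0)) (wk h)) (PConst (-1)).
Proof. by rewrite /ext (unsplitK (inr i : 'I_n + 'I_1)%type). Qed.

Lemma ord_ext (P : 'I_(n + 1) -> Prop) :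
  (forall i, P (lshift 1 i)) -> P (rshift n ord0) -> forall i, P i.
Proof.
by move=> hl hr i; rewrite -(splitK i); case: (split i) => j /=; [exact: hl|rewrite (ord1 j)].
Qed.

Lemma kills_ext (B : comPzRingType) (f : {rmorphism A -> B}) (y : 'I_(n + 1) -> B) g h :
  kills f y (rels (ext g h)) <->
  kills f (y \o lshift 1) (rels g) /\
  y (rshift n ord0) * peval f (y \o lshift 1) h = 1.
Proof.
rewrite !killsP; split=> [k|[k kr] i].
  split=> [i|]; first by rewrite -peval_wk -(ext_l g h).
  have := k (rshift n ord0); rewrite ext_r /= rmorphN1 peval_wk.
  by move/eqP; rewrite subr_eq0 => /eqP.
elim/ord_ext: i => [i|]; first by rewrite ext_l peval_wk.
by rewrite ext_r /= rmorphN1 peval_wk kr subrr.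
Qed.

(** The old relations do not involve the new variable, so the Jacobian matrix is block lower
    triangular; its last diagonal entry is the derivative of $Y h - 1$ in $Y$, which is $h$. *)
Lemma det_ext (B : comPzRingType) (f : {rmorphism A -> B}) (y : 'I_(n + 1) -> B) g h :
  \det (jac f y (ext g h)) =
  \det (jac f (y \o lshift 1) g) * peval f (y \o lshift 1) h.
Proof.
rewrite -(submxK (jac f y (ext g h))).
have -> : ursubmx (jac f y (ext g h)) = 0.
  apply/matrixP => i j; rewrite !mxE ext_l; apply: (pderiv_pmap0 idfun) => k.
  by rewrite eq_lrshift.
rewrite det_lblock; congr (_ * _).
  congr (\det _); apply/matrixP => i j; rewrite !mxE ext_l -peval_wk.
  by rewrite /wk (pderiv_pmap idfun) //; exact: lshift_inj.
rewrite det_mx11 !mxE ext_r /= (ord1 0) eqxx rmorph1 rmorph0 mul1r addr0 peval_wk.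
rewrite (pderiv_pmap0 idfun) ?mulr0 ?addr0 // => k.
by rewrite eq_lrshift.
Qed.

End Ext.

Lemma choice_fun (X Y : Type) (P : X -> Y -> Prop) :
  (forall x, exists y, P x y) -> exists g : X -> Y, forall x, P x (g x).
Proof. by move=> h; exists (fun x => sval (cid (h x))) => x; exact: svalP (cid (h x)). Qed.

Lemma hadamard_mx (A B : comPzRingType) n m (f : {rmorphism A -> B}) (x : 'I_n -> B)
    (e : 'cV[B]_n) (g : 'I_m -> pexp A n) :
  exists M : 'M[B]_(m, n),
    \col_k peval f (fun i => x i + e i 0) (g k) = \col_k peval f x (g k) + M *m e /\
    forall k i, idl (fam (fun i => e i 0)) ((M - jac f x g) k i).
Proof.
have [M hM] := choice_fun (fun k => hadamard f x (fun i => e i 0) (g k)).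
exists (\matrix_(k, i) M k i); split=> [|k i].
  apply/matrixP => k j; rewrite (ord1 j) !mxE (hM k).1; congr (_ + _).
  by apply: eq_bigr => i _; rewrite !mxE.
by rewrite !mxE; exact: (hM k).2.
Qed.

Definition jac_etale (A B : comPzRingType) (f : {rmorphism A -> B}) :=
  exists n (g : 'I_n -> pexp A n) x,
    presented f (rels g) x /\ exists d, d * \det (jac f x g) = 1.

(** If $h$ is the Jacobian determinant of $g$, the enlarged system has Jacobian determinant $h^2$,
    with inverse $Y^2$. *)
Lemma jac_etale_ext (A : comPzRingType) n (g : 'I_n -> pexp A n) h :
  (forall (B : comPzRingType) (f : {rmorphism A -> B}) (x : 'I_n -> B),
    peval f x h = \det (jac f x g)) ->
  jac_etale (pa_in (rels (ext g h))).
Proof.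
move=> hE; have pres := pa_presented (rels (ext g h)).
have [_ Yh] := (kills_ext _ _ _ _).1 (presented_kills pres).
exists _, (ext g h), (pa_var (rels (ext g h))); split=> //.
exists (pa_var (rels (ext g h)) (rshift n ord0) ^+ 2).
by rewrite det_ext -hE expr2 mulrACA Yh mulr1.
Qed.

Lemma adj_inv (R : comPzRingType) n (J : 'M[R]_n) d :
  d * \det J = 1 -> (d *: \adj J) *m J = 1%:M /\ J *m (d *: \adj J) = 1%:M.
Proof.
move=> h; split; rewrite -?scalemxAl -?scalemxAr ?mul_mx_adj ?mul_adj_mx;
  by rewrite scale_scalar_mx h.
Qed.

Definition square_zero (C D : comPzRingType) (p : {rmorphism C -> D}) :=
  (forall d : D, exists c : C, p c = d) /\
  (forall x y : C, p x = 0 -> p y = 0 -> x * y = 0).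

Lemma idl_fam_ker (C D : comPzRingType) (p : {rmorphism C -> D}) n (e : 'I_n -> C) x :
  (forall i, p (e i) = 0) -> idl (fam e) x -> p x = 0.
Proof. by move=> h; apply: idl_ker => s [i ->]. Qed.

Lemma square_zero_mulmx (C D : comPzRingType) (p : {rmorphism C -> D}) n m l
    (M : 'M[C]_(n, m)) (N : 'M[C]_(m, l)) :
  square_zero p -> (forall i j, p (M i j) = 0) -> (forall i j, p (N i j) = 0) ->
  M *m N = 0.
Proof.
move=> [_ sq] hM hN; apply/matrixP => i j; rewrite !mxE big1 // => k _.
exact: sq.
Qed.

(** One Newton step turns an arbitrary lift [c] of the images of the generators into an exact zero
    of [g], because the error is a product of two elements of the kernel of [p]. *)
Lemma jac_etale_lift (A B : comPzRingType) (f : {rmorphism A -> B})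
    (C D : comPzRingType) (p : {rmorphism C -> D}) :
  jac_etale f -> square_zero p -> unique_lifting f p.
Proof.
move=> [n [g [x [pres [d hd]]]]] sqz u v uv.
have [surj sq] := sqz.
have gx := (killsP _ _ _).1 (presented_kills pres).
have pv : p \o u =1 v \o f by [].
have [inv1 inv2] := adj_inv hd.
have [s sK] := choice_fun surj.
pose c i := s (v (x i)).
have cv i : p (c i) = v (x i) by rewrite /c sK.
pose G : 'cV[C]_n := \col_k peval u c (g k).
have vf : v \o f =1 p \o u by move=> a; rewrite -pv.
have hG i j : p (G i j) = 0.
  rewrite !mxE (peval_morph (g := v \o f) (y := v \o x)) //.
  by rewrite -(peval_morph (f := f) (h := v) (x := x)) // gx rmorph0.
(* [N] inverts the Jacobian matrix at [c] only modulo the kernel of [p]. This suffices, since [G]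
   has entries in the kernel. *)
pose N : 'M[C]_n := map_mx s (map_mx v (d *: \adj (jac f x g))).
pose e : 'cV[C]_n := - (N *m G).
have he i : p (e i 0) = 0.
  rewrite !mxE rmorphN rmorph_sum big1 ?oppr0 // => k _.
  by rewrite rmorphM hG mulr0.
have pJ : map_mx p (jac u c g) = map_mx v (jac f x g).
  rewrite (jac_morph (f' := v \o f) (y := v \o x)) //.
  by rewrite (jac_morph (f' := v \o f) (y := v \o x)).
have pN : map_mx p N = map_mx v (d *: \adj (jac f x g)).
  by apply/matrixP => i j; rewrite !mxE sK.
have [M [eM hM]] := hadamard_mx u c e g.
(* Here $g(c + e) = (1 - J N) G + (M - J) e$ with $J$ the Jacobian matrix at [c]; both products have
   all factors in the kernel. *)
have lift0 k : peval u (fun i => c i + e i 0) (g k) = 0.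
  suff : \col_k peval u (fun i => c i + e i 0) (g k) = 0 :> 'cV_n.
    by move/matrixP/(_ k 0); rewrite !mxE.
  rewrite eM -[M](subrK (jac u c g)) mulmxDl [X in _ + (X + _)](square_zero_mulmx sqz).
  - rewrite add0r -/G /e mulmxN mulmxA -{1}[G]mul1mx -mulmxBl.
    apply: (square_zero_mulmx sqz) => // i j.
    suff : map_mx p (1%:M - jac u c g *m N) = 0 by move/matrixP/(_ i j); rewrite !mxE.
    by rewrite map_mxB map_mxM map_mx1 pJ pN -map_mxM inv2 map_mx1 subrr.
  - by move=> i j; exact: idl_fam_ker (hM i j).
  - by move=> i j; rewrite (ord1 j).
have [h [hf hx]] : exists h : {rmorphism B -> C},
    h \o f =1 u /\ forall i, h (x i) = c i + e i 0.
  by apply: presented_ext pres _; apply/killsP.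
have ph : p \o h =1 v.
  apply: (gen_eq pres.1) => [a|i] /=; first exact: etrans (congr1 p (hf a)) (uv a).
  by rewrite hx rmorphD he addr0 cv.
exists h; split=> // h' h'f ph'.
apply: (gen_eq pres.1) => [a|i]; first exact: etrans (h'f a) (esym (hf a)).
(* The difference of two lifts lies in the kernel. As [g] vanishes at both, expanding gives $J e' =
   0$ with $J$ invertible. *)
pose e' : 'cV[C]_n := \col_i (h' (x i) - h (x i)).
have he' k j : p (e' k j) = 0.
  by rewrite !mxE rmorphB (ph' (x k) : p _ = _) (ph (x k) : p _ = _) subrr.
have [M' [eM' hM']] := hadamard_mx u (h \o x) e' g.
have kl (k : {rmorphism B -> C}) (y : 'I_n -> C) : k \o f =1 u -> (forall i, k (x i) = y i) ->
    \col_l peval u y (g l) = 0 :> 'cV_n.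
  by move=> kf ky; apply/matrixP => l j; rewrite !mxE -(peval_morph _ kf ky) gx rmorph0.
move: eM'; rewrite (kl h (h \o x)) // (kl h' (fun i => (h \o x) i + e' i 0)) //; last by move=> j; rewrite !mxE /= addrC subrK.
rewrite add0r -[M'](subrK (jac u (h \o x) g)) mulmxDl (square_zero_mulmx sqz) //; last first.
  by move=> j k; apply: idl_fam_ker (hM' j k) => l.
rewrite add0r -(jac_morph (f := f) (h := h) (x := x)) // => /esym.
move/(congr1 (mulmx (map_mx h (d *: \adj (jac f x g))))).
rewrite mulmxA -map_mxM inv1 map_mx1 mul1mx mulmx0 => /matrixP/(_ i 0).
by rewrite !mxE => /eqP; rewrite subr_eq0 => /eqP.
Qed.

Lemma jac_etale_unramified (A B : comPzRingType) (f : {rmorphism A -> B}) :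
  jac_etale f -> unramified f.
Proof.
move=> jf C D p surj sq u g h gu hu pgh.
have [k [_ _ uniq]] := jac_etale_lift jf (conj surj sq) (u := u) (v := p \o h)
  (fun a => congr1 p (esym (hu a))).
by move=> b; rewrite (uniq g) // (uniq h).
Qed.

(** * Tensor products *)

Section Tens.
Variables (A B : comPzRingType) (f : {rmorphism A -> B}) (M : lmodType A).
Local Notation "s ~ t" := (@tens_eq A B f M s t) (at level 70).

Lemma tens_catK (a b c : seq (M * B)) : a ~ b -> a ++ c ~ b ++ c.
Proof. by move=> h; apply: tens_cat => //; exact: tens_refl. Qed.
Lemma tens_catKl (a b c : seq (M * B)) : a ~ b -> c ++ a ~ c ++ b.
Proof. by move=> h; apply: tens_cat => //; exact: tens_refl. Qed.

Lemma tens_perm (s t : seq (M * B)) : perm_eq s t -> s ~ t.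
Proof.
elim: s t => [|x s IH] t pst.
  by move: pst; rewrite perm_sym => /perm_nilP ->; exact: tens_refl.
have /splitPr xt : x \in t by rewrite -(perm_mem pst) mem_head.
case: xt pst => t1 t2.
rewrite perm_sym -cat1s perm_catCA perm_cat2l perm_sym => /IH h.
apply: tens_trans (tens_catKl [:: x] h) _; rewrite !catA.
by apply: tens_trans (tens_catK _ (tens_catC _ _ _)) _; rewrite -catA; exact: tens_refl.
Qed.

Lemma tens_map (Y : Type) (r : seq Y) (F G H : Y -> seq (M * B)) :
  (forall y, F y ~ G y ++ H y) ->
  flatten [seq F y | y <- r] ~ flatten [seq G y | y <- r] ++ flatten [seq H y | y <- r].
Proof.
move=> h; elim: r => /= [|y r IH]; first exact: tens_refl.
apply: tens_trans (tens_cat (h y) IH) _; apply: tens_perm.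
by rewrite -!catA perm_cat2l perm_catCA.
Qed.

(** The universal property of the tensor product, for balanced biadditive maps to an abelian
    group. *)
Lemma tens_sum (G : zmodType) (phi : M -> B -> G) s t :
  (forall m m' b, phi (m + m') b = phi m b + phi m' b) ->
  (forall m b b', phi m (b + b') = phi m b + phi m b') ->
  (forall a m b, phi (a *: m) b = phi m (f a * b)) ->
  s ~ t -> \sum_(x <- s) phi x.1 x.2 = \sum_(x <- t) phi x.1 x.2.
Proof.
move=> Dl Dr Z; elim=> {s t} //.
- by move=> s t u _ -> _ ->.
- by move=> s s' t t' _ h _ h'; rewrite !big_cat h h'.
- by move=> s t; rewrite !big_cat /= addrC.
- move=> b; rewrite big_nil big_seq1 /=.
  by apply: (addrI (phi 0 b)); rewrite -Dl !addr0.
- by move=> m m' b; rewrite !big_cons !big_nil /= !addr0 Dl.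
- by move=> m m' b; rewrite !big_cons !big_nil /= !addr0 Dr.
- by move=> a m b; rewrite !big_seq1 /= Z.
Qed.

Lemma tens_0r m : [:: (m, 0)] ~ [::].
Proof.
have := tens_Z f 0 m 0; rewrite scale0r mulr0 => h.
exact: tens_trans (tens_sym h) (tens_0l f M 0).
Qed.

Lemma tens_sum_r m (Y : Type) (r : seq Y) (F : Y -> B) :
  [:: (m, \sum_(y <- r) F y)] ~ [seq (m, F y) | y <- r].
Proof.
elim: r => [|y r IH]; first by rewrite big_nil; exact: tens_0r.
by rewrite big_cons; apply: tens_trans (tens_Dr _ _ _ _) _; apply: (tens_catKl [:: _]) IH.
Qed.

End Tens.

(** * Submodules and flatness *)

Record submod (A : comPzRingType) (N : lmodType A) := Submod {
  sm_pred : N -> Prop;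
  sm0 : sm_pred 0;
  smD : forall x y, sm_pred x -> sm_pred y -> sm_pred (x + y);
  smZ : forall a x, sm_pred x -> sm_pred (a *: x) }.

Record subm (A : comPzRingType) (N : lmodType A) (D : submod N) := Subm {
  subm_val : N; subm_valP : sm_pred D subm_val }.

HB.instance Definition _ A N (D : @submod A N) := gen_eqMixin (subm D).
HB.instance Definition _ A N (D : @submod A N) := gen_choiceMixin (subm D).

Section SubModule.
Variables (A : comPzRingType) (N : lmodType A) (D : submod N).

Lemma subm_inj : injective (@subm_val A N D).
Proof. by move=> [x hx] [y hy] /= e; subst y; rewrite (Prop_irrelevance hx hy). Qed.

Definition subm_zero : subm D := Subm (sm0 D).
Definition subm_add (x y : subm D) : subm D := Subm (smD (subm_valP x) (subm_valP y)).
Definition subm_scale a (x : subm D) : subm D := Subm (smZ a (subm_valP x)).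
Definition subm_opp := subm_scale (-1).

Fact subm_addA : associative subm_add.
Proof. by move=> x y z; apply: subm_inj; exact: addrA. Qed.
Fact subm_addC : commutative subm_add.
Proof. by move=> x y; apply: subm_inj; exact: addrC. Qed.
Fact subm_add0 : left_id subm_zero subm_add.
Proof. by move=> x; apply: subm_inj; exact: add0r. Qed.
Fact subm_addN : left_inverse subm_zero subm_opp subm_add.
Proof. by move=> x; apply: subm_inj; rewrite /= scaleN1r addNr. Qed.
HB.instance Definition _ := GRing.isZmodule.Build (subm D)
  subm_addA subm_addC subm_add0 subm_addN.

Fact subm_scaleA a b v : subm_scale a (subm_scale b v) = subm_scale (a * b) v.
Proof. by apply: subm_inj; exact: scalerA. Qed.
Fact subm_scale1 : left_id 1 subm_scale.
Proof. by move=> x; apply: subm_inj; exact: scale1r. Qed.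
Fact subm_scaleDr : right_distributive subm_scale +%R.
Proof. by move=> a x y; apply: subm_inj; exact: scalerDr. Qed.
Fact subm_scaleDl v : {morph subm_scale^~ v : a b / a + b}.
Proof. by move=> a b; apply: subm_inj; exact: scalerDl. Qed.
HB.instance Definition _ := GRing.Zmodule_isLmodule.Build A (subm D)
  subm_scaleA subm_scale1 subm_scaleDr subm_scaleDl.

Fact subm_val_linear : linear (@subm_val A N D).
Proof. by []. Qed.
HB.instance Definition _ := GRing.isLinear.Build A (subm D) N _ (@subm_val A N D) subm_val_linear.

(** By flatness, a sum with first components in [D] that vanishes in $N (x) B$ already vanishes in
    $D (x) B$. Hence [phi] has to be balanced and biadditive on [D] only. *)
Lemma flat_sub (B : comPzRingType) (f : {rmorphism A -> B}) (G : zmodType)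
    (phi : N -> B -> G) (s : seq (N * B)) :
  flat f ->
  (forall m m' b, sm_pred D m -> sm_pred D m' -> phi (m + m') b = phi m b + phi m' b) ->
  (forall m b b', sm_pred D m -> phi m (b + b') = phi m b + phi m b') ->
  (forall a m b, sm_pred D m -> phi (a *: m) b = phi m (f a * b)) ->
  (forall x, x \in s -> sm_pred D x.1) -> tens_eq f s [::] ->
  \sum_(x <- s) phi x.1 x.2 = 0.
Proof.
move=> fl Dl Dr Z hs s0.
have [s' es] : exists s' : seq (subm D * B), s = [seq (subm_val x.1, x.2) | x <- s'].
  elim: s hs {s0} => [|[m b] s IH] hs; first by exists [::].
  have [|s' ->] := IH; first by move=> x xs; apply: hs; rewrite inE xs orbT.
  have hm : sm_pred D m by apply: (hs (m, b)); exact: mem_head.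
  by exists ((Subm hm, b) :: s').
have := fl _ _ (@subm_val A N D) subm_inj s' [::]; rewrite -es => /(_ s0) s'0.
rewrite es big_map /=.
rewrite (tens_sum (phi := fun m b => phi (subm_val m) b) _ _ _ s'0) ?big_nil //.
- by move=> m m' b; apply: Dl; exact: subm_valP.
- by move=> m b b'; apply: Dr; exact: subm_valP.
- by move=> a m b; apply: Z; exact: subm_valP.
Qed.

End SubModule.

(** * The tensor product of two algebras *)

Section TensRing.
Variables (A S B : comPzRingType) (u : {rmorphism A -> S}) (f : {rmorphism A -> B}).

(** A copy of [S] whose type records [u], so that the [A]-module structure through [u] can be
    inferred from it. *)
Definition amod of {rmorphism A -> S} : Type := S.
HB.instance Definition _ := GRing.Zmodule.on (amod u).

Definition amod_scale (a : A) (m : amod u) : amod u := u a * (m : S).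
Fact amod_scaleA a b v : amod_scale a (amod_scale b v) = amod_scale (a * b) v.
Proof. by rewrite /amod_scale rmorphM mulrA. Qed.
Fact amod_scale1 : left_id 1 amod_scale.
Proof. by move=> x; rewrite /amod_scale rmorph1 mul1r. Qed.
Fact amod_scaleDr : right_distributive amod_scale +%R.
Proof. by move=> a x y; exact: mulrDr. Qed.
Fact amod_scaleDl v : {morph amod_scale^~ v : a b / a + b}.
Proof. by move=> a b; rewrite /amod_scale rmorphD; exact: mulrDl. Qed.
HB.instance Definition _ := GRing.Zmodule_isLmodule.Build A (amod u)
  amod_scaleA amod_scale1 amod_scaleDr amod_scaleDl.

Local Notation M := (amod u).
Local Notation T := (seq (M * B)).
Local Notation "s ~ t" := (@tens_eq A B f M s t) (at level 70).

Definition pmul (x y : M * B) : M * B := ((x.1 : S) * (y.1 : S), x.2 * y.2).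
Definition tmul (s t : T) : T := flatten [seq [seq pmul x y | y <- t] | x <- s].

Lemma tmul_cons x s t : tmul (x :: s) t = [seq pmul x y | y <- t] ++ tmul s t.
Proof. by []. Qed.
Lemma tmul_cat s s' t : tmul (s ++ s') t = tmul s t ++ tmul s' t.
Proof. by rewrite /tmul map_cat flatten_cat. Qed.

Lemma pmulC : commutative pmul. Proof. by move=> x y; rewrite /pmul mulrC [x.2 * _]mulrC. Qed.
Lemma pmulA : associative pmul. Proof. by move=> x y z; rewrite /pmul /= !mulrA. Qed.

Lemma tmulC s t : tmul s t ~ tmul t s.
Proof.
elim: s t => [|x s IH] t.
  by rewrite (_ : tmul t [::] = [::]); [exact: tens_refl|elim: t].
rewrite tmul_cons; apply: tens_trans (tens_catKl _ (IH t)) _.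
elim: t {IH} => [|y t IH]; first exact: tens_refl.
rewrite !tmul_cons /= pmulC; apply: (tens_catKl [:: _]).
apply: (@tens_trans _ _ _ _ _ ([seq pmul y x0 | x0 <- s] ++ [seq pmul x y0 | y0 <- t] ++ tmul t s)).
  by apply: tens_perm; rewrite perm_catCA.
exact: tens_catKl.
Qed.

Lemma tmul_congl s s' t : s ~ s' -> tmul s t ~ tmul s' t.
Proof.
have ff (F : M * B -> M * B) r : flatten [seq [:: F y] | y <- r] = [seq F y | y <- r].
  by elim: r => //= y r ->.
have tm (x : M * B) r : tmul [:: x] r = flatten [seq [:: pmul x y] | y <- r].
  by rewrite /tmul /= cats0 ff.
elim=> {s s'}.
- by move=> s; exact: tens_refl.
- by move=> s r _; exact: tens_sym.
- by move=> s r v _ h _; exact: tens_trans.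
- by move=> s s' r r' _ h _ h'; rewrite !tmul_cat; exact: tens_cat.
- by move=> s r; rewrite !tmul_cat; exact: tens_catC.
- move=> b; rewrite tm; elim: t => /= [|y t IH]; first exact: tens_refl.
  rewrite -[X in _ ~ X]cat0s; apply: (tens_cat (s := [:: _])) IH.
  by rewrite /pmul /= mul0r; exact: tens_0l.
- move=> m m' b; rewrite (tmul_cat [:: (m, b)] [:: (m', b)]) !tm; apply: tens_map => y.
  by rewrite /pmul /= mulrDl; exact: tens_Dl.
- move=> m b b'; rewrite (tmul_cat [:: (m, b)] [:: (m, b')]) !tm; apply: tens_map => y.
  by rewrite /pmul /= mulrDl; exact: tens_Dr.
- move=> a m b; rewrite !tm; elim: t => /= [|y t IH]; first exact: tens_refl.
  apply: (tens_cat (s := [:: _]) (s' := [:: _])) IH.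
  rewrite /pmul /= -!mulrA; exact: (tens_Z f a (_ : M)).
Qed.

Lemma tmul_cong s s' t t' : s ~ s' -> t ~ t' -> tmul s t ~ tmul s' t'.
Proof.
move=> h h'; apply: tens_trans (tmul_congl t h) _.
apply: tens_trans (tmulC _ _) _; apply: tens_trans (tmul_congl _ h') _; exact: tmulC.
Qed.

Definition tens_per : per_ring.
Proof.
refine (@PerRing T (@tens_eq A B f M) [::] [:: (1 : S, 1)]
  (map (fun x => (- x.1, x.2))) cat tmul _ _ _ _ _ _ _ _ _ _ _ _ _ _ _).
- exact: tens_sym.
- exact: tens_trans.
- exact: tens_refl.
- exact: tens_refl.
- move=> t t'; elim=> {t t'} /=.
  + by move=> s; exact: tens_refl.
  + by move=> s r _; exact: tens_sym.
  + by move=> s r v _ h _; exact: tens_trans.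
  + by move=> s s' r r' _ h _ h'; rewrite !map_cat; exact: tens_cat.
  + by move=> s r; rewrite !map_cat; exact: tens_catC.
  + by move=> b; rewrite oppr0; exact: tens_0l.
  + by move=> m m' b; rewrite opprD; exact: tens_Dl.
  + by move=> m b b'; exact: tens_Dr.
  + by move=> a m b; rewrite -scalerN; exact: tens_Z.
- by move=> *; exact: tens_cat.
- by move=> *; exact: tmul_cong.
- by move=> *; rewrite catA; exact: tens_refl.
- by move=> *; exact: tens_catC.
- by move=> *; exact: tens_refl.
- move=> t _; elim: t => [|[m b] t IH]; first exact: tens_refl.
  rewrite /= -cat_cons -[_ :: t]cat1s.
  apply: (@tens_trans _ _ _ _ _ (([:: (- m, b)] ++ [:: (m, b)]) ++ ([seq (- x.1, x.2) | x <- t] ++ t))).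
    by apply: tens_perm; rewrite /= perm_cons -cat1s perm_catCA.
  apply: tens_trans (tens_catKl _ IH) _; rewrite cats0.
  apply: tens_trans (tens_sym (tens_Dl _ _ _ _)) _; rewrite addNr; exact: tens_0l.
- move=> t s r _ _ _; suff -> : tmul t (tmul s r) = tmul (tmul t s) r by exact: tens_refl.
  elim: t => // x t IH; rewrite !tmul_cons tmul_cat IH; congr (_ ++ _).
  elim: s {IH} => //= y s IH; rewrite !tmul_cons map_cat IH; congr (_ ++ _).
  by rewrite -map_comp; apply: eq_map => z /=; rewrite pmulA.
- by move=> *; exact: tmulC.
- move=> t _; suff -> : tmul [:: (1 : S, 1)] t = t by exact: tens_refl.
  rewrite /tmul /= cats0 -[RHS]map_id; apply: eq_map => -[m b].
  by rewrite /pmul /= !mul1r.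
- by move=> *; rewrite tmul_cat; exact: tens_refl.
Defined.

Definition tens := pquo tens_per.
Local Notation cl := (@pcls tens_per).

Lemma tens_inl_ex : exists i : {rmorphism S -> tens}, i =1 fun s => cl [:: (s : M, 1)].
Proof.
apply: rmorph_of => // [x y|x y]; rewrite -?pclsD -?pclsM; do ?exact: tens_refl.
  by apply: pcls_eq; exact: tens_Dl.
by apply: pcls_eq; rewrite /= /tmul /= /pmul mulr1; exact: tens_refl.
Qed.
Lemma tens_inr_ex : exists i : {rmorphism B -> tens}, i =1 fun b => cl [:: (1 : S, b)].
Proof.
apply: rmorph_of => // [x y|x y]; rewrite -?pclsD -?pclsM; do ?exact: tens_refl.
  by apply: pcls_eq; exact: tens_Dr.
by apply: pcls_eq; rewrite /= /tmul /= /pmul mulr1; exact: tens_refl.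
Qed.

Definition tinl : {rmorphism S -> tens} := sval (cid tens_inl_ex).
Definition tinr : {rmorphism B -> tens} := sval (cid tens_inr_ex).
Lemma tinlE s : tinl s = cl [:: (s : M, 1)].
Proof. exact: (svalP (cid tens_inl_ex)). Qed.
Lemma tinrE b : tinr b = cl [:: (1 : S, b)].
Proof. exact: (svalP (cid tens_inr_ex)). Qed.

Lemma tens_comm : tinl \o u =1 tinr \o f.
Proof.
move=> a /=; rewrite tinlE tinrE; apply: pcls_eq; rewrite /= -[f a]mulr1.
rewrite -[u a]mulr1. exact: (@tens_Z A B f M a (1 : S) 1).
Qed.

Lemma tens_clE (s : T) : cl s = \sum_(x <- s) tinl x.1 * tinr x.2.
Proof.
elim: s => [|[m b] s IH]; first by rewrite big_nil -pcls0.
rewrite big_cons -IH /= tinlE tinrE -pclsM -?pclsD; do ?exact: tens_refl.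
congr cl; rewrite /= /tmul /= /pmul /=; congr ((_, _) :: _).
  by rewrite mulr1.
by rewrite mul1r.
Qed.

Lemma tens_elt (c : tens) : exists s : T, c = \sum_(x <- s) tinl x.1 * tinr x.2.
Proof. by exists (prepr c); rewrite -tens_clE preprK. Qed.

Lemma tens_sum_eq (s t : T) :
  \sum_(x <- s) tinl x.1 * tinr x.2 = \sum_(x <- t) tinl x.1 * tinr x.2 -> s ~ t.
Proof. by rewrite -!tens_clE; apply: pcls_rel; exact: tens_refl. Qed.

(** Together with [tens_hom_eq], this makes [tens] the pushout of [u] and [f]. *)
Lemma tens_ext (C : comPzRingType) (g : {rmorphism S -> C}) (h : {rmorphism B -> C}) :
  g \o u =1 h \o f ->
  exists k : {rmorphism tens -> C}, k \o tinl =1 g /\ k \o tinr =1 h.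
Proof.
move=> gh.
pose F (s : T) := \sum_(x <- s) g x.1 * h x.2.
have FE s t : s ~ t -> F s = F t.
  apply: (tens_sum (phi := fun (m : M) b => g m * h b)).
  - by move=> m m' b; rewrite rmorphD mulrDl.
  - by move=> m b b'; rewrite rmorphD mulrDr.
  - move=> a m b; rewrite rmorphM rmorphM (gh a : g (u a) = h (f a)); rewrite mulrA; congr (_ * _).
    exact: mulrC.
have Fcl s : F (prepr (cl s)) = F s by apply: FE; apply: (@prepr_cls tens_per); exact: tens_refl.
have [k kE] : exists k : {rmorphism tens -> C}, k =1 fun c => F (prepr c).
  apply: rmorph_of.
  - elim/pquoP => s _; elim/pquoP => t _; rewrite -pclsD; do ?exact: tens_refl.
    by rewrite !Fcl /F big_cat.
  - elim/pquoP => s _; elim/pquoP => t _; rewrite -pclsM; do ?exact: tens_refl.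
    rewrite !Fcl /F /= /tmul big_flatten big_map mulr_suml; apply: eq_bigr => x _.
    rewrite big_map mulr_sumr; apply: eq_bigr => y _.
    by rewrite !rmorphM mulrACA.
  - by rewrite -pcls1 Fcl /F big_seq1 !rmorph1 mulr1.
exists k; split=> x /=; rewrite ?tinlE ?tinrE kE Fcl /F big_seq1 rmorph1.
  by rewrite mulr1.
by rewrite mul1r.
Qed.

Lemma tens_hom_eq (C : comPzRingType) (h h' : {rmorphism tens -> C}) :
  h \o tinl =1 h' \o tinl -> h \o tinr =1 h' \o tinr -> h =1 h'.
Proof.
move=> hl hr c; have [s ->] := tens_elt c.
rewrite !rmorph_sum; apply: eq_bigr => x _; rewrite !rmorphM; congr (_ * _).
  exact: hl.
exact: hr.
Qed.

(** The universal properties of [B] and of the tensor product give the map to the algebra over [S]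
    presented by the same relations, as [presented_intro] requires. *)
Lemma tens_presented n (rs : seq (pexp A n)) (x : 'I_n -> B) :
  presented f rs x -> presented tinl [seq pmap u id r | r <- rs] (tinr \o x).
Proof.
move=> pres.
have pe (C : comPzRingType) (g : {rmorphism S -> C}) y t :
    peval g y (pmap u id t) = peval (g \o u) y t by exact: peval_pmap.
have kl (C : comPzRingType) (g : {rmorphism S -> C}) (y : 'I_n -> C) :
    kills g y [seq pmap u id r | r <- rs] <-> kills (g \o u) y rs.
  split=> [k t ht|k t /List.in_map_iff[r [<- hr]]]; last by rewrite pe; exact: k.
  by rewrite -pe; apply: k; exact: List.in_map.
have cm : tinr \o f =1 tinl \o u by move=> a; rewrite (tens_comm a).
have [k [kf kx]] : exists k : {rmorphism B -> pa [seq pmap u id r | r <- rs]},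
    k \o f =1 pa_in [seq pmap u id r | r <- rs] \o u /\ forall i, k (x i) = pa_var _ i.
  by apply: presented_ext pres _; apply/kl/presented_kills/pa_presented.
have [h [hl hr]] := tens_ext (g := pa_in [seq pmap u id r | r <- rs]) (h := k) (fun a => esym (kf a)).
apply: (presented_intro (h := h)) => //.
- move=> c; have [s ->] := tens_elt c.
  elim: s => [|[m b] s [t tE]]; first by exists (PConst 0); rewrite big_nil /= rmorph0.
  have [r rE] := pres.1 b.
  exists (PAdd (PMul (PConst (m : S)) (pmap u id r)) t).
  rewrite big_cons /= tE pe -(peval_morph (f := f) (h := tinr) (x := x)) ?rE //.
- by apply/kl; apply: kills_morph (presented_kills pres) => //; exact: cm.
- by move=> i; rewrite -kx; exact: hr.
Qed.

End TensRing.

(** * Unramified and etale algebras *)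

Lemma surj_factor (S B C : comPzRingType) (p : {rmorphism S -> B}) (k : {rmorphism S -> C}) :
  (forall b, exists s, p s = b) -> (forall s, p s = 0 -> k s = 0) ->
  exists h : {rmorphism B -> C}, h \o p =1 k.
Proof.
move=> surj ker; have [s sK] := choice_fun surj.
have ks x : k (s (p x)) = k x.
  by apply/eqP; rewrite -subr_eq0 -rmorphB ker // rmorphB sK subrr.
have [h hE] : exists h : {rmorphism B -> C}, h =1 k \o s.
  apply: rmorph_of => [x y|x y|] /=.
  - by rewrite -{1}(sK x) -{1}(sK y) -rmorphD ks rmorphD.
  - by rewrite -{1}(sK x) -{1}(sK y) -rmorphM ks rmorphM.
  - by rewrite -(rmorph1 p) ks rmorph1.
by exists h => x /=; rewrite hE /= ks.
Qed.

Section TrivialExtension.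
Variables (B : comPzRingType) (n m : nat) (J : 'M[B]_(m, n)).

(* B + B^n / (rows of J), with B^n / (rows of J) of square zero *)
Definition dual_per : per_ring.
Proof.
refine (@PerRing (B * 'rV[B]_n)
  (fun t u => t.1 = u.1 /\ exists w : 'rV_m, t.2 - u.2 = w *m J)
  (0, 0) (1, 0) (fun t => (- t.1, - t.2)) (fun t u => (t.1 + u.1, t.2 + u.2))
  (fun t u => (t.1 * u.1, t.1 *: u.2 + u.1 *: t.2)) _ _ _ _ _ _ _ _ _ _ _ _ _ _ _).
- by move=> t u [-> [w e]]; split=> //; exists (- w); rewrite mulNmx -e opprB.
- move=> t u v [-> [w e]] [-> [w' e']]; split=> //; exists (w + w').
  by rewrite mulmxDl -e -e' addrA subrK.
- by split=> //; exists 0; rewrite mul0mx subrr.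
- by split=> //; exists 0; rewrite mul0mx subrr.
- by move=> t t' [-> [w e]]; split=> //; exists (- w); rewrite mulNmx -e opprD.
- move=> t t' u u' [-> [w e]] [-> [w' e']]; split=> //; exists (w + w').
  by rewrite mulmxDl -e -e' opprD addrACA.
- move=> t t' u u' [-> [w e]] [-> [w' e']]; split=> //=; exists (t'.1 *: w' + u'.1 *: w).
  have ej j : \sum_k w 0 k * J k j = t.2 0 j - t'.2 0 j.
    by move/rowP/(_ j): e; rewrite !mxE.
  have ej' j : \sum_k w' 0 k * J k j = u.2 0 j - u'.2 0 j.
    by move/rowP/(_ j): e'; rewrite !mxE.
  apply/rowP => j; rewrite mulmxDl -!scalemxAl !mxE ej ej'; ring.
all: move=> *; split=> /=; try (exists 0; rewrite mul0mx; apply/eqP; rewrite subr_eq0; apply/eqP;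
  apply/rowP => ?; rewrite !mxE); ring.
Defined.

Definition dual := pquo dual_per.
Local Notation cl := (@pcls dual_per).

Lemma dual_refl (t : B * 'rV[B]_n) : @pr_rel dual_per t t.
Proof. by split=> //; exists 0; rewrite mul0mx subrr. Qed.

Lemma dual_D t u : cl t + cl u = cl (t.1 + u.1, t.2 + u.2).
Proof. by rewrite -pclsD //; exact: dual_refl. Qed.
Lemma dual_M t u : cl t * cl u = cl (t.1 * u.1, t.1 *: u.2 + u.1 *: t.2).
Proof. by rewrite -pclsM //; exact: dual_refl. Qed.

Lemma dual_in : exists i : {rmorphism B -> dual}, i =1 fun b => cl (b, 0).
Proof.
apply: rmorph_of => // [x y|x y]; first by rewrite dual_D addr0.
by rewrite dual_M /= !scaler0 addr0.
Qed.

Lemma dual_proj : exists p : {rmorphism dual -> B}, (forall t, p (cl t) = t.1) /\ square_zero p.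
Proof.
have rE t : (prepr (cl t)).1 = t.1 by case: (prepr_cls (dual_refl t)).
have [p pE] : exists p : {rmorphism dual -> B}, p =1 fun c => (prepr c).1.
  apply: rmorph_of.
  - by elim/pquoP => t _; elim/pquoP => u _; rewrite dual_D !rE.
  - by elim/pquoP => t _; elim/pquoP => u _; rewrite dual_M !rE.
  - by rewrite -pcls1 rE.
exists p; split=> [t|]; first by rewrite pE rE.
split=> [d|]; first by exists (cl (d, 0)); rewrite pE rE.
elim/pquoP => t _; elim/pquoP => u _; rewrite !pE !rE dual_M => -> ->.
by rewrite mul0r !scale0r addr0.
Qed.

End TrivialExtension.

(** $B^n$ modulo the rows of the Jacobian matrix is the module of differentials of $B$ over $A$. The
    maps $x_k |-> x_k$ and $x_k |-> x_k + dx_k$ to the trivial extension agree modulo differentials,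
    so they are equal; each $dx_k$ is then a combination of rows, and these combinations form
    [N]. *)
Lemma unramified_jac (A B : comPzRingType) (f : {rmorphism A -> B}) n rs (x : 'I_n -> B) :
  unramified f -> presented f rs x ->
  exists N, N *m jac f x (tnth (in_tuple rs)) = 1%:M.
Proof.
move=> ur pres; set J := jac _ _ _.
pose cl := @pcls (dual_per J).
have [i iE] := dual_in J.
have [p [pE [surj sq]]] := dual_proj J.
pose y k := cl (x k, delta_mx 0 k).
(* The second component of an evaluation in the trivial extension is the gradient. *)
have ev t : peval (i \o f) y t = cl (peval f x t, \row_j peval f x (pderiv j t)).
  elim: t => /= [a|k|t -> u ->|t -> u ->].
  - by rewrite iE; congr (cl (_, _)); apply/rowP => j; rewrite !mxE rmorph0.
  - by congr (cl (_, _)); apply/rowP => j; rewrite !mxE eqxx rmorph_nat.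
  - by rewrite dual_D; congr (cl (_, _)); apply/rowP => j; rewrite !mxE.
  - rewrite dual_M; congr (cl (_, _)); apply/rowP => j; rewrite !mxE /=.
    by rewrite addrC mulrC.
have [h [hf hx]] : exists h : {rmorphism B -> dual J}, h \o f =1 i \o f /\ forall k, h (x k) = y k.
  apply: (presented_ext pres) => t ht; rewrite ev (presented_kills pres ht).
  have [k <-] := In_tnth ht.
  rewrite -(pcls0 (dual_per J)); apply: pcls_eq; split=> //=.
  by exists (delta_mx 0 k); rewrite subr0 -rowE; apply/rowP => j; rewrite !mxE.
have ih : i =1 h.
  apply: (ur _ _ p surj sq (i \o f)) => // a /=.
  apply: (gen_eq (h := p \o i) (h' := p \o h) pres.1) => [b|k] /=.
    by rewrite (hf b : h (f b) = _).
  by rewrite hx iE !pE.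
have W k : exists w : 'rV_(size rs), w *m J = delta_mx 0 k.
  have := ih (x k); rewrite iE hx => /esym /pcls_rel [||_ /= [w e]]; try exact: dual_refl.
  by exists w; rewrite -e subr0.
have [N NE] := choice_fun W.
exists (\matrix_k N k); apply/row_matrixP => k.
by rewrite row_mul rowK NE rowE mulmx1.
Qed.

(** The [n] combinations $g_i = sum_l N_il r_l$ of the relations have Jacobian matrix $N J = 1$ at
    [x]. [S] is defined by the [g i] with their Jacobian determinant [h] inverted, and [B] is its
    quotient by the original relations. *)
Lemma unramified_cover (A B : comPzRingType) (f : {rmorphism A -> B}) :
  unramified f -> finitely_presented f ->
  exists (S : comPzRingType) (e : {rmorphism A -> S}) (p : {rmorphism S -> B}),
  [/\ jac_etale e, p \o e =1 f, forall b, exists s, p s = b &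
      exists m (r : 'I_m -> S), forall s, p s = 0 <-> idl (fam r) s].
Proof.
move=> ur [n [rs [x pres]]].
have [N NJ] := unramified_jac ur pres.
have [Np NpE] := choice_fun (fun il : 'I_n * 'I_(size rs) => pres.1 (N il.1 il.2)).
pose r := tnth (in_tuple rs).
have rx l : peval f x (r l) = 0 by apply: presented_kills pres _ _; exact: tnth_In.
pose g i := \big[(@PAdd A n)/PConst 0]_l PMul (Np (i, l)) (r l).
have [h hE] := det_pexp g.
pose S := pa (rels (ext g h)); pose e := pa_in (rels (ext g h)).
pose X := pa_var (rels (ext g h)).
have presS := pa_presented (rels (ext g h)).
have /kills_ext[kX Yh] := presented_kills presS.
have hx : peval f x h = 1.
  rewrite hE -(det1 B n) -NJ; congr (\det _); apply/matrixP => i j; rewrite !mxE.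
  rewrite psum_pderiv psum_peval; apply: eq_bigr => l _ /=.
  by rewrite rx NpE mxE mulr0 add0r.
have gx i : peval f x (g i) = 0.
  by rewrite psum_peval big1 // => l _ /=; rewrite rx mulr0.
have xl z : extp x z \o lshift 1 =1 x by move=> i /=; rewrite extp_l.
(* The variable inverse to [h] goes to 1, because [h] has value 1 at [x]. *)
have [p [pe pX]] : exists p : {rmorphism S -> B}, p \o e =1 f /\ forall i, p (X i) = extp x 1 i.
  apply: (presented_ext presS); apply/kills_ext; split.
    by apply/killsP => i; rewrite (eq_peval _ _ (xl _)).
  by rewrite (eq_peval _ _ (xl _)) hx extp_r mulr1.
have pXl i : p (X (lshift 1 i)) = x i by rewrite pX extp_l.
have psurj b : exists s, p s = b.
  have [t <-] := pres.1 b; exists (peval e (X \o lshift 1) t).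
  exact: (peval_morph t pe pXl).
exists S, e, p; split=> //.
  exact: jac_etale_ext.
pose rho l := peval e (X \o lshift 1) (r l).
exists _, rho => s; split; last first.
  by apply: idl_ker => _ [l ->]; rewrite (peval_morph _ pe pXl).
pose q := qin (fam rho).
have [k [kf kx]] : exists k : {rmorphism B -> quot (fam rho)},
    k \o f =1 q \o e /\ forall i, k (x i) = q (X (lshift 1 i)).
  apply: (presented_ext pres) => t ht.
  rewrite -(peval_morph (f := e) (h := q) (x := X \o lshift 1)) //.
  by apply/qin_eq0/idl_in; have [l <-] := In_tnth ht; exists l.
(* On the inverse of [h] the two maps agree because [h] becomes 1 in the quotient. *)
have kp : k \o p =1 q.
  apply: (gen_eq (h := k \o p) presS.1) => [a|i].
    by rewrite -(kf a) /= (pe a : p (e a) = _).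
  elim/ord_ext: i => [i|] /=; first by rewrite pX extp_l kx.
  rewrite pX extp_r rmorph1; have := congr1 q Yh.
  rewrite rmorph1 rmorphM (peval_morph (g := q \o e) (y := k \o x)) => [|//|i]; last by rewrite /= kx.
  by rewrite -(peval_morph (f := f) (h := k) (x := x)) // hx rmorph1 mulr1 => ->.
move=> ps; apply/qin_eq0; rewrite -/q -(kp s) /= ps; exact: rmorph0.
Qed.

Definition kerp (S B : comPzRingType) (p : {rmorphism S -> B}) (s : S) := p s = 0.

(** The determinant trick: $I = I^2$ gives $r = M r$ with [M] having entries in $I$, so $d = det (1
    - M)$ kills $I$ and is 1 modulo $I$. Thus [d] is idempotent and $B = S[1/d]$, and the inverse of
    [d] is adjoined as a further variable. *)
Lemma jac_etale_quotient (A S B : comPzRingType) (e : {rmorphism A -> S})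
    (p : {rmorphism S -> B}) (f : {rmorphism A -> B}) m (r : 'I_m -> S) :
  jac_etale e -> p \o e =1 f -> (forall b, exists s, p s = b) ->
  (forall s, p s = 0 <-> idl (fam r) s) ->
  (forall s, p s = 0 -> idl (prods (kerp p) (kerp p)) s) ->
  jac_etale f.
Proof.
move=> [n [g [y [pres [w hw]]]]] pe surj ker sq.
have sq_sum s : idl (prods (kerp p) (kerp p)) s ->
    exists c : 'I_m -> S, s = \sum_j c j * r j /\ forall j, p (c j) = 0.
  elim=> [|a _ [b [c [pb /ker/idl_famP[d ->] ->]]]|u v _ [c [-> pc]] _ [d [-> pd]]].
  - exists (fun=> 0); split=> [|j]; last exact: rmorph0.
    by rewrite big1 // => j _; rewrite mul0r.
  - exists (fun j => a * b * d j); split=> [|j]; last by rewrite !rmorphM (pb : p b = 0) mulr0 mul0r.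
    by rewrite mulrA mulr_sumr; apply: eq_bigr => j _; rewrite !mulrA.
  - exists (fun j => c j + d j); split=> [|j]; last by rewrite rmorphD pc pd addr0.
    by rewrite -big_split; apply: eq_bigr => j _; rewrite mulrDl.
have [c hc] := choice_fun (fun i => sq_sum _ (sq _ ((ker _).2 (idl_in (ex_intro _ i erefl : fam r (r i)))))).
pose M : 'M[S]_m := \matrix_(i, j) c i j.
pose d := \det (1%:M - M).
have dr i : d * r i = 0.
  suff : \adj (1%:M - M) *m ((1%:M - M) *m \col_j r j) = 0.
    rewrite mulmxA mul_adj_mx mul_scalar_mx => /matrixP/(_ i 0); by rewrite !mxE.
  rewrite [X in _ *m X](_ : _ = 0) ?mulmx0 // mulmxBl mul1mx.
  apply/matrixP => k l; rewrite !mxE (hc k).1; apply/eqP; rewrite subr_eq0; apply/eqP.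
  by apply: eq_bigr => j _; rewrite !mxE.
have pd : p d = 1.
  rewrite -det_map_mx map_mxB map_mx1 (_ : map_mx p M = 0) ?subr0 ?det1 //.
  by apply/matrixP => i j; rewrite !mxE (hc i).2.
have dker s : p s = 0 -> d * s = 0.
  by move/ker/idl_famP => [b ->]; rewrite mulr_sumr big1 // => j _; rewrite mulrCA dr mulr0.
have [dp dpE] := pres.1 d.
pose X := pa_var (rels (ext g dp)); pose i := pa_in (rels (ext g dp)).
have presS := pa_presented (rels (ext g dp)).
have /kills_ext[kX Yd] := presented_kills presS.
have [k [ke ky]] := presented_ext pres kX.
(* The image of [d] in $S[1/d]$ is idempotent and invertible, hence equal to 1. *)
have kd : k d * k d = k d.
  by apply/eqP; rewrite -rmorphM -subr_eq0 -rmorphB -{3}(mulr1 d) -mulrBr dker ?rmorph0 // rmorphB pd rmorph1 subrr.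
rewrite -(peval_morph (f := e) (h := k) (x := y)) // dpE in Yd.
have kd1 : k d = 1 by rewrite -Yd -{2}kd mulrA Yd mul1r.
rewrite kd1 mulr1 in Yd.
have [h hp] : exists h : {rmorphism B -> pa (rels (ext g dp))}, h \o p =1 k.
  by apply: surj_factor => // s /dker; move/(congr1 k); rewrite rmorphM kd1 mul1r rmorph0.
have yl z : extp (p \o y) z \o lshift 1 =1 p \o y by move=> j /=; rewrite extp_l.
exists _, (ext g dp), (extp (p \o y) 1); split; last first.
  exists (p w); rewrite det_ext (eq_peval _ _ (yl _)).
  rewrite -(peval_morph (f := e) (h := p) (x := y)) // dpE pd mulr1.
  have -> : jac f (extp (p \o y) 1 \o lshift 1) g = map_mx p (jac e y g).
    rewrite (jac_morph (f' := f) (y := p \o y)) //.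
    by apply/matrixP => a b; rewrite !mxE (eq_peval _ _ (yl _)).
  by rewrite det_map_mx -rmorphM hw rmorph1.
apply: (presented_intro (h := h)).
- move=> b; have [s <-] := surj b; have [t <-] := pres.1 s; exists (wk t).
  by rewrite peval_wk (eq_peval _ _ (yl _)) -(peval_morph (f := e) (h := p) (x := y)).
- apply/kills_ext; split.
    apply/killsP => j; rewrite (eq_peval _ _ (yl _)) -(peval_morph (f := e) (h := p) (x := y)) //.
    by rewrite ((killsP _ _ _).1 (presented_kills pres)) rmorph0.
  rewrite (eq_peval _ _ (yl _)) -(peval_morph (f := e) (h := p) (x := y)) //.
  by rewrite dpE pd extp_r mulr1.
- by move=> a /=; rewrite -(pe a) -(ke a); exact: hp.
- elim/ord_ext => [j|]; first by rewrite extp_l; exact: etrans (hp (y j)) (ky j).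
  by rewrite extp_r rmorph1 -Yd.
Qed.

(** With $I$ the kernel of [p], the identity of $B = S/I$ lifts to [k] from [B] to $S/I^2$. The
    composite of [k] and [p] agrees with the projection of [S] modulo $I$, hence equals it because
    [S] is unramified; so the projection kills $I$. *)
Lemma formally_etale_ker (A S B : comPzRingType) (e : {rmorphism A -> S})
    (p : {rmorphism S -> B}) (f : {rmorphism A -> B}) :
  jac_etale e -> p \o e =1 f -> (forall b, exists s, p s = b) ->
  (forall (C D : comPzRingType) (q : {rmorphism C -> D}), square_zero q -> unique_lifting f q) ->
  forall s, p s = 0 -> idl (prods (kerp p) (kerp p)) s.
Proof.
move=> je pe surj fe.
pose q := qin (prods (kerp p) (kerp p)).
have qs : forall c, exists s, q s = c by exact: qin_surj.
have kq s : q s = 0 -> p s = 0.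
  by move/qin_eq0; apply: idl_ker => _ [a [b [ha _ ->]]]; rewrite rmorphM (ha : p a = 0) mul0r.
have [h hq] := surj_factor qs kq.
have [hsurj hsq] : square_zero h.
  split=> [d|c c'].
    by have [s <-] := surj d; exists (q s); exact: hq.
  have [s <-] := qs c; have [s' <-] := qs c'.
  rewrite (hq s : h (q s) = _) (hq s' : h (q s') = _) => ps ps'.
  by rewrite -rmorphM; apply/qin_eq0/idl_in; exists s, s'.
have [|k [kf hk _]] := fe _ _ h (conj hsurj hsq) (q \o e) idfun.
  by move=> a /=; rewrite -(pe a); exact: hq.
have kp : k \o p =1 q.
  apply: (jac_etale_unramified je hsurj hsq (u := q \o e)) => a //.
    by rewrite -(kf a) /= (pe a : p (e a) = _).
  by rewrite /= (hk (p a) : h (k (p a)) = _); exact/esym/(hq a).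
by move=> s ps; apply/qin_eq0; rewrite -/q -(kp s) /= ps rmorph0.
Qed.

(** Let $I$ be the kernel of [p]. An element [E] of $S (x) B$ is built which kills all $1 (x) p(s) -
    s (x) 1$ and which multiplication sends to 1. For [s0] in $I$ this gives $(s0 (x) 1) E = 0$; by
    flatness it holds in $I (x) B$, and its image in $S/I^2$ is [s0] times a lift of 1. *)
Lemma flat_ker (A S B : comPzRingType) (e : {rmorphism A -> S})
    (p : {rmorphism S -> B}) (f : {rmorphism A -> B}) :
  jac_etale e -> p \o e =1 f -> (forall b, exists s, p s = b) -> flat f ->
  forall s, p s = 0 -> idl (prods (kerp p) (kerp p)) s.
Proof.
move=> [n [g [y [pres [w hw]]]]] pe surj fl s0 ps0.
have gy := (killsP _ _ _).1 (presented_kills pres).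
pose l : {rmorphism S -> tens e f} := tinl e f.
pose r : {rmorphism B -> tens e f} := tinr e f.
have lr : l \o e =1 r \o f by exact: tens_comm.
(* The increments between the two zeros $y (x) 1$ and $1 (x) p(y)$ of [g]; expanding [g] between
   them gives the exact equation $M de = 0$. *)
pose de : 'cV[tens e f]_n := \col_i (r (p (y i)) - l (y i)).
have [M [eM hM]] := hadamard_mx (l \o e) (l \o y) de g.
have Mde : M *m de = 0.
  suff [E1 E2] : \col_k peval (l \o e) (fun i => (l \o y) i + de i 0) (g k) = 0 :> 'cV_n /\
    \col_k peval (l \o e) (l \o y) (g k) = 0 :> 'cV_n by move: eM; rewrite E1 E2 add0r => <-.
  split; apply/matrixP => k j; rewrite !mxE.
    rewrite -(peval_morph (f := e) (h := r \o p) (x := y)) ?gy ?rmorph0 // => [a|i] /=.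
      by rewrite (pe a : p (e a) = _) -(lr a : l (e a) = r (f a)).
    by rewrite mxE addrC subrK.
  by rewrite -(peval_morph (f := e) (h := l) (x := y)) ?gy ?rmorph0.
(* The adjugate shows that $det M$ kills [de]. The factor [l w] comes from the inverse [w] of the
   Jacobian determinant and makes [mu E] equal to 1. *)
pose E := l w * \det M.
have Ede i : E * de i 0 = 0.
  have : \adj M *m (M *m de) = 0 by rewrite Mde mulmx0.
  rewrite mulmxA mul_adj_mx mul_scalar_mx => /matrixP/(_ i 0); rewrite [LHS]mxE [RHS]mxE => h.
  by rewrite /E -mulrA h mulr0.
have Eker s : E * (r (p s) - l s) = 0.
  have : idl (fam (fun i => de i 0)) (r (p s) - l s).
    apply/qin_eq0; apply/eqP; rewrite rmorphB subr_eq0; apply/eqP; set q := qin _.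
    apply: (gen_eq (h := q \o (r \o p)) (h' := q \o l) pres.1) => [a|i] /=.
      by rewrite (pe a : p (e a) = _) -(lr a : l (e a) = r (f a)).
    apply/eqP; rewrite -subr_eq0 -rmorphB; apply/eqP/qin_eq0/idl_in; exists i.
    by rewrite mxE.
  by case/idl_famP => c ->; rewrite mulr_sumr big1 // => i _; rewrite mulrCA Ede mulr0.
have [mu [mul mur]] : exists mu : {rmorphism tens e f -> B}, mu \o l =1 p /\ mu \o r =1 idfun.
  exact: (tens_ext (g := p) (h := idfun) pe).
have muE : mu E = 1.
  rewrite rmorphM (mul w : mu (l w) = _) -det_map_mx.
  have -> : map_mx mu M = map_mx p (jac e y g).
    rewrite (jac_morph (f' := f) (y := p \o y)) //.
    rewrite -(jac_morph (f := l \o e) (h := mu) (x := l \o y)) //; first last.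
    - by move=> i; exact: mul.
    - by move=> a; rewrite -(pe a); exact: mul.
    apply/matrixP => i j; rewrite mxE [RHS]mxE; apply/eqP; rewrite -subr_eq0 -rmorphB; apply/eqP.
    have := hM i j; rewrite [X in idl _ X]mxE [in X in _ + X]mxE.
    apply: idl_ker => _ [k ->]; rewrite mxE rmorphB.
    by rewrite (mul (y k) : mu (l _) = _) (mur (p (y k)) : mu (r _) = _) subrr.
  by rewrite det_map_mx -rmorphM hw rmorph1.
have [z zE] := tens_elt E.
have zx : tens_eq f [seq ((s0 * x.1 : S) : amod e, x.2) | x <- z] [::].
  apply: tens_sum_eq; rewrite big_nil big_map /=.
  transitivity (l s0 * E).
    by rewrite zE mulr_sumr; apply: eq_bigr => x _; rewrite rmorphM mulrA.
  have := Eker s0; rewrite ps0 rmorph0 sub0r mulrN => /eqP.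
  by rewrite oppr_eq0 mulrC => /eqP.
have [s sK] := choice_fun surj.
pose Q := prods (kerp p) (kerp p).
have DZ a (x : amod e) : p (x : S) = 0 -> p (a *: x : S) = 0.
  by move=> px; rewrite [a *: x]/(e a * (x : S)) rmorphM px mulr0.
have D0 : p ((0 : amod e) : S) = 0 by exact: rmorph0.
have DD (x x' : amod e) : p (x : S) = 0 -> p (x' : S) = 0 -> p ((x + x' : amod e) : S) = 0.
  by move=> h h'; rewrite [x + x']/((x : S) + (x' : S)) rmorphD h h' addr0.
pose D : submod (amod e) := @Submod A (amod e) (fun x => p (x : S) = 0) D0 DD DZ.
(* For [a] in the kernel, the class of [a * s b] modulo $I^2$ does not depend on the lift [s b] of
   [b]; this gives the map from $I (x) B$ to $S/I^2$. *)
have qeq a b b' : p a = 0 -> p (b - b') = 0 -> qin Q (a * b) = qin Q (a * b').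
  move=> ha hb; apply/eqP; rewrite -subr_eq0 -rmorphB -mulrBr; apply/eqP/qin_eq0/idl_in.
  by exists a, (b - b').
have := @flat_sub A (amod e) D B f (quot Q) (fun m b => qin Q ((m : S) * s b)) _ fl _ _ _ _ zx.
rewrite big_map => H.
have {H} : \sum_(x <- z) qin Q (s0 * x.1 * s x.2) = 0.
  apply: H => [m m' b _ _|m b b' hm|a m b hm|x].
  - by rewrite -rmorphD -mulrDl.
  - rewrite -rmorphD -mulrDr; apply: qeq => //.
    by rewrite !(rmorphB, rmorphD) !sK subrr.
  - rewrite [a *: m]/(e a * (m : S)) mulrAC mulrC; apply: qeq => //.
    by rewrite rmorphB rmorphM !sK (pe a : p (e a) = _) subrr.
  - by case/mapP => x' _ -> /=; rewrite rmorphM ps0 mul0r.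
rewrite -rmorph_sum => /qin_eq0 h; apply: idl_eq h.
rewrite (eq_bigr _ (fun x _ => esym (mulrA _ _ _))) -mulr_sumr -{1}(mulr1 s0) -mulrBr.
apply: idl_in; exists s0, (1 - \sum_(x <- z) x.1 * s x.2); split=> //.
rewrite /kerp rmorphB rmorph1 -muE zE !rmorph_sum.
rewrite -sumrB big1 // => x _; rewrite !rmorphM sK.
by rewrite (mul x.1 : mu (l _) = _) (mur x.2 : mu (r _) = _) subrr.
Qed.

Lemma fp_etale_jac (A B : comPzRingType) (f : {rmorphism A -> B}) : fp_etale f -> jac_etale f.
Proof.
move=> [fl ur fp]; have [S [e [p [je pe surj [m [r ker]]]]]] := unramified_cover ur fp.
exact: jac_etale_quotient je pe surj ker (flat_ker je pe surj fl).
Qed.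

Lemma formally_etale_jac (A B : comPzRingType) (f : {rmorphism A -> B}) :
  finitely_presented f ->
  (forall (C D : comPzRingType) (q : {rmorphism C -> D}), square_zero q -> unique_lifting f q) ->
  jac_etale f.
Proof.
move=> fp fe.
have ur : unramified f.
  move=> C D p surj sq u g h gu hu pgh.
  have [k [_ _ uniq]] := fe _ _ p (conj surj sq) u (p \o h) (fun a => congr1 p (esym (hu a))).
  by move=> b; rewrite (uniq g) // (uniq h).
have [S [e [p [je pe surj [m [r ker]]]]]] := unramified_cover ur fp.
exact: jac_etale_quotient je pe surj ker (formally_etale_ker je pe surj fe).
Qed.

(** * Noetherian rings *)

(** The ascending chain condition, expressed on a sequence of generators. *)
Definition noeth (R : comPzRingType) :=
  forall a : nat -> R, exists k, idl (fun y => exists2 j, (j < k)%N & y = a j) (a k).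

Lemma noeth_surj (R R' : comPzRingType) (g : {rmorphism R -> R'}) :
  (forall y, exists x, g x = y) -> noeth R -> noeth R'.
Proof.
move=> surj nR a; have [s sK] := choice_fun surj.
have [k hk] := nR (s \o a); exists k; rewrite -(sK (a k)).
apply: (idl_morph (S := fun y => exists2 j, (j < k)%N & y = (s \o a) j)) => //.
by move=> _ [j jk ->]; apply: idl_in; exists j; rewrite //= sK.
Qed.

(** * Hilbert's basis theorem *)

Section Hilbert.
Variables (R R' : comPzRingType) (g : {rmorphism R -> R'}) (t : R').

(** Replaces the condition of having degree less than [D]; as [t] may be algebraic over [R], the
    coefficients need not be unique. *)
Definition low D (x : R') := exists c : nat -> R, x = \sum_(i < D) g (c i) * t ^+ i.

Lemma low_add D x y : low D x -> low D y -> low D (x + y).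
Proof.
move=> [c ->] [d ->]; exists (fun i => c i + d i).
by rewrite -big_split; apply: eq_bigr => i _; rewrite rmorphD mulrDl.
Qed.

Lemma low_scale D a x : low D x -> low D (g a * x).
Proof.
move=> [c ->]; exists (fun i => a * c i).
by rewrite mulr_sumr; apply: eq_bigr => i _; rewrite rmorphM mulrA.
Qed.

Lemma low_opp D x : low D x -> low D (- x).
Proof. by move/(low_scale (-1)); rewrite rmorphN1 mulN1r. Qed.

Lemma low_shift D x e : low D x -> low (e + D) (t ^+ e * x).
Proof.
move=> [c ->]; exists (fun i => if (i < e)%N then 0 else c (i - e)%N).
rewrite big_split_ord /= [X in _ = X + _]big1 ?add0r => [|i _]; last by rewrite ltn_ord rmorph0 mul0r.
rewrite mulr_sumr; apply: eq_bigr => i _.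
by rewrite ltnNge leq_addr /= addKn mulrCA exprD.
Qed.

Lemma low0 D : low D 0.
Proof. by exists (fun=> 0); rewrite big1 // => i _; rewrite rmorph0 mul0r. Qed.

Lemma low_lead D x : low D.+1 x -> exists b, low D (x - g b * t ^+ D).
Proof. by move=> [c ->]; exists (c D); rewrite big_ord_recr /= addrK; exists c. Qed.

(** Each new element is chosen in terms of the list of all earlier ones. *)
Fixpoint iter_list (next : seq R' -> nat * R') k : seq R' :=
  if k is k'.+1 then (next (iter_list next k')).2 :: iter_list next k' else [::].

(** Otherwise the ideal [J] generated by the sequence is not finitely generated. Elements of [J]
    outside the ideal of the earlier ones are chosen with least degree bound; some leading
    coefficient lies in the ideal of the earlier ones, and cancelling it contradicts minimality. *)
Lemma noeth_hilbert : noeth R -> (forall x, exists D, low D x) -> noeth R'.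
Proof.
move=> nR gen a; apply: contrapT => nex.
pose pre k := idl (fun y => exists2 j, (j < k)%N & y = a j).
have npre k : ~ pre k (a k) by move=> h; apply: nex; exists k.
have preS k k' x : (k <= k')%N -> pre k x -> pre k' x.
  move=> kk'; apply: idl_sub => _ [j jk ->]; apply: idl_in; exists j => //.
  exact: leq_trans jk kk'.
pose J x := exists k, pre k x.
have JD x y : J x -> J y -> J (x + y).
  move=> [k hk] [k' hk']; exists (maxn k k'); apply: idlD.
    exact: preS (leq_maxl _ _) hk.
  exact: preS (leq_maxr _ _) hk'.
have JM b x : J x -> J (b * x) by move=> [k hk]; exists k; exact: idlM.
pose inL L := idl (fun y : R' => List.In y L).
have JL L x : (forall l, List.In l L -> J l) -> inL L x -> J x.
  move=> hL; elim=> [|b s /hL|y z _ hy _ hz]; [by exists 0; exact: idl0|exact: JM|exact: JD].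
have nL L : (forall l, List.In l L -> J l) -> exists x, J x /\ ~ inL L x.
  move=> hL; have [K hK] : exists K, forall l, List.In l L -> pre K l.
    elim: L hL => [|l L IH] hL; first by exists 0.
    have [|K hK] := IH; first by move=> l' h; apply: hL; right.
    have [k hk] := hL l (or_introl erefl).
    exists (maxn K k) => l' [<-|/hK]; first exact: preS (leq_maxr _ _) hk.
    exact: preS (leq_maxl _ _).
  exists (a K); split; first by exists K.+1; apply: idl_in; exists K.
  by move=> h; apply: (npre K); apply: idl_sub h => l /hK.
(* The pair is a degree and an element of that degree. The guard on [L] makes the choice total; for
   other lists the value is arbitrary. *)
pose P L (p : nat * R') := (forall l, List.In l L -> J l) ->
  [/\ J p.2, ~ inL L p.2, low p.1.+1 p.2 &
    forall D x, J x -> ~ inL L x -> low D x -> (p.1 < D)%N].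
have [next nextP] : exists next, forall L, P L (next L).
  apply: choice_fun => L.
  have [hL|hL] := pselect (forall l, List.In l L -> J l); last by exists (0%N, 0).
  have ex : exists D, `[< exists x, [/\ J x, ~ inL L x & low D x] >].
    by have [x [Jx nx]] := nL L hL; have [D lD] := gen x; exists D; apply/asboolP; exists x.
  case: (ex_minnP ex) => [[|D]] /asboolP[x [Jx nx lx]] hmin.
    by case: nx; case: lx => c ->; rewrite big_ord0; exact: idl0.
  exists (D, x) => _; split=> // D' x' Jx' nx' lx'; apply: hmin.
  by apply/asboolP; exists x'.
pose Ls := iter_list next.
have LsP k l : List.In l (Ls k) <-> exists2 j, (j < k)%N & l = (next (Ls j)).2.
  elim: k => [|k IH] /=; first by split=> // -[].
  rewrite -/(Ls k); split=> [[<-|h]|[j]]; first by exists k.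
    by have [j jk ->] := IH.1 h; exists j => //; exact: ltnW.
  rewrite ltnS leq_eqVlt => /predU1P[-> ->|jk e]; first by left.
  by right; apply: IH.2; exists j.
have LsJ k : forall l, List.In l (Ls k) -> J l.
  elim: k => [//|k IH] l /=; rewrite -/(Ls k) => -[<-|h]; last exact: IH.
  by case: (nextP (Ls k) IH).
pose dg k := (next (Ls k)).1; pose xx k := (next (Ls k)).2.
have Ns k := nextP (Ls k) (LsJ k).
have dg_le j k : (j <= k)%N -> (dg j <= dg k)%N.
  move=> jk; have [_ _ _ hmin] := Ns j; have [Jx nx lx _] := Ns k.
  rewrite -ltnS; apply: (hmin _ (next (Ls k)).2) => // h; apply: nx.
  apply: idl_sub h => l /LsP[i ij ->]; apply: idl_in; apply/LsP.
  by exists i => //; exact: leq_trans ij jk.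
have [b bP] : exists b, forall k, low (dg k) (xx k - g (b k) * t ^+ dg k).
  apply: (choice_fun (P := fun k bk => low (dg k) (xx k - g bk * t ^+ dg k))) => k.
  by apply: low_lead; case: (Ns k).
have [k hk] := nR b.
(* [z] is the combination of earlier elements, shifted by powers of [t], with the same leading term
   as [xx k]. *)
have [z [zL lz]] : exists z, inL (Ls k) z /\ low (dg k) (z - g (b k) * t ^+ dg k).
  elim: hk => [|c _ [j jk ->]|y y' _ [z [hz lz]] _ [z' [hz' lz']]].
  - by exists 0; split; [exact: idl0|rewrite rmorph0 mul0r subr0; exact: low0].
  - have jk' := dg_le _ _ (ltnW jk).
    exists (g c * t ^+ (dg k - dg j) * xx j); split.
      by apply: idl_mem; apply/LsP; exists j.
    have e : t ^+ dg k = t ^+ (dg k - dg j) * t ^+ dg j by rewrite -exprD subnK.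
    rewrite rmorphM e.
    have := low_scale c (low_shift (dg k - dg j) (bP j)); rewrite subnK //.
    by congr (low _ _); ring.
  - exists (z + z'); split; first exact: idlD.
    have := low_add lz lz'; congr (low _ _); rewrite rmorphD; ring.
have [Jx nx lx hmin] := Ns k.
suff : (dg k < dg k)%N by rewrite ltnn.
apply: (hmin _ (xx k - z)).
- by apply: JD => //; rewrite -mulN1r; apply: JM; exact: JL (LsJ k) zL.
- by move=> h; apply: nx; rewrite -[_.2](subrK z); exact: idlD.
- have := low_add (bP k) (low_opp lz); congr (low _ _); ring.
Qed.

End Hilbert.

(** The last generator is adjoined to the polynomial ring in the other variables, which is
    Noetherian by induction. *)
Lemma noeth_fg n (R R' : comPzRingType) (g : {rmorphism R -> R'}) (x : 'I_n -> R') :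
  noeth R -> (forall y, exists t, peval g x t = y) -> noeth R'.
Proof.
move=> nR; elim: n R' g x => [|n IH] R' g x gen.
  apply: (noeth_surj (g := g)) nR => y; have [t <-] := gen y.
  elim: t => [a|[]//|t [a IHt] u [b IHu]|t [a IHt] u [b IHu]] /=; first by exists a.
    by exists (a + b); rewrite rmorphD IHt IHu.
  by exists (a * b); rewrite rmorphM IHt IHu.
have [h [hg hx]] := pa0_ext g (x \o lift ord_max).
have nP : noeth (pa (A := R) (n := n) [::]).
  apply: IH (pa_presented _).1.
apply: (noeth_hilbert (g := h) (t := x ord_max) nP) => y.
have lowS D D' z : (D <= D')%N -> low h (x ord_max) D z -> low h (x ord_max) D' z.
  move=> DD' [c ->]; exists (fun i => if (i < D)%N then c i else 0).
  rewrite (big_ord_widen D' (fun i => h (c i) * x ord_max ^+ i) DD') big_mkcond.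
  by apply: eq_bigr => i _; case: ifP => // _; rewrite rmorph0 mul0r.
have [t <-] := gen y; elim: t => [a|i|t [D hD] u [D' hD']|t [D hD] u [D' hD']] /=.
- exists 1%N, (fun=> pa_in [::] a); rewrite big_ord1 mulr1; exact/esym/hg.
- case: (unliftP ord_max i) => [j|] ->.
    by exists 1%N, (fun=> pa_var [::] j); rewrite big_ord1 mulr1 hx.
  exists 2%N, (fun i => (i == 1)%N%:R); rewrite big_ord_recl big_ord1 /=.
  by rewrite rmorph0 mul0r add0r rmorph1 mul1r.
- exists (maxn D D'); apply: low_add; first exact: lowS (leq_maxl _ _) hD.
  exact: lowS (leq_maxr _ _) hD'.
- case: hD' => d ->; rewrite mulr_sumr.
  have hm (i : 'I_D') : low h (x ord_max) (D' + D) (peval g x t * (h (d i) * x ord_max ^+ i)).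
    apply: (lowS (i + D)%N); first by rewrite leq_add2r ltnW.
    by rewrite mulrCA [peval _ _ _ * _]mulrC; apply: low_scale; exact: low_shift.
  exists (D' + D)%N; elim/big_rec: _ => [|i z _ hz]; [exact: low0|exact: low_add].
Qed.

(** Let [d] be the least positive integer in the union of the ideals of initial segments, reached by
    the first [k] terms. It divides [a k], since the remainder lies in the next ideal and is
    smaller. *)
Lemma noeth_int : noeth int.
Proof.
move=> a; pose pre k := idl (fun y => exists2 j, (j < k)%N & y = a j).
have preS k k' x : (k <= k')%N -> pre k x -> pre k' x.
  move=> kk'; apply: idl_sub => _ [j jk ->]; apply: idl_in; exists j => //.
  exact: leq_trans jk kk'.
have [a0|a0] := pselect (a 0%N = 0); first by exists 0%N; rewrite a0; exact: idl0.
have ex : exists d, (0 < d)%N && `[< exists k, pre k d%:Z >].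
  exists `|a 0%N|%N; rewrite absz_gt0; apply/andP; split; first exact/eqP.
  apply/asboolP; exists 1%N; rewrite abszEsg; apply: idl_mem.
  by exists 0%N.
case: (ex_minnP ex) => d /andP[d0 /asboolP[k hk]] hmin; exists k.
have dn0 : d%:Z != 0 by rewrite eqz_nat -lt0n.
rewrite (divz_eq (a k) d).
have /eqP -> : (a k %% d)%Z == 0; last by rewrite addr0; exact: idlM.
have r0 := modz_ge0 (a k) dn0; have rd : (a k %% d)%Z < d%:Z by apply: ltz_pmod; rewrite ltz_nat.
apply: contraTT (rd) => rn0; rewrite -leNgt; case er: (a k %% d)%Z r0 rn0 => [r|//] _ rn0.
rewrite lez_nat; apply: hmin; rewrite lt0n -eqz_nat rn0 /=; apply/asboolP; exists k.+1.
rewrite -er (_ : (a k %% d)%Z = a k - (a k %/ d)%Z * d); last by rewrite {2}(divz_eq (a k) d) addrC addKr.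
apply: idlB; first by apply: idl_in; exists k.
by apply: idlM; exact: preS (leqnSn _) hk.
Qed.

(** After a case split on $1 = 0$, this leads to the rings over which [{poly P}] and [{mpoly A[n]}]
    are formed. *)
Lemma nz_pack (R : comPzRingType) :
  (1 : R) <> 0 -> exists R' : comNzRingType, (R' : comPzRingType) = R.
Proof.
case: R => T c h.
pose R := GRing.ComPzRing.Pack c.
have nz : (1 : R) != 0 by apply/eqP.
pose m := GRing.PzSemiRing_isNonZero.Build R nz.
pose R' : comNzRingType := HB.pack T c m.
by exists R'.
Qed.

(** * Krull's intersection theorem *)

Fixpoint ipow (R : comPzRingType) (I : R -> Prop) k : R -> Prop :=
  if k is k'.+1 then idl (prods I (ipow I k')) else fun=> True.

Section Krull.
Variables (P : comNzRingType) (n : nat) (q : 'I_n -> P) (S : P -> Prop) (x : P).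
Local Notation I := (idl (fam q)).

(* Perdry's proof: the elements x t^k of the Rees algebra, read modulo (S),
   generate a finitely generated ideal. *)
Lemma krull_nz :
  noeth P -> (forall k, exists2 y, ipow I k y & idl S (x - y)) ->
  exists2 i, I i & idl S (x - i * x).
Proof.
move=> nP hx.
pose W : comPzRingType := pa (A := P) (n := n) [::].
have nW : noeth W by apply: (noeth_fg nP (pa_presented _).1).
(* The image of [phi] is the Rees algebra, the sum of all $I^k T^k$ in $P[T]$. *)
have [phi [phiC phiX]] := pa0_ext (polyC : {rmorphism P -> {poly P}}) (fun i => (q i)%:P * 'X).
have lift k y : ipow I k y -> exists F : W, phi F = y%:P * 'X^k.
  elim: k y => [|k IH] y /=.
    by exists (pa_in [::] y); rewrite expr0 mulr1; exact: phiC.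
  elim=> [|a _ [b [c [/idl_famP[d ->] /IH[F FE] ->]]]|u v _ [F FE] _ [G GE]].
  - by exists 0; rewrite rmorph0 polyC0 mul0r.
  - exists (pa_in [::] a * (\sum_i pa_in [::] (d i) * pa_var [::] i) * F).
    rewrite !rmorphM FE rmorph_sum (phiC a : phi _ = _).
    rewrite (eq_bigr (fun i => ((d i * q i)%:P * 'X))) => [|i _]; last first.
      by rewrite rmorphM (phiC (d i) : phi _ = _) phiX polyCM mulrA.
    rewrite -mulr_suml -rmorph_sum exprS; ring.
  - by exists (F + G); rewrite rmorphD FE GE polyCD mulrDl.
have [y yI yS] : exists2 y : nat -> P, forall k, ipow I k (y k) & forall k, idl S (x - y k).
  have [y hy] := choice_fun (fun k => let: ex_intro2 y h1 h2 := hx k in ex_intro _ y (conj h1 h2)).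
  by exists y => k; case: (hy k).
have [F FE] := choice_fun (fun k => lift k _ (yI k)).
have phiI w i : I (phi w)`_(i.+1).
  have [t <-] := (pa_presented [::]).1 w; elim: t i => [a|j|t IHt u IHu|t IHt u IHu] i /=.
  - by rewrite (phiC a : phi _ = _) coefC; exact: idl0.
  - rewrite phiX mulrC coefXM /= coefC; case: i => [|i]; last exact: idl0.
    by apply: idl_in; exists j.
  - by rewrite rmorphD coefD; exact: idlD.
  - rewrite rmorphM coefM; apply: idl_sum => -[[|k] kP] _ /=.
      by rewrite subn0; exact: idlM.
    exact: idlMr.
have [k hk] := nW F.
(* In degree [k], a combination of the [F j] with $j < k$ has coefficient a sum of terms
   $phi(a)_(k-j) y_j$. Modulo (S) each $y_j$ is [x], and its factor lies in $I$ because $k - j >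
   0$. *)
have : exists2 i, I i & idl S ((phi (F k))`_k - i * x).
  elim: hk => [|a _ [j jk ->]|u v _ [i hi ei] _ [i' hi' ei']].
  - by exists 0; [exact: idl0|rewrite rmorph0 coef0 mul0r subrr; exact: idl0].
  - exists (phi a)`_(k - j); first by case: (k - j)%N (subn_gt0 j k) => [|d _ //]; rewrite jk.
    rewrite rmorphM FE mulrA coefMXn ltnNge (ltnW jk) /= coefMC -mulrBr -opprB.
    by apply/idlM/idlN.
  - exists (i + i'); first exact: idlD.
    by rewrite rmorphD coefD mulrDl opprD addrACA; exact: idlD.
move=> [i hi ei]; exists i => //.
have -> : x - i * x = (x - y k) + ((phi (F k))`_k - i * x).
  by rewrite FE coefMXn ltnn subnn coefC /= addrA subrK.
exact: idlD.
Qed.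

End Krull.

Lemma krull (P : comPzRingType) n (q : 'I_n -> P) (S : P -> Prop) (x : P) :
  noeth P -> (forall k, exists2 y, ipow (idl (fam q)) k y & idl S (x - y)) ->
  exists2 i, idl (fam q) i & idl S (x - i * x).
Proof.
have [P0|/nz_pack[P' eP]] := pselect ((1 : P) = 0).
  move=> _ _; exists 0; first exact: idl0.
  by rewrite -[_ - _]mulr1 P0 mulr0; exact: idl0.
by subst P; exact: krull_nz.
Qed.

(** * The equational criterion for flatness *)

Definition eqflat (A B : comPzRingType) (f : {rmorphism A -> B}) :=
  forall m (a : 'rV[A]_m) (b : 'cV[B]_m), map_mx f a *m b = 0 ->
  exists l (G : 'M[A]_(m, l)) (c : 'cV[B]_l), b = map_mx f G *m c /\ a *m G = 0.

(** The criterion is applied to the first row, and the remaining rows become relations on the new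
    column [c]. *)
Lemma eqflat_rows (A B : comPzRingType) (f : {rmorphism A -> B}) : eqflat f ->
  forall p m (a : 'M[A]_(p, m)) (b : 'cV[B]_m), map_mx f a *m b = 0 ->
  exists l (G : 'M[A]_(m, l)) (c : 'cV[B]_l), b = map_mx f G *m c /\ a *m G = 0.
Proof.
move=> ef; elim=> [|p IH] m a b ab.
  exists m, 1%:M, b; split; first by rewrite map_mx1 mul1mx.
  by apply/matrixP => -[].
move: a ab; rewrite -(add1n p) => a; rewrite -[a]vsubmxK map_col_mx mul_col_mx -col_mx0.
move=> /eq_col_mx[ab1 ab2].
have [l [G [c [bG aG]]]] := ef _ _ _ ab1.
have [|l' [G' [c' [cG' aG']]]] := IH _ (dsubmx a *m G) c.
  by rewrite map_mxM -mulmxA -bG.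
exists l', (G *m G'), c'; split.
  by rewrite map_mxM -mulmxA -cG'.
by rewrite mul_col_mx !mulmxA aG mul0mx aG' col_mx0.
Qed.

(** [P] is free on the monomials: [c] lists them, [G] holds the coefficients of [b], and comparing
    coefficients in the relation gives $a G = 0$. *)
Lemma eqflat_free (A : comNzRingType) n (P : comPzRingType) (i : {rmorphism A -> P})
    (X : 'I_n -> P) (psi : {rmorphism P -> {mpoly A[n]}}) :
  psi \o i =1 @mpolyC n A -> (forall k, psi (X k) = 'X_k) ->
  (forall b, exists t, peval i X t = b) -> eqflat i.
Proof.
have /nz_pack[P' eP] : (1 : P) <> 0.
  move/(congr1 psi)/eqP; rewrite rmorph1 rmorph0; apply/negP; exact: oner_neq0.
subst P; move: P' i X psi => P i X psi psiC psiX gen.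
have psiK : mmap i X \o psi =1 id.
  apply: (gen_eq (h := mmap i X \o psi) (h' := idfun) gen) => [a|k] /=.
    by rewrite (psiC a : psi (i a) = _) mmapC.
  by rewrite psiX mmapX mmap1U.
move=> m a b ab.
(* A bound such that every monomial occurring in some [b j] has degree less than [k]. *)
pose k := \max_j msize (psi (b j ord0)).
exists #|{: 'X_{1..n < k}}|, (\matrix_(j, l) (psi (b j ord0))@_(val (enum_val l))).
exists (\col_l mmap1 X (val (enum_val l))); split.
  apply/matrixP => j z; rewrite (ord1 z) -[LHS]psiK /= (mmapE k) ?mxE; last exact: (leq_bigmax j).
  rewrite (reindex_onto (enum_val (A := {: 'X_{1..n < k}})) enum_rank) => [|l _]; last by rewrite enum_rankK.
  apply: eq_big => [l|l _]; first by rewrite enum_valK eqxx.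
  by rewrite !mxE.
apply/matrixP => z l; rewrite (ord1 z) !mxE.
have := congr1 (fun M : 'M_1 => (psi (M ord0 ord0))@_(val (enum_val l))) ab.
rewrite !mxE rmorph0 mcoeff0 rmorph_sum linear_sum /= => {2}<-; apply: eq_bigr => j _.
by rewrite !mxE rmorphM (psiC (a ord0 j) : psi (i _) = _) mcoeffCM.
Qed.

Lemma eqflat_pa (A : comPzRingType) n : eqflat (pa_in (A := A) (n := n) [::]).
Proof.
have [A0|/nz_pack[A' eA]] := pselect ((1 : A) = 0).
  move=> m a b _; exists 0%N, 0, 0; split; last by apply/matrixP => i [].
  apply/matrixP => i j; rewrite -[LHS]mul1r -[RHS]mul1r.
  by rewrite -(rmorph1 (pa_in [::])) A0 rmorph0 !mul0r.
subst A; move: A' => A.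
have [psi [psiC psiX]] := pa0_ext (@mpolyC n A : {rmorphism A -> {mpoly A[n]}}) (fun k => 'X_k).
exact: eqflat_free psiC psiX (pa_presented [::]).1.
Qed.

Lemma presented_ker (A B : comPzRingType) (f : {rmorphism A -> B}) n m
    (g : 'I_m -> pexp A n) (x : 'I_n -> B) (p : {rmorphism pa (A := A) (n := n) [::] -> B}) :
  presented f (rels g) x -> p \o pa_in [::] =1 f -> (forall i, p (pa_var [::] i) = x i) ->
  forall z, p z = 0 -> idl (fam (fun i => peval (pa_in [::]) (pa_var [::]) (g i))) z.
Proof.
move=> pres pf px z pz; set q := fun i : 'I_m => _.
have [k [kf kx]] : exists k : {rmorphism B -> quot (fam q)},
    k \o f =1 qin (fam q) \o pa_in [::] /\ forall i, k (x i) = qin (fam q) (pa_var [::] i).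
  apply: (presented_ext pres); apply/killsP => i.
  rewrite -(peval_morph (f := pa_in [::]) (h := qin (fam q)) (x := @pa_var A n [::])) //.
  by apply/qin_eq0/idl_in; exists i.
apply/qin_eq0; have <- : k (p z) = qin (fam q) z; last by rewrite pz rmorph0.
apply: (gen_eq (h := k \o p) (pa_presented [::]).1) => [a|i] /=.
  by rewrite (pf a : p _ = _); exact: kf.
by rewrite px kx.
Qed.

Lemma ipow_le (R : comPzRingType) (S : R -> Prop) k : forall x, ipow (idl S) k.+1 x -> ipow (idl S) k x.
Proof.
elim: k => [//|k IH] x; apply: idl_sub => _ [a [b [ha hb ->]]].
by apply: idl_in; exists a, b; split=> //; exact: IH.
Qed.

Lemma idl_prodE (R : comPzRingType) m (a : 'I_m -> R) S x :
  idl (prods (fam a) (idl S)) x -> exists y : 'I_m -> R, (forall i, idl S (y i)) /\ x = \sum_i a i * y i.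
Proof.
elim=> [|c _ [_ [b [[j ->] hb ->]]]|u v _ [y [hy ->]] _ [y' [hy' ->]]].
- exists (fun=> 0); split=> [_|]; first exact: idl0.
  by rewrite big1 // => i _; rewrite mulr0.
- exists (fun i => if i == j then c * b else 0); split=> [i|].
    by case: ifP => _; [exact: idlM|exact: idl0].
  rewrite (bigD1 j) //= eqxx big1 ?addr0 => [|i /negPf ->]; last exact: mulr0.
  by rewrite mulrCA.
- exists (fun i => y i + y' i); split=> [i|]; first exact: idlD.
  by rewrite -big_split; apply: eq_bigr => i _; rewrite mulrDr.
Qed.

(** A relation $sum a_j b_j = 0$ is lifted to [z] over the polynomial ring [P]. The sum [x0] of the
    $a_j z_j$ lies in the ideal $I$ of the relations; once [x0] is known to be a sum of $a_j y_j$
    with $y_j$ in $I$, the corrected $z_j - y_j$ satisfy an exact relation in [P], which is flat. *)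
Lemma jac_etale_eqflat_noeth (A B : comPzRingType) (f : {rmorphism A -> B}) :
  noeth A -> jac_etale f -> eqflat f.
Proof.
move=> nA [n [g [x [pres [d hd]]]]].
have gx := (killsP _ _ _).1 (presented_kills pres).
have [P [i [X [genP extP kerP nP efP]]]] : exists (P : comPzRingType)
    (i : {rmorphism A -> P}) (X : 'I_n -> P),
  [/\ forall b : P, exists t, peval i X t = b,
      forall (C : comPzRingType) (h : {rmorphism A -> C}) (y : 'I_n -> C),
        exists p : {rmorphism P -> C}, p \o i =1 h /\ forall k, p (X k) = y k,
      forall p : {rmorphism P -> B}, p \o i =1 f -> (forall k, p (X k) = x k) ->
        forall z, p z = 0 -> idl (fam (fun k => peval i X (g k))) z,
      noeth P & eqflat i].
  have genP := (pa_presented (A := A) (n := n) [::]).1.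
  exists (pa [::]), (pa_in [::]), (pa_var [::]); split=> //.
  - exact: pa0_ext.
  - by move=> p; exact: presented_ker.
  - exact: noeth_fg nA genP.
  - exact: eqflat_pa.
have [p [pi pX]] := extP _ f x.
have psurj b : exists z, p z = b.
  by have [t <-] := pres.1 b; exists (peval i X t); exact: peval_morph.
have [s sK] := choice_fun psurj.
pose q k := peval i X (g k).
pose I := idl (fam q).
have kerI z : p z = 0 -> I z by exact: kerP.
have pq k : p (q k) = 0 by rewrite (peval_morph _ pi pX).
have Iker z : I z -> p z = 0 by apply: idl_ker => _ [k ->].
have [_ inv2] := adj_inv hd.
pose N : 'M[P]_n := map_mx s (d *: \adj (jac f x g)).
have pN : map_mx p N = d *: \adj (jac f x g) by apply/matrixP => a b; rewrite mxE [X in p X]mxE sK.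
pose Q : 'cV[P]_n := \col_k q k.
pose e : 'cV[P]_n := - (N *m Q).
have he k : I (e k 0).
  rewrite !mxE; apply: idlN; apply: idl_sum => l _; rewrite [Q l 0]mxE; apply: idl_mem; by exists l.
have [th [thi thX]] : exists th : {rmorphism P -> P}, th \o i =1 i /\ forall k, th (X k) = X k + e k 0.
  exact: extP.
have pth : p \o th =1 p.
  apply: (gen_eq (h := p \o th) genP) => [a|k]; first exact: (congr1 p (thi a)).
  by rewrite /= thX rmorphD (Iker _ (he k)) addr0.
have Ith z : I z -> I (th z).
  by move=> /Iker pz; apply: kerI; rewrite -[p _]/((p \o th) z) pth.
have [M [eM hM]] := hadamard_mx i X e g.
(* By the expansion at the Newton step, [th (q k)] is an entry of $(1 - M N) Q$, and both factors
   have entries in $I$. *)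
have thq k : ipow I 2 (th (q k)).
  have -> : th (q k) = ((1%:M - M *m N) *m Q) k 0.
    have h := congr1 (fun v : 'cV_n => v k 0) eM; rewrite /= !mxE in h.
    rewrite (peval_morph (g := i) (y := fun i => X i + e i 0)) // h mulmxBl mul1mx -mulmxA.
    rewrite -[RHS]/(((Q - M *m (N *m Q)) : 'cV_n) k 0) [RHS]mxE [Q k 0]mxE; congr (_ + _).
    have -> : - (M *m (N *m Q)) = M *m e by rewrite /e mulmxN.
    by rewrite [RHS]mxE.
  rewrite mxE; apply: idl_sum => l _; apply: idl_in; exists ((1%:M - M *m N) k l), (Q l 0).
  split=> //; last by rewrite mxE; apply: idl_in; exists (q l), 1; split; rewrite ?mulr1 //; apply: idl_in; exists l.
  apply: kerI; suff : map_mx p (1%:M - M *m N) = 0 by move/matrixP/(_ k l); rewrite !mxE.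
  rewrite map_mxB map_mxM map_mx1 pN.
  have -> : map_mx p M = jac f x g.
    rewrite -(jac_morph g pi pX); apply/matrixP => a b; rewrite mxE [RHS]mxE.
    apply/eqP; rewrite -subr_eq0 -rmorphB; apply/eqP; have := hM a b; rewrite [X in idl _ X]mxE [in X in _ + X]mxE.
    by apply: idl_ker => _ [l' ->]; exact: Iker.
  by rewrite inv2 subrr.
have thI2 z : I z -> ipow I 2 (th z).
  by apply: idl_morph => _ [k ->]; apply: idl_sub (thq k) => w hw; exact: idl_in.
have thI k : forall z, ipow I k.+1 z -> ipow I k.+2 (th z).
  elim: k => [|k IH] z.
    move=> hz; apply: thI2; elim: hz => [|c _ [a [b [ha _ ->]]]|u v _ hu _ hv]; [exact: idl0| |exact: idlD].
    by apply: idlM; exact: idlMr.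
  apply: idl_morph => _ [a [b [ha /IH hb ->]]]; rewrite rmorphM.
  by apply: idl_in; exists (th a), (th b); split=> //; exact: Ith.
have thr r z : I z -> ipow I r.+1 (iter r th z).
  move=> hz; elim: r => [|r IH]; last by rewrite iterS; exact: thI.
  by apply: idl_in; exists z, 1; rewrite mulr1.
have thp r z : p (iter r th z) = p z.
  by elim: r => // r IH; rewrite iterS -IH -[LHS]/((p \o th) _) pth.
have thD r z w : iter r th (z + w) = iter r th z + iter r th w.
  by elim: r => // r IH; rewrite !iterS IH rmorphD.
have tha r a z : iter r th (i a * z) = i a * iter r th z.
  by elim: r => // r IH; rewrite !iterS IH rmorphM (thi a : th (i a) = _).
move=> m a b ab.
pose z : 'cV[P]_m := map_mx s b.
have pz : map_mx p z = b by apply/matrixP => k l; rewrite !mxE sK.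
pose x0 : P := \sum_j i (a 0 j) * z j 0.
have px0 : p x0 = 0.
  have := congr1 (fun v : 'M_1 => v 0 0) ab; rewrite !mxE => <-.
  rewrite rmorph_sum; apply: eq_bigr => j _.
  by rewrite rmorphM (pi (a 0 j) : p (i _) = _) !mxE sK.
have Ix0 := kerI _ px0.
pose ia j := i (a 0 j).
(* The approximation of [x0] is its [k]-th Newton iterate. Iterates are [A]-linear and the identity
   modulo $I$, so the difference is a sum of $a_j$ times elements of $I$. *)
have [c hc hx] : exists2 c, I c & idl (prods (fam ia) I) (x0 - c * x0).
  apply: krull nP _ => k; exists (iter k th x0); first exact/ipow_le/thr.
  have -> : iter k th x0 = \sum_j ia j * iter k th (z j 0).
    rewrite /x0; elim/big_rec2: _ => [|j w w' _ <-]; last by rewrite thD tha.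
    by have := tha k 0 0; rewrite mulr0 rmorph0 mul0r.
  rewrite -sumrB; apply: idl_sum => j _; rewrite -mulrBr; apply: idl_in.
  exists (ia j), (z j 0 - iter k th (z j 0)); split=> //; first by exists j.
  by apply: kerI; rewrite rmorphB thp subrr.
(* The remaining part [c * x0] is the sum of $a_j (c z_j)$ with [c] in $I$. *)
have : idl (prods (fam ia) I) x0.
  apply: idl_eq hx _; rewrite mulr_sumr; apply: idl_sum => j _; rewrite mulrCA.
  by apply: idl_in; exists (ia j), (c * z j 0); split=> //; [exists j|exact: idlMr].
case/idl_prodE => y [Iy x0y].
have [|l [G [cc [zG aG]]]] := efP _ a (z - \col_j y j).
  apply/matrixP => u v; rewrite (ord1 u) (ord1 v) mulmxBr !mxE; apply/eqP; rewrite subr_eq0; apply/eqP.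
  transitivity x0; first by apply: eq_bigr => j _; rewrite [map_mx _ _ _ _]mxE.
  by rewrite x0y; apply: eq_bigr => j _; rewrite !mxE.
exists l, G, (map_mx p cc); split=> //.
have := congr1 (map_mx p) zG; rewrite map_mxB pz map_mxM -map_mx_comp.
have -> : map_mx p (\col_j y j) = 0 by apply/matrixP => u v; rewrite !mxE; exact/Iker/Iy.
rewrite subr0 => ->; congr (_ *m _); apply/matrixP => u v; rewrite !mxE; exact: pi.
Qed.

(** * From the equational criterion to flatness *)

Section Teq.
Variables (A B : comPzRingType) (f : {rmorphism A -> B}).

Definition dec (N : lmodType A) m (c : 'cV[B]_m) (w : seq (N * 'rV[A]_m)) : seq (N * B) :=
  [seq (x.1, (map_mx f x.2 *m c) 0 0) | x <- w].
Definition tot (N : lmodType A) m (w : seq (N * 'rV[A]_m)) (j : 'I_m) : N :=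
  \sum_(x <- w) x.2 0 j *: x.1.

(* When B is flat, two tensors are equal as soon as their second components
   can be expanded in a common finite family c in such a way that the
   coefficients of each c_j agree. *)
Definition teq (N : lmodType A) (s t : seq (N * B)) :=
  exists m (c : 'cV[B]_m) w w', [/\ dec c w = s, dec c w' = t & tot w =1 tot w'].

Section Module.
Variable N : lmodType A.
Implicit Types s t : seq (N * B).

Definition chg m l (G : 'M[A]_(m, l)) (w : seq (N * 'rV[A]_m)) : seq (N * 'rV[A]_l) :=
  [seq (x.1, x.2 *m G) | x <- w].

Lemma dec_chg m l (G : 'M[A]_(m, l)) c w : dec c (chg G w) = dec (map_mx f G *m c) w.
Proof. by rewrite /dec -map_comp; apply: eq_map => x /=; rewrite map_mxM mulmxA. Qed.

Lemma tot_chg m l (G : 'M[A]_(m, l)) w k : tot (chg G w) k = \sum_j G j k *: tot w j.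
Proof.
rewrite /tot big_map /=.
under [RHS]eq_bigr => j _ do rewrite scaler_sumr.
rewrite exchange_big /=; apply: eq_bigr => x _.
rewrite mxE scaler_suml; apply: eq_bigr => j _.
by rewrite scalerA mulrC.
Qed.

Lemma dec_cat m (c : 'cV[B]_m) (w w' : seq (N * 'rV[A]_m)) : dec c (w ++ w') = dec c w ++ dec c w'.
Proof. exact: map_cat. Qed.

Lemma tot_cat m (w w' : seq (N * 'rV[A]_m)) j : tot (w ++ w') j = tot w j + tot w' j.
Proof. exact: big_cat. Qed.

Lemma common m l (c : 'cV[B]_m) (d : 'cV[B]_l) :
  map_mx f (row_mx 1%:M 0) *m col_mx c d = c /\ map_mx f (row_mx 0 1%:M) *m col_mx c d = d.
Proof.
by rewrite !map_row_mx !map_mx1 !map_mx0 !mul_row_col !mul1mx !mul0mx addr0 add0r.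
Qed.

Lemma teq_cat s s' t t' : teq s s' -> teq t t' -> teq (s ++ t) (s' ++ t').
Proof.
move=> [m [c [w [w' [<- <- hw]]]]] [l [d [v [v' [<- <- hv]]]]].
have [ec ed] := common c d.
exists (m + l)%N, (col_mx c d), (chg (row_mx 1%:M 0) w ++ chg (row_mx 0 1%:M) v),
  (chg (row_mx 1%:M 0) w' ++ chg (row_mx 0 1%:M) v').
rewrite !dec_cat !dec_chg ec ed; split=> // j; rewrite !tot_cat !tot_chg.
by under eq_bigr => k _ do rewrite hw; congr (_ + _); apply: eq_bigr => k _; rewrite hv.
Qed.

Lemma dec1 (m : N) (b : B) (a : A) :
  dec (b%:M : 'cV_1) [:: (m, a%:M)] = [:: (m, f a * b)].
Proof. by rewrite /dec /= map_scalar_mx -scalar_mxM mxE eqxx mulr1n. Qed.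

Lemma teq_refl s : teq s s.
Proof.
elim: s => [|[n b] s IH]; first by exists 0%N, 0, [::], [::].
rewrite -cat1s; apply: teq_cat => //.
exists 1%N, b%:M, [:: (n, 1%:M)], [:: (n, 1%:M)].
by rewrite dec1 rmorph1 mul1r.
Qed.

Lemma teq_catC s t : teq (s ++ t) (t ++ s).
Proof.
have [m [c [w [_ [<- _ _]]]]] := teq_refl s; have [l [d [v [_ [<- _ _]]]]] := teq_refl t.
have [ec ed] := common c d.
exists (m + l)%N, (col_mx c d), (chg (row_mx 1%:M 0) w ++ chg (row_mx 0 1%:M) v),
  (chg (row_mx 0 1%:M) v ++ chg (row_mx 1%:M 0) w).
by rewrite !dec_cat !dec_chg ec ed; split=> // j; rewrite !tot_cat addrC.
Qed.

(** The middle tensor is expanded in two families [c] and [d]; equating its second components gives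
    relations between them. The criterion for several rows writes both families through one family
    [b], over which the two expansions of the middle tensor coincide. *)
Lemma teq_trans s t u : eqflat f -> teq s t -> teq t u -> teq s u.
Proof.
move=> ef [m [c [w [w' [<- <- hw]]]]] [l [d [v [v' [e <- hv]]]]].
have sz : size v = size w' by have := congr1 size e; rewrite !size_map.
pose W i := (nth (0, 0) w' i).2; pose V i := (nth (0, 0) v i).2.
pose a : 'M[A]_(size w', m + l) := \matrix_i row_mx (W i) (- V i).
have [|p [G [b [Gb aG]]]] := eqflat_rows ef (a := a) (b := col_mx c d).
  apply/row_matrixP => i; rewrite row_mul row0 -map_row rowK map_row_mx mul_row_col map_mxN mulNmx.
  apply/eqP; rewrite subr_eq0; apply/eqP/matrixP => x y; rewrite (ord1 x) (ord1 y).
  have := congr1 (fun r => (nth (0, 0) r i).2) e; rewrite !(nth_map (0, 0)) ?sz //=.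
have Gc : map_mx f (usubmx G) *m b = c.
  by have := congr1 usubmx Gb; rewrite col_mxKu -{1}[G]vsubmxK map_col_mx mul_col_mx col_mxKu.
have Gd : map_mx f (dsubmx G) *m b = d.
  by have := congr1 dsubmx Gb; rewrite col_mxKd -{1}[G]vsubmxK map_col_mx mul_col_mx col_mxKd.
exists p, b, (chg (usubmx G) w), (chg (dsubmx G) v'); rewrite !dec_chg Gc Gd; split=> // j.
have -> : tot (chg (usubmx G) w) j = tot (chg (usubmx G) w') j.
  by rewrite !tot_chg; apply: eq_bigr => k _; rewrite hw.
have -> : tot (chg (dsubmx G) v') j = tot (chg (dsubmx G) v) j.
  by rewrite !tot_chg; apply: eq_bigr => k _; rewrite hv.
congr (tot _ j); apply: (@eq_from_nth _ (0, 0)); first by rewrite !size_map.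
rewrite size_map => i iw; rewrite !(nth_map (0, 0)) ?sz //; congr (_, _).
  have := congr1 (fun r => (nth (0, 0) r i).1) e; by rewrite !(nth_map (0, 0)) ?sz //= => ->.
have := congr1 (row (Ordinal iw)) aG; rewrite row_mul row0 rowK -{1}[G]vsubmxK mul_row_col mulNmx.
by move/eqP; rewrite subr_eq0 => /eqP.
Qed.

Lemma tens_eq_teq s t : eqflat f -> tens_eq f s t -> teq s t.
Proof.
move=> ef; elim=> {s t}.
- exact: teq_refl.
- move=> s t _ [m [c [w [w' [ew ew' h]]]]]; exists m, c, w', w; split=> // j; exact/esym/h.
- by move=> s t u _ h _; exact: teq_trans.
- by move=> s s' t t' _ h _; exact: teq_cat.
- exact: teq_catC.
- move=> b; exists 1%N, b%:M, [:: (0, 1%:M)], [::]; rewrite dec1 rmorph1 mul1r; split=> // j.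
  by rewrite /tot big_seq1 big_nil scaler0.
- move=> m m' b; exists 1%N, b%:M, [:: (m + m', 1%:M)], ([:: (m, 1%:M)] ++ [:: (m', 1%:M)]).
  rewrite dec_cat !dec1 rmorph1 mul1r; split=> // j.
  by rewrite /tot big_cat !big_seq1 scalerDr.
- move=> m b b'; have [e1 e2] := common (b%:M : 'cV_1) (b'%:M : 'cV_1).
  exists (1 + 1)%N, (col_mx b%:M b'%:M), (chg (row_mx 1%:M 0 + row_mx 0 1%:M) [:: (m, 1%:M)]),
    (chg (row_mx 1%:M 0) [:: (m, 1%:M)] ++ chg (row_mx 0 1%:M) [:: (m, 1%:M)]).
  rewrite dec_cat !dec_chg map_mxD mulmxDl e1 e2 -raddfD !dec1 rmorph1 !mul1r; split=> // j.
  rewrite tot_cat !tot_chg -big_split; apply: eq_bigr => k _.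
  by rewrite mxE scalerDl.
- move=> a m b; exists 1%N, b%:M, [:: (a *: m, 1%:M)], [:: (m, a%:M)].
  rewrite !dec1 rmorph1 mul1r; split=> // j.
  by rewrite /tot !big_seq1 (ord1 j) !mxE !eqxx !mulr1n scale1r.
Qed.

Lemma dec_tens m (c : 'cV[B]_m) (w : seq (N * 'rV[A]_m)) :
  tens_eq f (dec c w) [seq (tot w j, c j 0) | j <- enum 'I_m].
Proof.
have fl (Y : Type) (r : seq Y) (F : Y -> N * B) : flatten [seq [:: F y] | y <- r] = [seq F y | y <- r].
  by elim: r => //= y r ->.
elim: w => [|[n a] w IH].
  apply: tens_sym; rewrite -fl; elim: (enum _) => [|j r IH]; first exact: tens_refl.
  apply: (tens_cat (s := [:: _]) (s' := [::])) IH; rewrite /tot big_nil; exact: tens_0l.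
rewrite /dec map_cons -cat1s; apply: tens_trans (tens_catKl _ IH) _.
apply: (@tens_trans _ _ _ _ _ ([seq (a 0 j *: n, c j 0) | j <- enum 'I_m] ++ [seq (tot w j, c j 0) | j <- enum 'I_m])).
  apply: tens_catK; rewrite mxE -big_enum; apply: tens_trans (tens_sum_r _ _ _ _) _.
  rewrite -!fl; elim: (enum _) => [|j r IH']; first exact: tens_refl.
  apply: (tens_cat (s := [:: _]) (s' := [:: _])) IH'; rewrite mxE.
  exact/tens_sym/tens_Z.
rewrite -!fl; apply/tens_sym/tens_map => j.
by rewrite /tot big_cons; exact: tens_Dl.
Qed.

Lemma teq_tens_eq s t : teq s t -> tens_eq f s t.
Proof.
move=> [m [c [w [w' [<- <- h]]]]]; apply: tens_trans (dec_tens _ _) _.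
by under eq_map => j do rewrite h; exact/tens_sym/dec_tens.
Qed.

End Module.

(** An expansion of the images under [g] is the image of an expansion in [M], and injectivity
    carries the equality of coefficients back to [M]. *)
Lemma eqflat_flat : eqflat f -> flat f.
Proof.
move=> ef M N g ginj s t /(tens_eq_teq ef) [m [c [w [w' [ew ew' h]]]]].
have pull r v : dec c v = [seq (g x.1, x.2) | x <- r] ->
    exists v' : seq (M * 'rV_m), v = [seq (g x.1, x.2) | x <- v'] /\ dec c v' = r.
  elim: v r => [|[n a] v IH] [|[n' b] r] //=; first by exists [::].
  move=> [-> <- /IH[v' [-> <-]]]; by exists ((n', a) :: v').
have [v [ev <-]] := pull _ _ ew; have [v' [ev' <-]] := pull _ _ ew'.
apply: teq_tens_eq; exists m, c, v, v'; split=> // j; apply: ginj.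
have gt r : g (tot r j) = tot [seq (g x.1, x.2) | x <- r] j.
  by rewrite /tot big_map linear_sum; apply: eq_bigr => x _; rewrite linearZ.
by rewrite !gt -ev -ev' h.
Qed.

End Teq.

(** * Flatness under base change and retracts *)

Section BaseChange.
Variables (A0 B0 A : comPzRingType) (e : {rmorphism A0 -> B0}) (al : {rmorphism A0 -> A}).
Let l : {rmorphism A -> tens al e} := tinl al e.
Let r : {rmorphism B0 -> tens al e} := tinr al e.

Lemma tens_span m (b : 'cV[tens al e]_m) :
  exists p (H : 'M[A]_(m, p)) (c : 'cV[B0]_p), b = map_mx l H *m map_mx r c.
Proof.
elim: m b => [|m IH] b; first by exists 0%N, 0, 0; apply/matrixP => -[].
suff : exists p (H : 'M[A]_(1 + m, p)) (c : 'cV[B0]_p),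
  (b : 'cV_(1 + m)) = map_mx l H *m map_mx r c by [].
move: b; rewrite -[m.+1]/(1 + m)%N => b.
have [p [H [c bE]]] := IH (dsubmx b).
have [s sE] := tens_elt (b 0 0).
pose H0 : 'rV[A]_(size s) := \row_k (nth (0 : amod al, 0) s k).1.
pose c0 : 'cV[B0]_(size s) := \col_k (nth (0 : amod al, 0) s k).2.
exists (size s + p)%N, (block_mx H0 0 0 H), (col_mx c0 c).
rewrite map_block_mx !map_mx0 map_col_mx -[LHS]vsubmxK bE.
rewrite block_mxEv mul_col_mx !mul_row_col !mul0mx addr0 add0r; congr col_mx.
apply/matrixP => i j; rewrite (ord1 i) (ord1 j) !mxE.
rewrite (_ : lshift m 0 = 0); last exact: val_inj.
rewrite sE (big_nth (0 : amod al, 0)) big_mkord; apply: eq_bigr => k _.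
by rewrite !mxE.
Qed.

(** Written in pure tensors, the relation says that $sum h_k (x) c_k$ vanishes with $h = a H$.
    Comparison with the empty sum by [teq] expands [c] in a family [d] with coefficients over [A0]
    that annihilate [h]. *)
Lemma eqflat_base_change : eqflat e -> eqflat l.
Proof.
move=> ef m a b; have [p [H [c ->]]] := tens_span b.
rewrite mulmxA -map_mxM; set h := a *m H => hc.
have : tens_eq e [seq ((h 0 k : amod al), c k 0) | k <- enum 'I_p] [::].
  apply: tens_sum_eq; rewrite big_nil big_map big_enum /=.
  have := congr1 (fun M : 'M_1 => M 0 0) hc; rewrite !mxE => E; rewrite -[RHS]E.
  by apply: eq_bigr => k _; rewrite !mxE.
move/(tens_eq_teq ef) => [q [d [w [w' [ew /eqP ew' hw]]]]].
have {ew'} w0 : w' = [::] by case: (w') ew'.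
subst w'.
have sw : size w = p by have := congr1 size ew; rewrite size_map [RHS]size_map size_enum_ord.
pose Gm : 'M[A0]_(p, q) := \matrix_k (nth (0, 0) w k).2.
have ewk (k : 'I_p) : (nth (0, 0) w k).1 = h 0 k /\ (map_mx e (nth (0, 0) w k).2 *m d) 0 0 = c k 0.
  have := congr1 (fun z => nth (0, 0) z k) ew.
  rewrite (nth_map (0, 0)) ?sw // (nth_map k) ?size_enum_ord // nth_ord_enum.
  by move=> [-> ->].
have cE : c = map_mx e Gm *m d.
  apply/matrixP => k z; rewrite (ord1 z) -(ewk k).2 !mxE.
  by apply: eq_bigr => j _; rewrite !mxE.
exists q, (H *m map_mx al Gm), (map_mx r d); split.
  rewrite cE !map_mxM -!mulmxA; congr (_ *m (_ *m _)).
  by apply/matrixP => k j; rewrite !mxE; exact/esym/tens_comm.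
rewrite mulmxA -/h; apply/matrixP => z j; rewrite (ord1 z) [LHS]mxE [RHS]mxE.
have := hw j; rewrite /tot big_nil (big_nth (0, 0)) sw big_mkord => E; rewrite -[RHS]E.
by apply: eq_bigr => k _; rewrite [map_mx al _ _ _]mxE [Gm _ _]mxE (ewk k).1; exact: mulrC.
Qed.

End BaseChange.

(** The relation is pushed to [T], solved there, and the solution is brought back by the
    retraction. *)
Lemma eqflat_retract (A B T : comPzRingType) (f : {rmorphism A -> B}) (i : {rmorphism A -> T})
    (s : {rmorphism B -> T}) (r : {rmorphism T -> B}) :
  s \o f =1 i -> r \o i =1 f -> r \o s =1 id -> eqflat i -> eqflat f.
Proof.
move=> sf ri rs ei m a b ab.
have [|p [G [c [bE aG]]]] := ei m a (map_mx s b).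
  have := congr1 (map_mx s) ab; rewrite map_mxM map_mx0 -map_mx_comp => <-.
  by congr (_ *m _); apply/matrixP => i' j; rewrite !mxE; exact/esym/sf.
exists p, G, (map_mx r c); split=> //.
have := congr1 (map_mx r) bE; rewrite map_mxM -!map_mx_comp.
rewrite (_ : map_mx (r \o s) b = b); last by apply/matrixP => i' j; rewrite mxE; exact: rs.
by move=> ->; congr (_ *m _); apply/matrixP => i' j; rewrite !mxE; exact: ri.
Qed.

(** * Descent to algebras of finite type over the integers *)

Lemma pmap_comp (A A' A'' : Type) n m l (g : A -> A') (g' : A' -> A'') (s : 'I_n -> 'I_m)
    (s' : 'I_m -> 'I_l) t : pmap g' s' (pmap g s t) = pmap (g' \o g) (s' \o s) t.
Proof. by elim: t => //= t -> u ->. Qed.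

Lemma eq_pmap (A A' : Type) n m (g h : A -> A') (s s' : 'I_n -> 'I_m) t :
  g =1 h -> s =1 s' -> pmap g s t = pmap h s' t.
Proof.
by move=> gh ss; elim: t => /= [a|i|t -> u ->|t -> u ->] //; rewrite ?gh ?ss.
Qed.

(** An expression has finitely many constants; replaced by indices, they can later be read as
    variables. *)
Lemma pmap_const (A : Type) n (t : pexp A n) :
  exists N (c : 'I_N -> A) (t' : pexp 'I_N n), t = pmap c id t'.
Proof.
elim: t => [a|i|t [N [c [t' ->]]] u [N' [c' [u' ->]]]|t [N [c [t' ->]]] u [N' [c' [u' ->]]]].
- by exists 1%N, (fun=> a), (PConst ord0).
- by exists 0%N, (fun j : 'I_0 => match notF (ltn_ord j) with end), (PVar i).
all: exists (N + N')%N, (fun k => match split k with inl i => c i | inr i => c' i end).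
1: exists (PAdd (pmap (lshift N') id t') (pmap (@rshift N N') id u')).
2: exists (PMul (pmap (lshift N') id t') (pmap (@rshift N N') id u')).
1: rewrite /= !pmap_comp; congr PAdd; apply: eq_pmap => // k /=.
3: rewrite /= !pmap_comp; congr PMul; apply: eq_pmap => // k /=.
- by rewrite (unsplitK (inl k : 'I_N + 'I_N')%type).
- by rewrite (unsplitK (inr k : 'I_N + 'I_N')%type).
- by rewrite (unsplitK (inl k : 'I_N + 'I_N')%type).
- by rewrite (unsplitK (inr k : 'I_N + 'I_N')%type).
Qed.

Lemma pmap_const_fam (A : Type) n (J : finType) (g : J -> pexp A n) :
  exists N (c : 'I_N -> A) (g' : J -> pexp 'I_N n), forall j, g j = pmap c id (g' j).
Proof.
suff [N [c h]] : exists N (c : 'I_N -> A), forall j, j \in enum J -> exists t, g j = pmap c id t.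
  have [g' g'E] := choice_fun (fun j => h j (mem_enum J j)).
  by exists N, c, g'.
elim: (enum J) => [|j r [N [c IH]]].
  by exists 0%N, (fun j : 'I_0 => match notF (ltn_ord j) with end).
have [N' [c' [t' tE]]] := pmap_const (g j).
exists (N' + N)%N, (fun k => match split k with inl i => c' i | inr i => c i end) => i.
rewrite inE => /predU1P[->|/IH[t ->]].
  exists (pmap (lshift N) id t'); rewrite tE pmap_comp; apply: eq_pmap => // k /=.
  by rewrite (unsplitK (inl k : 'I_N' + 'I_N)%type).
exists (pmap (@rshift N' N) id t); rewrite pmap_comp; apply: eq_pmap => // k /=.
by rewrite (unsplitK (inr k : 'I_N' + 'I_N)%type).
Qed.

Lemma eq_peval_fun (A B : comPzRingType) (f f' : {rmorphism A -> B}) n (x : 'I_n -> B) t :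
  f =1 f' -> peval f x t = peval f' x t.
Proof. by move=> h; elim: t => //= t -> u ->. Qed.

Lemma presented_fun (A B : comPzRingType) (f f' : {rmorphism A -> B}) n rs (x : 'I_n -> B) :
  f =1 f' -> presented f rs x -> presented f' rs x.
Proof.
move=> h [gen ke]; split=> [b|t u]; last by rewrite -!(eq_peval_fun _ _ h).
by have [t <-] := gen b; exists t; rewrite (eq_peval_fun _ _ h).
Qed.

(** The generators are those of both steps. The coefficients in [B] of the second set of relations
    are replaced by chosen expressions in the first generators, by [lft]. *)
Lemma presented_comp (A B C : comPzRingType) (f : {rmorphism A -> B}) (g : {rmorphism B -> C})
    n rs (x : 'I_n -> B) m ss (y : 'I_m -> C) :
  presented f rs x -> presented g ss y -> finitely_presented (g \o f).
Proof.
move=> pf pg; have [lf lfE] := choice_fun pf.1.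
pose fix lft (t : pexp B m) : pexp A (n + m) := match t with
  | PConst b => pmap id (lshift m) (lf b)
  | PVar j => PVar (rshift n j)
  | PAdd t u => PAdd (lft t) (lft u)
  | PMul t u => PMul (lft t) (lft u) end.
pose z i := match split i with inl i => g (x i) | inr j => y j end.
have zl i : z (lshift m i) = g (x i) by rewrite /z (unsplitK (inl i : 'I_n + 'I_m)%type).
have zr i : z (rshift n i) = y i by rewrite /z (unsplitK (inr i : 'I_n + 'I_m)%type).
pose ts := ([seq pmap id (lshift m) r | r <- rs] ++ [seq lft s | s <- ss])%SEQ.
have lftE (D : comPzRingType) (h : {rmorphism A -> D}) (k : {rmorphism B -> D}) w w' t :
    k \o f =1 h -> (forall i, k (x i) = w (lshift m i)) -> (forall j, w' j = w (rshift n j)) ->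
    peval h w (lft t) = peval k w' t.
  move=> kf kx e; elim: t => /= [b|j|t -> u ->|t -> u ->] //.
  rewrite -{2}(lfE b) (peval_morph _ kf (fun i => erefl)).
  exact: (peval_pmap (g := idfun)).
exists (n + m)%N, ts, z.
have gen c : exists t, peval (g \o f) z t = c.
  have [t <-] := pg.1 c; exists (lft t).
  by apply: lftE => // i; rewrite ?zl ?zr.
have kz : kills (g \o f) z ts.
  move=> t /List.in_app_iff[] /List.in_map_iff[r [<- hr]].
    rewrite (peval_pmap (g := idfun) (f := g \o f) (x := g \o x)) //.
    rewrite -(peval_morph (f := f) (h := g) (x := x)) // (presented_kills pf hr).
    exact: rmorph0.
  rewrite (lftE _ _ g _ y) //.
  exact: presented_kills pg _ hr.
have pts := pa_presented ts; pose Z := pa_var ts.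
have kts := presented_kills pts.
have [k [kf kx]] : exists k : {rmorphism B -> pa ts}, k \o f =1 pa_in ts /\
    forall i, k (x i) = Z (lshift m i).
  apply: (presented_ext pf) => t ht.
  rewrite -(peval_pmap (g := idfun) (s := lshift m) (f' := pa_in ts) (y := Z)) //.
  by apply: kts; apply/List.in_app_iff; left; exact: List.in_map.
have [h [hg hy]] : exists h : {rmorphism C -> pa ts}, h \o g =1 k /\ forall j, h (y j) = Z (rshift n j).
  apply: (presented_ext pg) => t ht; rewrite -(lftE _ (pa_in ts) k Z) //.
  by apply: kts; apply/List.in_app_iff; right; exact: List.in_map.
apply: (presented_intro (h := h)) => // [a|i].
  exact: etrans (hg (f a)) (kf a).
rewrite /z -{2}(splitK i); case: (split i) => j /=; last exact: hy.
exact: etrans (hg (x j)) (kx j).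
Qed.

(** The final clauses, existence and uniqueness, say that [B] is the base change of [B0] along [al],
    as a pushout property. *)
Lemma jac_etale_descent (A B : comPzRingType) (f : {rmorphism A -> B}) : jac_etale f ->
  exists (A0 B0 : comPzRingType) (e : {rmorphism A0 -> B0}) (al : {rmorphism A0 -> A})
    (be : {rmorphism B0 -> B}),
  [/\ noeth A0, jac_etale e, finitely_presented_ring A0 /\ finitely_presented_ring B0,
      be \o e =1 f \o al &
      (forall (C : comPzRingType) (u : {rmorphism A -> C}) (v : {rmorphism B0 -> C}),
        v \o e =1 u \o al ->
        exists h : {rmorphism B -> C}, h \o f =1 u /\ h \o be =1 v) /\
      (forall (C : comPzRingType) (h h' : {rmorphism B -> C}),
        h \o f =1 h' \o f -> h \o be =1 h' \o be -> h =1 h')].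
Proof.
move=> [n [g [x [pres [d hd]]]]].
have [N [c [g' g'E]]] := pmap_const_fam g.
pose A0 : comPzRingType := pa (A := int) (n := N) [::].
pose i0 := pa_in (A := int) (n := N) [::].
have [al [_ alX]] := pa0_ext ((intmul 1 : int -> A) : {rmorphism int -> A}) c.
pose g0 i : pexp A0 n := pmap (pa_var [::]) id (g' i).
have g0E i : pmap al id (g0 i) = g i.
  by rewrite g'E pmap_comp; apply: eq_pmap.
have [h hE] := det_pexp g0.
pose B0 := pa (rels (ext g0 h)); pose e := pa_in (rels (ext g0 h)).
have je : jac_etale e by exact: jac_etale_ext.
have presB0 := pa_presented (rels (ext g0 h)); pose X := pa_var (rels (ext g0 h)).
have [kX Yh] := (kills_ext _ _ _ _).1 (presented_kills presB0).
have gal (C : comPzRingType) (u : {rmorphism A -> C}) y i :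
    peval (u \o al) y (g0 i) = peval u y (g i).
  by rewrite -g0E; apply/esym/peval_pmap.
have xl z : extp x z \o lshift 1 =1 x by move=> i /=; rewrite extp_l.
have gx := (killsP _ _ _).1 (presented_kills pres).
have detg : peval (f \o al) x h = \det (jac f x g).
  rewrite hE; congr (\det _); apply/matrixP => i j; rewrite !mxE -g0E.
  by rewrite (pderiv_pmap al) //; apply/esym/peval_pmap.
(* The variable inverse to the generic Jacobian determinant goes to the given inverse [d]. *)
have [be [bee beX]] : exists be : {rmorphism B0 -> B}, be \o e =1 f \o al /\
    forall i, be (X i) = extp x d i.
  apply: (presented_ext presB0); apply/kills_ext; split.
    by apply/killsP => i; rewrite (eq_peval _ _ (xl _)) gal.
  by rewrite (eq_peval _ _ (xl _)) extp_r detg.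
have fpA0 : finitely_presented_ring A0.
  exists N, [::], (pa_var [::]); apply: presented_fun (pa_presented _) => z.
  by rewrite -[in LHS](intz z) rmorph_int.
exists A0, B0, e, al, be; split=> //.
- exact: noeth_fg noeth_int (pa_presented (A := int) [::]).1.
- split=> //; have [k [rs [y prA0]]] := fpA0.
  have [k' [rs' [y' prB0]]] := presented_comp prA0 presB0.
  exists k', rs', y'; apply: presented_fun prB0 => z.
  by rewrite /= -/e rmorph_int.
- split=> [C u v uv|C k k' kf kbe].
    have vX : forall j, v (X (lshift 1 j)) = (v \o X \o lshift 1) j by [].
    have [k [kf kx]] : exists k : {rmorphism B -> C}, k \o f =1 u /\
        forall j, k (x j) = v (X (lshift 1 j)).
      apply: (presented_ext pres); apply/killsP => j; rewrite -gal.
      rewrite -(peval_morph (f := e) (h := v) (x := X \o lshift 1)) //.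
      by rewrite ((killsP _ _ _).1 kX) rmorph0.
    exists k; split=> //.
    have kbe : forall a, (k \o be) (e a) = v (e a).
      move=> a; rewrite /= (bee a : be (e a) = _) /= (kf (al a) : k (f _) = _).
      exact/esym/uv.
    apply: (gen_eq (h := k \o be) presB0.1) => // j.
    elim/ord_ext: j => [j|] /=; first by rewrite beX extp_l kx.
    have kh : k (be (peval e (X \o lshift 1) h)) = v (peval e (X \o lshift 1) h).
      rewrite (peval_morph (f := e) (h := v) (g := v \o e) (y := v \o X \o lshift 1)) //.
      rewrite -[k (be _)]/((k \o be) _).
      apply: peval_morph => [a|j]; first exact: kbe.
      by rewrite /= beX extp_l kx.
    (* On the last generator the two maps agree by uniqueness of inverses. *)
    have E1 := congr1 v Yh; have E2 := congr1 (k \o be) Yh.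
    rewrite rmorphM rmorph1 in E1; rewrite [LHS]rmorphM [RHS]rmorph1 /= kh in E2.
    by rewrite -[LHS]mulr1 -E1 mulrCA E2 mulr1.
  apply: (gen_eq pres.1) => // j.
  by have := kbe (X (lshift 1 j)); rewrite /= beX extp_l.
Qed.

(** The pushout properties give maps both ways between [B] and the base change of [B0]; by
    uniqueness their composite on [B] is the identity. *)
Lemma jac_etale_eqflat (A B : comPzRingType) (f : {rmorphism A -> B}) :
  jac_etale f -> eqflat f.
Proof.
move=> /jac_etale_descent [A0 [B0 [e [al [be [nA0 je _ bee [ext uniq]]]]]]].
have ee := jac_etale_eqflat_noeth nA0 je.
have [s [sf sb]] := ext _ (tinl al e) (tinr al e) (fun a => esym (tens_comm al e a)).
have [r [rl rr]] := tens_ext (g := f) (h := be) (fun a => esym (bee a)).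
apply: (eqflat_retract sf rl _ (eqflat_base_change ee)).
apply: (uniq _ (r \o s) idfun) => a /=.
  by rewrite (sf a : s (f a) = _); exact: rl.
by rewrite (sb a : s (be a) = _); exact: rr.
Qed.

Lemma jac_etale_fp_etale (A B : comPzRingType) (f : {rmorphism A -> B}) :
  jac_etale f -> fp_etale f.
Proof.
move=> jf; split; [exact/eqflat_flat/jac_etale_eqflat|exact: jac_etale_unramified|].
by case: jf => n [g [x [pres _]]]; exists n, (rels g), x.
Qed.

(** A lifting problem is restricted to [e], which belongs to $Et^f_*$, and its solution is extended
    by the pushout property. *)
Lemma jac_etale_indEt (A B : comPzRingType) (f : {rmorphism A -> B}) :
  jac_etale f -> indEt f.
Proof.
move=> /jac_etale_descent [A0 [B0 [e [al [be [_ je [fA fB] bee [ext uniq]]]]]]].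
have es : fp_etale_star e by split=> //; exact: jac_etale_fp_etale.
move=> C D g Hg u v uv.
have sq : g \o (u \o al) =1 (v \o be) \o e.
  by move=> a /=; rewrite (uv (al a) : g (u _) = _) /= (bee a : be (e a) = _).
have [h0 [h0e gh0 h0u]] := Hg _ _ _ es (u \o al) (v \o be) sq.
have [h [hf hb]] := ext _ u h0 h0e.
exists h; split=> //.
  apply: (uniq _ (g \o h) v) => a /=.
    by rewrite (hf a : h (f a) = _); exact: uv.
  by rewrite (hb a : h (be a) = _); exact: gh0.
move=> h' h'f gh'; apply: (uniq _ h' h) => a.
  exact: etrans (h'f a) (esym (hf a)).
rewrite (hb a); apply: (h0u (h' \o be)) => b /=.
  by rewrite (bee b : be (e b) = _); exact: h'f.
exact: gh'.
Qed.

Lemma fp_etale_indEt (A B : comPzRingType) (f : {rmorphism A -> B}) :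
  fp_etale f <-> finitely_presented f /\ indEt f.
Proof.
split=> [ef|[fp ind]].
  by case: (ef) => _ _ ?; split=> //; apply/jac_etale_indEt/fp_etale_jac.
apply/jac_etale_fp_etale/formally_etale_jac => // C D q sq; apply: ind.
(* This is the membership of square-zero extensions in [Hens]. *)
move=> R S e [_ _ /fp_etale_jac je]; exact: jac_etale_lift.
Qed.

(** * Existentially closed rings *)

(* HW rs i stands for the i-th coordinate of a chosen zero of rs. *)
Inductive hterm (R : Type) : Type :=
  | HC of R
  | HAdd of hterm R & hterm R
  | HMul of hterm R & hterm R
  | HW n of seq (pexp (hterm R) n) & 'I_n.

Fixpoint hsub (R : Type) n (w : 'I_n -> hterm R) (r : pexp (hterm R) n) : hterm R :=
  match r with
  | PConst t => t
  | PVar i => w i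
  | PAdd r s => HAdd (hsub w r) (hsub w s)
  | PMul r s => HMul (hsub w r) (hsub w s)
  end.

Section Henkin.
Variable R : comPzRingType.
Local Notation T := (hterm R).

(* Equality in a non-zero quotient of the ring of the terms that are defined
   (those with E t t); a witness is defined only if it is one.  The quotient by
   a maximal such E is existentially closed: otherwise the undefined witnesses
   of some rs could be interpreted in K[X_1, ..., X_n] / (rs). *)
Record good (E : T -> T -> Prop) : Prop := Good {
  g_sym : forall t u, E t u -> E u t;
  g_trans : forall t u v, E t u -> E u v -> E t v;
  g_const : forall a, E (HC a) (HC a);
  g_constD : forall a b, E (HC (a + b)) (HAdd (HC a) (HC b));
  g_constM : forall a b, E (HC (a * b)) (HMul (HC a) (HC b));
  g_add : forall t t' u u', E t t' -> E u u' -> E (HAdd t u) (HAdd t' u');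
  g_mul : forall t t' u u', E t t' -> E u u' -> E (HMul t u) (HMul t' u');
  g_addA : forall t u v, E t t -> E u u -> E v v ->
    E (HAdd t (HAdd u v)) (HAdd (HAdd t u) v);
  g_addC : forall t u, E t t -> E u u -> E (HAdd t u) (HAdd u t);
  g_add0 : forall t, E t t -> E (HAdd (HC 0) t) t;
  g_addN : forall t, E t t -> E (HAdd (HMul (HC (-1)) t) t) (HC 0);
  g_mulA : forall t u v, E t t -> E u u -> E v v ->
    E (HMul t (HMul u v)) (HMul (HMul t u) v);
  g_mulC : forall t u, E t t -> E u u -> E (HMul t u) (HMul u t);
  g_mul1 : forall t, E t t -> E (HMul (HC 1) t) t;
  g_mulD : forall t u v, E t t -> E u u -> E v v ->
    E (HMul (HAdd t u) v) (HAdd (HMul t v) (HMul u v));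
  g_nz : ~ E (HC 1) (HC 0);
  g_subD : forall t u, E (HAdd t u) (HAdd t u) -> E t t /\ E u u;
  g_subM : forall t u, E (HMul t u) (HMul t u) -> E t t /\ E u u;
  g_wit : forall n (rs : seq (pexp T n)) i, E (HW rs i) (HW rs i) ->
    (forall j, E (HW rs j) (HW rs j)) /\
    forall r, List.In r rs -> E (hsub (HW rs) r) (HC 0) }.

(** A partial evaluation [V] in a non-zero ring transfers the ring laws to its terms. It yields both
    the initial relation and the enlargement that contradicts maximality. *)
Lemma good_eval (C : comPzRingType) (k : {rmorphism R -> C}) (V : T -> C -> Prop) :
  (forall t a b, V t a -> V t b -> a = b) ->
  (forall a, V (HC a) (k a)) ->
  (forall t u a b, V t a -> V u b -> V (HAdd t u) (a + b)) ->
  (forall t u a b, V t a -> V u b -> V (HMul t u) (a * b)) ->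
  (1 : C) <> 0 ->
  (forall t u c, V (HAdd t u) c -> exists a b, V t a /\ V u b) ->
  (forall t u c, V (HMul t u) c -> exists a b, V t a /\ V u b) ->
  (forall n (rs : seq (pexp T n)) i c, V (HW rs i) c ->
    (forall j, exists d, V (HW rs j) d) /\
    forall r, List.In r rs -> V (hsub (HW rs) r) 0) ->
  good (fun t u => exists2 a, V t a & V u a).
Proof.
move=> fn VC VD VM nz sD sM W.
have V0 : V (HC 0) 0 by rewrite -(rmorph0 k).
have V1 : V (HC 1) 1 by rewrite -(rmorph1 k).
have VN t a : V t a -> V (HMul (HC (-1)) t) (- a).
  by move=> ta; have := VM _ _ _ _ (VC (-1)) ta; rewrite rmorphN1 mulN1r.
split.
- by move=> t u [a ? ?]; exists a.
- by move=> t u v [a ta ua] [b ub vb]; exists a => //; rewrite (fn _ _ _ ua ub).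
- by move=> a; exists (k a).
- by move=> a b; exists (k (a + b)) => //; rewrite rmorphD; exact: VD.
- by move=> a b; exists (k (a * b)) => //; rewrite rmorphM; exact: VM.
- by move=> t t' u u' [a ? ?] [b ? ?]; exists (a + b); exact: VD.
- by move=> t t' u u' [a ? ?] [b ? ?]; exists (a * b); exact: VM.
- move=> t u v [a ta _] [b ub _] [c vc _]; exists (a + (b + c)).
    exact/VD/VD.
  by rewrite addrA; apply: (VD) => //; exact: VD.
- move=> t u [a ta _] [b ub _]; exists (a + b); first exact: VD.
  by rewrite addrC; exact: VD.
- by move=> t [a ta _]; exists a => //; rewrite -[a]add0r; exact: VD.
- by move=> t [a ta _]; exists 0 => //; rewrite -(addNr a); exact/VD/ta/VN.
- move=> t u v [a ta _] [b ub _] [c vc _]; exists (a * (b * c)).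
    exact/VM/VM.
  by rewrite mulrA; apply: (VM) => //; exact: VM.
- move=> t u [a ta _] [b ub _]; exists (a * b); first exact: VM.
  by rewrite mulrC; exact: VM.
- by move=> t [a ta _]; exists a => //; rewrite -[a]mul1r; exact: VM.
- move=> t u v [a ta _] [b ub _] [c vc _]; exists ((a + b) * c).
    exact/VM/vc/VD.
  by rewrite mulrDl; apply: (VD); exact: VM.
- by move=> [a ta ua]; apply: nz; rewrite (fn _ _ _ V1 ta) (fn _ _ _ V0 ua).
- by move=> t u [c /sD[a [b [ta ub]]] _]; split; [exists a|exists b].
- by move=> t u [c /sM[a [b [ta ub]]] _]; split; [exists a|exists b].
- move=> n rs i [c /W[hW hr] _]; split=> [j|r rrs].
    by have [d hd] := hW j; exists d.
  by exists 0 => //; exact: hr.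
Qed.

Fixpoint heval (t : T) : option R :=
  match t with
  | HC a => Some a
  | HAdd t u => if heval t is Some a then if heval u is Some b then Some (a + b) else None else None
  | HMul t u => if heval t is Some a then if heval u is Some b then Some (a * b) else None else None
  | HW _ _ _ => None
  end.

Lemma good_init : (1 : R) <> 0 -> exists E, good E.
Proof.
move=> nz; exists (fun t u => exists2 a, heval t = Some a & heval u = Some a).
apply: (good_eval (k := idfun) (V := fun t a => heval t = Some a)) => //.
- by move=> t a b -> [].
- by move=> t u a b /= -> ->.
- by move=> t u a b /= -> ->.
- by move=> t u c /=; case: heval => // a; case: heval => // b _; exists a, b.
- by move=> t u c /=; case: heval => // a; case: heval => // b _; exists a, b.
Qed.

Lemma good_max : (1 : R) <> 0 ->
  exists2 E, good E & forall E', good E' -> (forall t u, E t u -> E' t u) -> forall t u, E' t u -> E t u.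
Proof.
move=> nz.
pose rl (X : set (T * T)) t u := X (t, u).
pose P (X : set (T * T)) := X = set0 \/ good (rl X).
have [F FP Ft|X [PX Xmax]] := @Zorn_bigcup _ P.
  have [[X0 FX0 gX0]|no] := pselect (exists2 X, F X & good (rl X)); last first.
    left; apply/seteqP; split=> // x [X FX Xx].
    have [X0|gX] := FP _ FX; first by move: Xx; rewrite X0.
    by case: no; exists X.
  right.
  have mem x : (exists2 X, F X & X x) -> exists X, [/\ F X, good (rl X) & X x].
    move=> [X FX Xx]; exists X; split=> //; case: (FP _ FX) => // X0'.
    by move: Xx; rewrite X0'.
  (* In a chain, the premises of each closure condition, at most three, hold together in one
     member. *)
  have mem2 x y : (exists2 X, F X & X x) -> (exists2 X, F X & X y) ->
      exists X, [/\ F X, good (rl X), X x & X y].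
    move=> /mem[X [FX gX Xx]] /mem[Y [FY gY Yy]].
    have [XY|YX] := Ft _ _ FX FY; first by exists Y; split=> //; exact: XY.
    by exists X; split=> //; exact: YX.
  have mem3 x y z : (exists2 X, F X & X x) -> (exists2 X, F X & X y) -> (exists2 X, F X & X z) ->
      exists X, [/\ F X, good (rl X), X x, X y & X z].
    move=> /mem2 h /h [X [FX gX Xx Xy]] /mem[Y [FY gY Yz]].
    have [XY|YX] := Ft _ _ FX FY; first by exists Y; split=> //; exact: XY.
    by exists X; split=> //; exact: YX.
  split; rewrite /rl.
  - by move=> t u /mem[X [FX gX h]]; exists X => //; exact: g_sym gX _ _ h.
  - by move=> t u v h1 /(mem2 _ _ h1)[X [FX gX tu uv]]; exists X => //; exact: g_trans gX _ _ _ tu uv.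
  - by move=> a; exists X0 => //; exact: g_const gX0 a.
  - by move=> a b; exists X0 => //; exact: g_constD gX0 a b.
  - by move=> a b; exists X0 => //; exact: g_constM gX0 a b.
  - by move=> t t' u u' h1 /(mem2 _ _ h1)[X [FX gX h2 h3]]; exists X => //; exact: (g_add gX).
  - by move=> t t' u u' h1 /(mem2 _ _ h1)[X [FX gX h2 h3]]; exists X => //; exact: (g_mul gX).
  - by move=> t u v h1 h2 /(mem3 _ _ _ h1 h2)[X [FX gX ? ? ?]]; exists X => //; exact: (g_addA gX).
  - by move=> t u h1 /(mem2 _ _ h1)[X [FX gX ? ?]]; exists X => //; exact: (g_addC gX).
  - by move=> t /mem[X [FX gX h]]; exists X => //; exact: (g_add0 gX).
  - by move=> t /mem[X [FX gX h]]; exists X => //; exact: (g_addN gX).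
  - by move=> t u v h1 h2 /(mem3 _ _ _ h1 h2)[X [FX gX ? ? ?]]; exists X => //; exact: (g_mulA gX).
  - by move=> t u h1 /(mem2 _ _ h1)[X [FX gX ? ?]]; exists X => //; exact: (g_mulC gX).
  - by move=> t /mem[X [FX gX h]]; exists X => //; exact: (g_mul1 gX).
  - by move=> t u v h1 h2 /(mem3 _ _ _ h1 h2)[X [FX gX ? ? ?]]; exists X => //; exact: (g_mulD gX).
  - by move=> /mem[X [FX gX h]]; exact: g_nz gX h.
  - by move=> t u /mem[X [FX gX /(g_subD gX)[? ?]]]; split; exists X.
  - by move=> t u /mem[X [FX gX /(g_subM gX)[? ?]]]; split; exists X.
  - move=> n rs i /mem[X [FX gX /(g_wit gX)[hW hr]]]; split=> [j|r rrs].
      by exists X => //; exact: hW.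
    by exists X => //; exact: hr.
have max E' : good E' -> (forall t u, rl X t u -> E' t u) -> forall t u, E' t u -> rl X t u.
  move=> gE' XE'; apply: contrapT => nsub.
  have lt : (X `<` [set x | E' x.1 x.2])%classic.
    split; first by move=> [t u] /XE'.
    by move=> sub; apply: nsub => t u; exact: (sub (t, u)).
  exact: Xmax lt (or_intror gE').
case: PX => [X0|gX]; last by exists (rl X).
have [E0 gE0] := good_init nz.
have := max _ gE0; rewrite X0 => /(_ (fun _ _ => False_ind _)) h.
by have := h _ _ (g_const gE0 0).
Qed.

(** Defined terms are evaluated through [phi], the witnesses of [rT] by [x], and composite terms
    componentwise. The overlapping clauses make this a relation, shown single-valued below. *)
Inductive ext_eval n (rT : seq (pexp T n)) (C : comPzRingType) (phi : T -> C)
    (E : T -> T -> Prop) (x : 'I_n -> C) : T -> C -> Prop :=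
  | Eval_dom t : E t t -> ext_eval rT phi E x t (phi t)
  | Eval_wit i : ext_eval rT phi E x (HW rT i) (x i)
  | Eval_add t u a b : ext_eval rT phi E x t a -> ext_eval rT phi E x u b ->
      ext_eval rT phi E x (HAdd t u) (a + b)
  | Eval_mul t u a b : ext_eval rT phi E x t a -> ext_eval rT phi E x u b ->
      ext_eval rT phi E x (HMul t u) (a * b).

Section Quotient.
Variables (E : T -> T -> Prop) (gE : good E).

Definition henkin_per : per_ring :=
  @PerRing T E (HC 0) (HC 1) (HMul (HC (-1))) (@HAdd R) (@HMul R)
    (g_sym gE) (g_trans gE) (g_const gE 0) (g_const gE 1)
    (fun t t' h => g_mul gE (g_const gE (-1)) h) (g_add gE) (g_mul gE)
    (g_addA gE) (g_addC gE) (g_add0 gE) (g_addN gE) (g_mulA gE) (g_mulC gE)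
    (g_mul1 gE) (g_mulD gE).

Local Notation K := (pquo henkin_per).
Local Notation cl := (@pcls henkin_per).

Lemma henkin_in : exists i : {rmorphism R -> K}, forall a, i a = cl (HC a).
Proof.
apply: rmorph_of => // a b; rewrite -?pclsD -?pclsM; try exact: (g_const gE).
  by apply: pcls_eq; exact: (g_constD gE).
by apply: pcls_eq; exact: (g_constM gE).
Qed.

Lemma henkin_nz : (1 : K) <> 0.
Proof.
rewrite -pcls1 -pcls0 => /pcls_rel h; apply: (g_nz gE); apply: h; exact: (g_const gE).
Qed.

(** Recovers the index from an equality of witnesses despite its dependent type. *)
Definition hidx (t : T) : nat := if t is HW _ _ i then i else 0%N.

Hypothesis maxE : forall E', good E' -> (forall t u, E t u -> E' t u) -> forall t u, E' t u -> E t u.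

Lemma henkin_wit n (rs : seq (pexp K n)) :
  (1 : pa rs) <> 0 -> exists y : 'I_n -> K, kills idfun y rs.
Proof.
move=> nz.
pose rT := [seq pmap (@prepr henkin_per) id r | r <- rs].
suff h : (forall i, E (HW rT i) (HW rT i)) /\ forall r, List.In r rT -> E (hsub (HW rT) r) (HC 0).
  exists (fun i => cl (HW rT i)) => r hr.
  have ev (s : pexp K n) : let t := hsub (HW rT) (pmap (@prepr henkin_per) id s) in
      E t t /\ peval idfun (fun i => cl (HW rT i)) s = cl t.
    elim: s => /= [a|i|s [Es ->] u [Eu ->]|s [Es ->] u [Eu ->]].
    - by split; [exact: (@prepr_dom henkin_per)|rewrite preprK].
    - by split=> //; exact: h.1.
    - by split; [exact: (g_add gE)|rewrite -(@pclsD henkin_per)].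
    - by split; [exact: (g_mul gE)|rewrite -(@pclsM henkin_per)].
  rewrite (ev r).2 -pcls0; apply: (@pcls_eq henkin_per); apply: h.2.
  exact: (List.in_map (pmap (@prepr henkin_per) id)).
(* If one witness is defined, goodness of [E] gives all of them and the equations. *)
have [[i hi]|no] := pselect (exists i, E (HW rT i) (HW rT i)).
  exact: (g_wit gE hi).
set C := pa rs in nz.
pose phi : {rmorphism K -> C} := pa_in rs.
pose V := ext_eval rT (fun t => phi (cl t)) E (pa_var rs).
have VE t : E t t -> V t (phi (cl t)) by move=> tt; exact: Eval_dom.
have cD t u : E t t -> E u u -> phi (cl (HAdd t u)) = phi (cl t) + phi (cl u).
  by move=> tt uu; rewrite -rmorphD -(@pclsD henkin_per).
have cM t u : E t t -> E u u -> phi (cl (HMul t u)) = phi (cl t) * phi (cl u).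
  by move=> tt uu; rewrite -rmorphM -(@pclsM henkin_per).
(* By [no], a witness of [rT] has no value through [E]; a sum or product defined in [E] has defined
   parts, so both ways of evaluating it agree. *)
have Vfun t a b : V t a -> V t b -> a = b.
  move=> ta; elim: ta b => {t a} [t tt|i|t u a b ta IHa ub IHb|t u a b ta IHa ub IHb] c.
  - move=> tc; elim: tc tt => {t c} [//|i|t u a b _ IHa _ IHb|t u a b _ IHa _ IHb] tt.
    + by case: no; exists i.
    + by have [tt' uu] := g_subD gE tt; rewrite cD // IHa // IHb.
    + by have [tt' uu] := g_subM gE tt; rewrite cM // IHa // IHb.
  - move e : (HW rT i) => t tc; case: tc e => [t' tt e|j e| |] //.
      by case: no; exists i; rewrite e.
    by congr pa_var; apply: val_inj; exact: (congr1 hidx e).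
  - move e : (HAdd t u) => v vc; case: vc e => [v' vv e|//|t' u' a' b' ta' ub' [et eu]|//].
      move: vv; rewrite -e => /(g_subD gE)[tt uu].
      by rewrite (IHa _ (VE _ tt)) (IHb _ (VE _ uu)) cD.
    by rewrite (IHa a') ?et // (IHb b') ?eu.
  - move e : (HMul t u) => v vc; case: vc e => [v' vv e|//|//|t' u' a' b' ta' ub' [et eu]].
      move: vv; rewrite -e => /(g_subM gE)[tt uu].
      by rewrite (IHa _ (VE _ tt)) (IHb _ (VE _ uu)) cM.
    by rewrite (IHa a') ?et // (IHb b') ?eu.
have [i0 i0E] := henkin_in.
have Vsub (r : pexp K n) : V (hsub (HW rT) (pmap (@prepr henkin_per) id r)) (peval phi (pa_var rs) r).
  elim: r => /= [a|i|r IHr s IHs|r IHr s IHs].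
  - rewrite -{2}(preprK a); apply: VE; exact: (@prepr_dom henkin_per).
  - exact: Eval_wit.
  - exact: Eval_add.
  - exact: Eval_mul.
have Vrel r : List.In r rT -> V (hsub (HW rT) r) 0.
  move=> /List.in_map_iff[s [<- hs]].
  by rewrite -(presented_kills (pa_presented rs) hs); exact: Vsub.
have gV : good (fun t u => exists2 a, V t a & V u a).
  apply: (good_eval (k := phi \o i0) Vfun _ _ _ nz).
  - by move=> a /=; rewrite i0E; apply: VE; exact: (g_const gE).
  - by move=> *; exact: Eval_add.
  - by move=> *; exact: Eval_mul.
  - move=> t u c; move e : (HAdd t u) => v vc; case: vc e => [v' vv e|//|t' u' a' b' ta' ub' [et eu]|//].
      move: vv; rewrite -e => /(g_subD gE)[tt uu].
      by exists (phi (cl t)), (phi (cl u)); split; exact: VE.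
    by exists a', b'; rewrite et eu.
  - move=> t u c; move e : (HMul t u) => v vc; case: vc e => [v' vv e|//|//|t' u' a' b' ta' ub' [et eu]].
      move: vv; rewrite -e => /(g_subM gE)[tt uu].
      by exists (phi (cl t)), (phi (cl u)); split; exact: VE.
    by exists a', b'; rewrite et eu.
  - move=> m ss j c; move e : (HW ss j) => v vc; case: vc e => [v' vv e|i e|//|//].
      move: vv; rewrite -e => /(g_wit gE)[hW hr]; split=> [k|r rr].
        by exists (phi (cl (HW ss k))); exact: VE.
      have rE := hr r rr; have E0 := g_const gE 0.
      have -> : (0 : C) = phi (cl (hsub (HW ss) r)).
        by rewrite (pcls_eq (rE : @pr_rel henkin_per _ _)) -(rmorph0 phi).
      by apply: VE; apply: (g_trans gE rE); exact: (g_sym gE).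
    (* Through [Q] the equality of two witnesses with different arities can be rewritten. *)
    pose Q (t : T) := match t with
      | HW p qs _ => (forall j, exists d, V (HW qs j) d) /\
          forall r, List.In r qs -> V (hsub (HW qs) r) 0
      | _ => True end.
    rewrite -/(Q (HW ss j)) e; split=> // k.
    by exists (pa_var rs k); exact: Eval_wit.
(* By maximality the enlarged relation is contained in [E], which therefore defines the witnesses of
   [rT]. *)
have sub := maxE gV (fun t u tu =>
  let tt := g_trans gE tu (g_sym gE tu) in let uu := g_trans gE (g_sym gE tu) tu in
  ex_intro2 _ _ (phi (cl t)) (VE t tt)
    (eq_ind_r (fun c => V u c) (VE u uu) (congr1 phi (pcls_eq (tu : @pr_rel henkin_per t u))))).
split=> [i|r hr]; apply: sub.
  by exists (pa_var rs i); exact: Eval_wit.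
exists 0; first exact: Vrel.
have := VE _ (g_const gE 0); rewrite -i0E.
by rewrite rmorph0 [phi 0]rmorph0.
Qed.
End Quotient.

End Henkin.

Definition closed_ring (K : comPzRingType) := (1 : K) <> 0 /\
  forall n (rs : seq (pexp K n)), (1 : pa rs) <> 0 -> exists y : 'I_n -> K, kills idfun y rs.

Lemma closed_extension (R : comPzRingType) : (1 : R) <> 0 ->
  exists (K : comPzRingType) (i : {rmorphism R -> K}), closed_ring K.
Proof.
move=> nz; have [E gE maxE] := good_max nz; have [i _] := henkin_in gE.
exists (pquo (henkin_per gE)), i; split; first exact: henkin_nz.
by move=> n rs; exact: henkin_wit.
Qed.

Lemma closed_retract (K B : comPzRingType) (g : {rmorphism K -> B}) :
  closed_ring K -> finitely_presented g -> (1 : B) <> 0 ->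
  exists r : {rmorphism B -> K}, r \o g =1 id.
Proof.
move=> [_ cl] [n [rs [x pres]]] nz.
have [h [_ _]] := presented_ext (pa_presented rs) (presented_kills pres).
have [|y ky] := cl n rs; first by move/(congr1 h); rewrite rmorph1 rmorph0.
by have [r [rg _]] := presented_ext pres ky; exists r.
Qed.

(** The equation $a = 0$ in no variables is solvable if $K/(a)$ is non-zero; otherwise [a] is
    invertible. *)
Lemma closed_field (K : comPzRingType) (a b : K) : closed_ring K -> a * b = 0 -> a = 0 \/ b = 0.
Proof.
move=> [nz cl] ab.
have [h|h] := pselect ((1 : pa [:: (PConst a : pexp K 0)]) = 0); last first.
  by left; have [y ky] := cl _ _ h; exact: (ky _ (or_introl erefl)).
right.
have [k [kf _]] := presented_ext (pa_presented [:: (PConst a : pexp K 0)])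
  (g := qin (fun z => z = a)) (y := fun j : 'I_0 => match notF (ltn_ord j) with end)
  (ltac:(by move=> t [<-|//]; apply/qin_eq0/idl_in)).
have : qin (fun z => z = a) (1 : K) = 0 by rewrite rmorph1 -(rmorph1 k) h rmorph0.
move/qin_eq0 => I1.
suff [c ->] : exists c, b = c * (a * b) by rewrite ab mulr0.
have : exists c, 1 = c * a.
  elim: I1 => [|c _ ->|x y _ [c ->] _ [d ->]]; [by exists 0; rewrite mul0r|by exists c|].
  by exists (c + d); rewrite mulrDl.
by case=> c hc; exists c; rewrite mulrA -hc mul1r.
Qed.

(** * Points and covers *)

Section ResidueField.
Variables (A : comPzRingType) (p : A -> Prop).
Hypothesis pp : prime_ideal p.

Let p0 : p 0. Proof. by case: pp. Qed.
Let pD x y : p x -> p y -> p (x + y). Proof. by case: pp => _ h _ _ _; exact: h. Qed.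
Let pM a x : p x -> p (a * x). Proof. by case: pp => _ _ h _ _; exact: h. Qed.
Let p1 : ~ p 1. Proof. by case: pp. Qed.
Let pP x y : p (x * y) -> p x \/ p y. Proof. by case: pp => _ _ _ _; exact. Qed.
Let pn x y : ~ p x -> ~ p y -> ~ p (x * y).
Proof. by move=> nx ny /pP[]. Qed.
Let p_eq x : x = 0 -> p x. Proof. by move=> ->. Qed.

(** The fraction field of $A/p$: a pair is a fraction, defined when its denominator is outside [p].
    Primality gives transitivity. *)
Definition residue_per : per_ring.
Proof.
refine (@PerRing (A * A) (fun t u => [/\ ~ p t.2, ~ p u.2 & p (t.1 * u.2 - u.1 * t.2)])
  (0, 1) (1, 1) (fun t => (- t.1, t.2)) (fun t u => (t.1 * u.2 + u.1 * t.2, t.2 * u.2))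
  (fun t u => (t.1 * u.1, t.2 * u.2)) _ _ _ _ _ _ _ _ _ _ _ _ _ _ _).
- by move=> t u [nt nu h]; split=> //; rewrite -opprB -mulN1r; exact: pM.
- move=> t u v [nt nu h] [_ nv h']; split=> //.
  suff /pP[//|//] : p (u.2 * (t.1 * v.2 - v.1 * t.2)).
  rewrite (_ : _ * _ = v.2 * (t.1 * u.2 - u.1 * t.2) + t.2 * (u.1 * v.2 - v.1 * u.2)); last by ring.
  by apply: pD; exact: pM.
- by split=> //; apply: p_eq; ring.
- by split=> //; apply: p_eq; ring.
- move=> t t' [nt nt' h]; split=> //=.
  rewrite (_ : _ - _ = -1 * (t.1 * t'.2 - t'.1 * t.2)); last by ring.
  exact: pM.
- move=> t t' u u' [nt nt' h] [nu nu' h']; split; [exact: pn|exact: pn|] => /=.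
  rewrite (_ : _ - _ = (u.2 * u'.2) * (t.1 * t'.2 - t'.1 * t.2) +
    (t.2 * t'.2) * (u.1 * u'.2 - u'.1 * u.2)); last by ring.
  by apply: pD; exact: pM.
- move=> t t' u u' [nt nt' h] [nu nu' h']; split; [exact: pn|exact: pn|] => /=.
  rewrite (_ : _ - _ = (u.1 * u'.2) * (t.1 * t'.2 - t'.1 * t.2) +
    (t'.1 * t.2) * (u.1 * u'.2 - u'.1 * u.2)); last by ring.
  by apply: pD; exact: pM.
all: move=> *; repeat match goal with H : and3 _ _ _ |- _ => destruct H end.
all: by split=> /=; [do ?apply: pn|do ?apply: pn|apply: p_eq; ring].
Defined.

Lemma residue_ring : exists (R : comPzRingType) (i : {rmorphism A -> R}),
  [/\ (1 : R) <> 0, forall a, p a -> i a = 0 & forall a, ~ p a -> exists b, i a * b = 1].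
Proof.
pose cl := @pcls residue_per.
have rf (t : A * A) : ~ p t.2 -> @pr_rel residue_per t t.
  by move=> nt; split=> //; apply: p_eq; ring.
have rf1 a : @pr_rel residue_per (a, 1) (a, 1) by exact: rf.
have [i iE] : exists i : {rmorphism A -> pquo residue_per}, i =1 fun a => cl (a, 1).
  apply: rmorph_of => [a b|a b|//]; rewrite /cl -?pclsD -?pclsM //; apply: pcls_eq.
    by split=> //=; rewrite ?mulr1 //; apply: p_eq; ring.
  by split=> //=; rewrite ?mulr1 //; apply: p_eq; ring.
exists (pquo residue_per), i; split.
- rewrite -pcls1 -pcls0 => /pcls_rel h.
  by have [|| _ _ /=] := h; [exact: rf1|exact: rf1|rewrite mulr1 mul0r subr0].
- by move=> a pa; rewrite iE -pcls0; apply: pcls_eq; split=> //=; rewrite mulr1 mul0r subr0.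
- move=> a na; have r1 : @pr_rel residue_per (1, a) (1, a) by exact: rf.
  exists (cl (1, a)); rewrite iE /cl -pclsM // -pcls1; apply: pcls_eq.
  by split=> //=; rewrite ?mul1r //; apply: p_eq; ring.
Qed.

(** Elements outside [p] become units in the residue field, so they cannot vanish in a non-zero
    extension. *)
Lemma closed_over_prime : exists (K : comPzRingType) (u : {rmorphism A -> K}),
  closed_ring K /\ forall a, p a <-> u a = 0.
Proof.
have [R [i [nz i0 iu]]] := residue_ring; have [K [j Kc]] := closed_extension nz.
exists K, (j \o i); split=> // a; split=> [pa|/= ia]; first by rewrite /= i0 // rmorph0.
apply: contrapT => /iu[b ab]; case: Kc => nzK _; apply: nzK.
by rewrite -(rmorph1 j) -ab rmorphM ia mul0r.
Qed.

End ResidueField.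

Lemma closed_point (K : comPzRingType) : closed_ring K -> is_point K.
Proof. by move=> Kc; split=> [|B g fp _ nz]; [case: Kc|exact: closed_retract]. Qed.

Lemma closed_ker_prime (A K : comPzRingType) (v : {rmorphism A -> K}) :
  closed_ring K -> prime_ideal (fun a => v a = 0).
Proof.
move=> Kc; split.
- exact: rmorph0.
- by move=> x y hx hy; rewrite rmorphD hx hy addr0.
- by move=> a x hx; rewrite rmorphM hx mulr0.
- by rewrite rmorph1; case: Kc.
- by move=> x y; rewrite rmorphM; exact: closed_field.
Qed.

Lemma indEt_base_change (A S B : comPzRingType) (u : {rmorphism A -> S}) (f : {rmorphism A -> B}) :
  indEt f -> indEt (tinl u f).
Proof.
move=> fi C D g Hg a b ab.
have sq : g \o (a \o u) =1 (b \o tinr u f) \o f.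
  by move=> x; apply: etrans (ab (u x)) _; exact: (congr1 b (tens_comm u f x)).
have [h [hf gh hu]] := fi _ _ _ Hg _ _ sq.
have [k [kl kr]] := tens_ext (fun x => esym (hf x)).
exists k; split=> //.
  apply: (tens_hom_eq (h := g \o k) (h' := b)) => x.
    exact: etrans (congr1 g (kl x)) (ab x).
  exact: etrans (congr1 g (kr x)) (gh x).
move=> k' k'l gk'; apply: tens_hom_eq => x; first exact: etrans (k'l x) (esym (kl x)).
rewrite (kr x); apply: (hu (k' \o tinr u f)) => y; last exact: gk'.
exact: etrans (congr1 k' (esym (tens_comm u f y))) (k'l (u y)).
Qed.

(* Flatness embeds (A/p) (x) B, which maps onto the non-zero ring B/q, into
   K (x) B. *)
Lemma flat_tens_nz (A B K : comPzRingType) (u : {rmorphism A -> K}) (f : {rmorphism A -> B})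
    (q : B -> Prop) :
  flat f -> prime_ideal q -> (forall a, u a = 0 <-> q (f a)) -> (1 : tens u f) <> 0.
Proof.
move=> fl [q0 qD qM q1 _] uq T0.
have qI x : idl q x -> q x by elim=> [|a s /qM//|y z _ hy _ hz]; [|exact: qD].
(* [s] chooses preimages under [u], with value 0 outside the image. *)
have [s sK] : exists s : K -> A, forall y, (exists a, y = u a) -> u (s y) = y.
  apply: (choice_fun (P := fun y a => (exists a, y = u a) -> u a = y)) => y.
  have [[a ya]|no] := pselect (exists a, y = u a); first by exists a.
  by exists 0 => h; case: no.
pose N : lmodType A := amod u.
have D0 : exists a, ((0 : N) : K) = u a by exists 0; rewrite rmorph0.
have DD (x y : N) : (exists a, (x : K) = u a) -> (exists a, (y : K) = u a) ->
    exists a, ((x + y : N) : K) = u a.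
  by move=> [a xa] [b yb]; exists (a + b); rewrite rmorphD -xa -yb.
have DZ a (x : N) : (exists b, (x : K) = u b) -> exists b, ((a *: x : N) : K) = u b.
  by move=> [b xb]; exists (a * b); rewrite rmorphM -xb.
(* [D] is the image of [u], a copy of $A/p$ inside [K]. *)
pose D := @Submod A N (fun x => exists a, (x : K) = u a) D0 DD DZ.
have t0 : tens_eq f [:: ((1 : K) : N, 1)] [::].
  by apply: tens_sum_eq; rewrite big_seq1 big_nil /= !rmorph1 mul1r.
(* This makes $(u(a), b) |-> f(a) b$ well defined from $A/p$ and $B$ to $B/q$. *)
have phi_eq a a' b : u a = u a' -> qin q (f a * b) = qin q (f a' * b).
  move=> e; apply/eqP; rewrite -subr_eq0 -rmorphB -mulrBl -rmorphB; apply/eqP/qin_eq0.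
  by rewrite mulrC; apply/idl_mem/uq; rewrite rmorphB e subrr.
have := @flat_sub A N D B f (quot q) (fun y b => qin q (f (s y) * b)) _ fl _ _ _ _ t0.
rewrite big_seq1 /= mulr1 => H.
apply: q1; have : q (f (s 1)).
  apply/qI/qin_eq0; apply: H => [m m' b hm hm'|m b b' _|a m b hm|x].
  - rewrite -rmorphD -mulrDl -rmorphD; apply: phi_eq.
    by rewrite rmorphD !sK //; exact: (DD).
  - by rewrite mulrDr rmorphD.
  - rewrite mulrA [f _ * f a]mulrC -rmorphM; apply: phi_eq.
    by rewrite rmorphM !sK //; exact: (DZ).
  - by rewrite inE => /eqP -> /=; exists 1; rewrite rmorph1.
move/uq; rewrite sK; last by exists 1; rewrite rmorph1.
by move=> K1; rewrite -(rmorph1 f); apply/uq; rewrite rmorph1.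
Qed.

Theorem proposition70 (A : comPzRingType) (I : Type) (B : I -> comPzRingType)
    (f : forall i : I, {rmorphism A -> B i}) :
  point_covering_family f <-> etale_cover f.
Proof.
split=> [[ind cov]|[et cov]]; split.
- by move=> i; exact/fp_etale_indEt/ind.
- move=> p pp; have [K [u [Kc pu]]] := closed_over_prime pp.
  have [i [v vf]] := cov _ (closed_point Kc) u.
  exists i, (fun b => v b = 0); split; first exact: closed_ker_prime.
  by move=> a; rewrite pu -(vf a).
- by move=> i; exact/fp_etale_indEt/et.
move=> K [nz Kp] u; have [K' [w K'c]] := closed_extension nz.
have [i [q [qp pq]]] := cov _ (closed_ker_prime (w \o u) K'c).
have [fl _ _] := et i; have [fp fi] := (fp_etale_indEt (f i)).1 (et i).
exists i; have [n [rs [x pres]]] := fp.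
have fpl : finitely_presented (tinl u (f i)).
  by eexists; eexists; eexists; exact: tens_presented pres.
have [|r rl] := Kp _ _ fpl (indEt_base_change (u := u) fi).
  move=> T0; apply: (flat_tens_nz fl qp pq).
  (* $K (x) B_i$ maps to $K' (x) B_i$, which is non-zero, so it is non-zero itself. *)
  have [k _] := tens_ext (g := tinl (w \o u) (f i) \o w) (h := tinr (w \o u) (f i))
    (tens_comm (w \o u) (f i)).
  by rewrite -(rmorph1 k) T0 rmorph0.
exists (r \o tinr u (f i)) => a.
apply: etrans (congr1 r (esym (tens_comm u (f i) a))) _; exact: rl.
Qed.
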